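(* Let $(\nu_t)_{t\in[0,1]}$ be a family of probability measures on $\mathbb R^q$. Assume that $C(\nu_t)$ is nonempty and that $\mathcal W$ has an $I$-projection $\mathcal W^*$ on $C(\nu_t)$ such that $\log\frac{d\mathcal W^*}{d\mathcal W}$ is bounded and continuous. Assume in addition that the initial law $\mu_0$ has a polynomial concentration rate, i.e. $\mu_0(B(0,R)^c)\le \kappa/R^m$ for some constants $\kappa,m>0$ and all $R>0$. If $\varepsilon_n=1/(\log n)^r$ for some $0<r<\frac1{2q}$, then for every integer $k\ge1$ the conditional laws $$\mathcal W^n_{\varepsilon_n,k}:=\mathcal L\big(X_1,\dots,X_k\mid L_n\in C^{\varepsilon_n}(\nu_t)\big)$$ converge to $(\mathcal W^* )^{\otimes k}$ in total variation distance as $n\to\infty$.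
   Context: $E=C^0([0,1],\mathbb R^q)$ with the sup-norm, $M_1(E)$ the set of Borel probability measures on $E$, $\mathcal W\in M_1(E)$ the Wiener measure (law of Brownian motion on $\mathbb R^q$) with initial law $\mu_0$. $X_1,X_2,\dots$ are i.i.d. with law $\mathcal W$ and $L_n=\frac1n\sum_{j=1}^n\delta_{X_j}$. For $\mathcal V\in M_1(E)$, $\mathcal V_t$ is the marginal law at time $t$. Define $$C(\nu_t)=\{\mathcal V\in M_1(E):\forall t\in[0,1],\ \mathcal V_t=\nu_t\},\qquad C^\varepsilon(\nu_t)=\{\mathcal V\in M_1(E):\bar d(\mathcal V,C(\nu_t))\le\varepsilon\}\quad(\varepsilon>0).$$ $\bar d$ is one of the two metrics on $M_1(E)$ (with $d$ the sup-distance on $E$): the Prohorov metric $d_P(\nu,\nu')=\inf\{r>0:\sup_A(\nu(A)-\nu'(A^r))\le r\}$, where $A$ ranges over Borel sets and $A^r=\{x:d(x,A)\le r\}$; or the Fortet–Mourier metric $d_{FM}(\nu,\nu')=\sup\{\int f(d\nu-d\nu'):f\text{ bounded Lipschitz},\ \|f\|_\infty+\|f\|_{Lip}\le1\}$. $H(\beta\mid\gamma)=\int\log\frac{d\beta}{d\gamma}d\beta$ if $\beta\ll\gamma$ and this is finite, $+\infty$ otherwise. The $I$-projection of $\mathcal W$ on a convex set $C$ is the unique $\mathcal W^*\in C$ with $H(\mathcal W^*\mid\mathcal W)=\inf_{\mathcal V\in C}H(\mathcal V\mid\mathcal W)<+\infty$, if it exists. $B(0,R)$ is the ball of radius $R$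 in $\mathbb R^q$ and $B(0,R)^c$ its complement. *)

(* Defs.v *)
From HB Require Import structures.
From mathcomp Require Import all_boot all_order all_algebra.
From mathcomp Require Import all_classical all_reals all_analysis.
From mathcomp Require Import giry ring.

Set Implicit Arguments.
Unset Strict Implicit.
Unset Printing Implicit Defensive.
Import Order.TTheory GRing.Theory Num.Theory.
Import numFieldTopology.Exports numFieldNormedType.Exports.

Local Open Scope classical_set_scope.
Local Open Scope ring_scope.

Section euclidean_norm.
Context {R : realType} {q : nat}.
Implicit Types x y : 'rV[R]_q.

(* The norm `|x| of the library on 'rV[R]_q is the max-norm. *)
Definition enorm x : R := Num.sqrt (\sum_(j < q) x 0 j ^+ 2).

Lemma enorm_ge0 x : 0 <= enorm x.
Proof. exact: sqrtr_ge0. Qed.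

Lemma enorm0 : enorm 0 = 0.
Proof. by rewrite /enorm big1 ?sqrtr0// => j _; rewrite mxE expr0n. Qed.

Lemma enormN x : enorm (- x) = enorm x.
Proof.
by rewrite /enorm; congr Num.sqrt; apply: eq_bigr => j _; rewrite mxE sqrrN.
Qed.

Lemma enorm_eq0 x : enorm x = 0 -> x = 0.
Proof.
move/eqP; rewrite sqrtr_eq0 => x0.
have s0 : \sum_(j < q) x 0 j ^+ 2 == 0.
  by rewrite eq_le x0 sumr_ge0// => j _; exact: sqr_ge0.
apply/rowP => j; rewrite mxE; apply/eqP.
rewrite psumr_eq0 in s0; last by move=> i _; exact: sqr_ge0.
by move/allP: s0 => /(_ j); rewrite mem_index_enum /= sqrf_eq0; apply.
Qed.

Lemma enorm_sqr x : enorm x ^+ 2 = \sum_(j < q) x 0 j ^+ 2.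
Proof. by rewrite sqr_sqrtr// sumr_ge0// => j _; exact: sqr_ge0. Qed.

Lemma le_dot_enorm x y : \sum_(j < q) x 0 j * y 0 j <= enorm x * enorm y.
Proof.
have [x0|xn0] := eqVneq (enorm x) 0.
  by rewrite x0 mul0r (enorm_eq0 x0) big1// => j _; rewrite mxE mul0r.
have [y0|yn0] := eqVneq (enorm y) 0.
  by rewrite y0 mulr0 (enorm_eq0 y0) big1// => j _; rewrite mxE mulr0.
set a := enorm x; set b := enorm y.
have ap : 0 < a by rewrite lt_neqAle eq_sym xn0 enorm_ge0.
have bp : 0 < b by rewrite lt_neqAle eq_sym yn0 enorm_ge0.
have h j : 2 * (a * b) * (x 0 j * y 0 j) <=
           b ^+ 2 * x 0 j ^+ 2 + a ^+ 2 * y 0 j ^+ 2.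
  rewrite -subr_ge0 [leRHS](_ : _ = (b * x 0 j - a * y 0 j) ^+ 2) ?sqr_ge0//.
  by rewrite sqrrB !exprMn mulr2n; ring.
have : 2 * (a * b) * (\sum_(j < q) x 0 j * y 0 j) <= 2 * (a * b) * (a * b).
  rewrite mulr_sumr; apply: le_trans (ler_sum _ (fun j _ => h j)) _.
  rewrite big_split/= -!mulr_sumr -!enorm_sqr -/a -/b.
  by rewrite le_eqVlt; apply/orP; left; apply/eqP; ring.
by rewrite ler_pM2l// mulr_gt0// mulr_gt0.
Qed.

Lemma ler_enormD x y : enorm (x + y) <= enorm x + enorm y.
Proof.
rewrite -(@ler_pXn2r _ 2)// ?nnegrE ?addr_ge0 ?enorm_ge0//.
rewrite sqrrD !enorm_sqr.
rewrite (eq_bigr (fun j => x 0 j ^+ 2 + (x 0 j * y 0 j) *+ 2 + y 0 j ^+ 2));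
  last by move=> j _; rewrite mxE sqrrD.
by rewrite !big_split/= lerD2r lerD2l mulr2n lerD ?le_dot_enorm.
Qed.

Lemma continuous_enorm : continuous (enorm : 'rV[R]_q -> R).
Proof.
move=> x; apply: (@continuous_comp _ _ _ (fun x => \sum_(j < q) x 0 j ^+ 2)).
  move: x; apply: continuous_big; first exact: add_continuous.
  move=> j _ x; apply: (@continuous_comp _ _ _ _ (fun r : R => r ^+ 2)).
    exact: coord_continuous.
  exact: exprn_continuous.
exact: sqrt_continuous.
Qed.

End euclidean_norm.

Section unit_interval.
Context (R : realType).

Definition unit_itv : Type := set_type (`[0, 1]%classic : set R).
HB.instance Definition _ := Topological.on unit_itv.
HB.instance Definition _ := Choice.on unit_itv.

Let unit_itv0_subproof : (0 : R) \in (`[0, 1]%classic : set R).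
Proof. by rewrite inE /= in_itv/= lexx ler01. Qed.

Definition unit_itv0 : unit_itv := exist _ 0 unit_itv0_subproof.

Let clamp_subproof (r : R) :
  Num.max 0 (Num.min 1 r) \in (`[0, 1]%classic : set R).
Proof.
by rewrite inE /= in_itv/= le_max lexx/= ge_max ler01 ge_min lexx.
Qed.

Let clamp (r : R) : unit_itv :=
  exist (fun x => x \in (`[0, 1]%classic : set R)) _ (clamp_subproof r).

Let continuous_clamp : continuous clamp.
Proof.
apply: continuous_comp_initial => r.
suff : {for r, continuous ((cst 0 : R -> R^o) \max (cst 1 \min id))} by [].
apply: continuous_max; first exact: cvg_cst.
by apply: continuous_min; [exact: cvg_cst|exact: cvg_id].
Qed.

Lemma compact_unit_itv : compact [set: unit_itv].
Proof.
have -> : [set: unit_itv] = clamp @` `[0, 1]%classic.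
  apply/seteqP; split=> // -[r r01] _ /=; exists r; first exact: set_mem.
  apply: val_inj => /=.
  by move/set_mem: r01; rewrite /= in_itv/= => /andP[r0 r1]; rewrite min_r// max_r.
apply: continuous_compact; last exact: segment_compact.
by apply: continuous_subspaceT => r; exact: continuous_clamp.
Qed.

End unit_interval.
Arguments unit_itv0 {R}.

Section path_space.
Context (R : realType) (q : nat).

Definition path_space : Type := continuousType (unit_itv R) 'rV[R]_q.
HB.instance Definition _ := Choice.on path_space.

Definition path_eval (t : unit_itv R) (x : path_space) : 'rV[R]_q := x t.

Let continuous_zero : continuous (fun _ : unit_itv R => 0 : 'rV[R]_q).
Proof. exact: cst_continuous. Qed.

HB.instance Definition _ :=
  isPointed.Build path_space (mkcts continuous_zero).

Definition sup_dist (x y : path_space) : R :=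
  sup (range (fun t => enorm (path_eval t x - path_eval t y))).

Let has_sup_enorm (x y : path_space) :
  has_sup (range (fun t => enorm (path_eval t x - path_eval t y))).
Proof.
apply: compact_has_sup; first by eexists; exists unit_itv0.
apply: continuous_compact; last exact: compact_unit_itv.
apply: continuous_subspaceT => t.
apply: (@continuous_comp _ _ _ (fun t => x t - y t)); last exact: continuous_enorm.
apply: cvgB; [exact: nbhs_filter
  |exact: (@cts_fun _ _ (x : continuousType _ _) t)
  |exact: (@cts_fun _ _ (y : continuousType _ _) t)].
Qed.

Let sup_dist_ub (x y : path_space) t :
  enorm (path_eval t x - path_eval t y) <= sup_dist x y.
Proof. by apply: sup_upper_bound; [exact: has_sup_enorm|exists t]. Qed.

Let sup_dist_le (x y : path_space) (a : R) :
  (forall t, enorm (path_eval t x - path_eval t y) <= a) -> sup_dist x y <= a.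
Proof.
move=> xya; apply: ge_sup; first by have [] := has_sup_enorm x y.
by move=> _ [t _ <-].
Qed.

Let sup_distxx x : sup_dist x x = 0.
Proof.
apply/eqP; rewrite eq_le; apply/andP; split.
  by apply: sup_dist_le => t; rewrite subrr enorm0.
exact: le_trans (enorm_ge0 _) (sup_dist_ub x x unit_itv0).
Qed.

Let sup_dist_positivity x y : sup_dist x y = 0 -> x = y.
Proof.
move=> xy0; apply/continuousEP => t; apply/eqP; rewrite -subr_eq0; apply/eqP.
apply: enorm_eq0; apply/eqP; rewrite eq_le enorm_ge0 andbT -xy0.
exact: sup_dist_ub.
Qed.

Let sup_dist_sym x y : sup_dist x y = sup_dist y x.
Proof.
by congr sup; congr image; apply/funext => t; rewrite -enormN opprB.
Qed.

Let sup_dist_triangle y x z : sup_dist x z <= sup_dist x y + sup_dist y z.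
Proof.
apply: sup_dist_le => t; rewrite -(subrKA (path_eval t y)).
by apply: le_trans (ler_enormD _ _) _; apply: lerD; exact: sup_dist_ub.
Qed.

HB.instance Definition _ := isMetric.Build R path_space
  sup_distxx sup_dist_positivity sup_dist_sym sup_dist_triangle.

End path_space.

HB.instance Definition _ (R : realType) (q : nat) :=
  @isMeasurable.Build (sigma_display (@open (path_space R q))) (path_space R q)
    <<s @open (path_space R q) >> (@sigma_algebra0 _ setT _)
    (@sigma_algebraC _ _) (@sigma_algebra_bigcup _ setT _).

HB.instance Definition _ (R : realType) (m n : nat) :=
  @isMeasurable.Build (sigma_display (@open 'M[R]_(m, n))) 'M[R]_(m, n)
    <<s @open 'M[R]_(m, n) >> (@sigma_algebra0 _ setT _)
    (@sigma_algebraC _ _) (@sigma_algebra_bigcup _ setT _).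

Section wiener_measure.
Local Open Scope ereal_scope.
Context {R : realType} {q : nat}.

(* W is the law of a Brownian motion started from mu0: the position at time 0
   has law mu0, and is independent of the increments over consecutive time
   intervals, whose coordinates are independent and centered Gaussian with
   variance (hence the square root) the length of the interval. *)
Definition is_wiener (mu0 : probability 'rV[R]_q R)
    (W : probability (path_space R q) R) :=
  forall (n : nat) (t : nat -> unit_itv R)
      (A : set 'rV[R]_q) (B : 'I_n -> 'I_q -> set R),
    val (t 0%N) = 0%R ->
    (forall i : 'I_n, (val (t i) < val (t i.+1))%R) ->
    measurable A -> (forall i j, measurable (B i j)) ->
  W [set x | A (path_eval (t 0%N) x) /\
      forall i j, B i j (path_eval (t i.+1) x 0%R j - path_eval (t i) x 0%R j)%R]
  = mu0 A * \prod_(i < n) \prod_(j < q)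
      normal_prob 0 (Num.sqrt (val (t i.+1) - val (t i))) (B i j).

End wiener_measure.

Section metrics_on_probabilities.
Local Open Scope ereal_scope.
Context {R : realType} {q : nat}.
Local Notation E := (path_space R q).
Implicit Types (nu : probability E R) (A : set E) (f : E -> R).

(* The distance to the empty set is +oo. *)
Definition dist_to_set A (x : E) : \bar R := ereal_inf [set (mdist x y)%:E | y in A].

Definition enlargement A (r : R) : set E := [set x | dist_to_set A x <= r%:E].

Definition prohorov nu nu' : \bar R :=
  ereal_inf [set r%:E | r in [set r : R | (0 < r)%R /\
    ereal_sup [set nu A - nu' (enlargement A r) | A in measurable] <= r%:E]].

Definition sup_norm f : \bar R := ereal_sup [set `|f x|%:E | x in setT].

(* The pairs (x, x) contribute 0 / 0 = 0. *)
Definition lip_norm f : \bar R :=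
  ereal_sup [set (`|f p.1 - f p.2| / mdist p.1 p.2)%:E | p in setT].

Definition fortet_mourier nu nu' : \bar R :=
  ereal_sup [set \int[nu]_x (f x)%:E - \int[nu']_x (f x)%:E |
    f in [set f | sup_norm f + lip_norm f <= 1]].

End metrics_on_probabilities.

Section marginals.
Local Open Scope ereal_scope.
Context {R : realType} {q : nat}.
Local Notation E := (path_space R q).

(* Measures of the library are functions on all sets, hence the restriction to
   measurable sets when comparing them. *)
Definition marginal_constraint (nu : unit_itv R -> probability 'rV[R]_q R) :
    set (probability E R) :=
  [set V | forall t A, measurable A -> pushforward V (path_eval t) A = nu t A].

Definition thickened_constraint (dbar : probability E R -> probability E R -> \bar R)
    (nu : unit_itv R -> probability 'rV[R]_q R) (eps : R) :
    set (probability E R) :=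
  [set V | ereal_inf [set dbar V U | U in marginal_constraint nu] <= eps%:E].

End marginals.

Section probability_notions.
Local Open Scope ereal_scope.
Context {d} {T : measurableType d} {R : realType}.

Definition log_density (beta gamma : probability T R) : T -> \bar R :=
  fun x => lne (Radon_Nikodym (charge_of_finite_measure beta) gamma x).

Definition relative_entropy (beta gamma : probability T R) : \bar R :=
  if `[< beta `<< gamma /\ \int[beta]_x log_density beta gamma x \is a fin_num >]
  then \int[beta]_x log_density beta gamma x else +oo.

Definition is_I_projection (W : probability T R) (C : set (probability T R))
    (Wstar : probability T R) :=
  [/\ C Wstar,
      relative_entropy Wstar W = ereal_inf [set relative_entropy V W | V in C],
      relative_entropy Wstar W < +oo &
      forall V, C V -> relative_entropy V W = relative_entropy Wstar W ->
        measure_eq V Wstar].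

(* The empirical measure of the first n.+1 terms of x. *)
Section empirical.
Variables (n : nat) (x : nat -> T).

Definition empirical : set T -> \bar R :=
  mscale (n.+1%:R^-1%:nng : {nonneg R})%R (msum (fun j => \d_(x j)) n.+1).

HB.instance Definition _ := Measure.on empirical.

Let empirical_setT : empirical setT = 1.
Proof.
rewrite /empirical /mscale /= /msum.
rewrite (eq_bigr (fun=> 1)) => [|j _]; last exact: diracT.
by rewrite sumEFin sumr_const card_ord -EFinM mulVf.
Qed.

HB.instance Definition _ :=
  Measure_isProbability.Build _ _ _ empirical empirical_setT.
End empirical.

Definition tv_dist (mu nu : set T -> \bar R) : \bar R :=
  ereal_sup [set `|mu A - nu A| | A in measurable].

Let cons_tuple n (p : T * n.-tuple T) : n.+1.-tuple T := [tuple of p.1 :: p.2].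

Let measurable_cons_tuple n : measurable_fun setT (@cons_tuple n).
Proof. by apply: measurable_cons. Qed.

HB.instance Definition _ n :=
  isMeasurableFun.Build _ _ _ _ (@cons_tuple n) (@measurable_cons_tuple n).

Fixpoint tuple_power (mu : probability T R) (k : nat) :
    probability (k.-tuple T) R :=
  match k with
  | 0 => \d_[tuple]
  | k'.+1 => distribution
      (mu \x tuple_power mu k') (@cons_tuple k')
  end.

End probability_notions.

Section conditioning.
Local Open Scope ereal_scope.
Context {d d'} {Omega : measurableType d} {T : measurableType d'} {R : realType}.
Variable P : probability Omega R.

Definition mutually_independent (X : nat -> Omega -> T) :=
  forall (s : seq nat) (A : nat -> set T), uniq s ->
    (forall j, measurable (A j)) ->
  P [set w | forall j, j \in s -> A j (X j w)] =
    \prod_(j <- s) P (X j @^-1` A j).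

(* The zero function when P D = 0. *)
Definition conditional_law (Y : Omega -> T) (D : set Omega) : set T -> \bar R :=
  fun A => (fine (P (Y @^-1` A `&` D)) / fine (P D))%:E.

End conditioning.

(* Main.v *)
Require Import Defs.
From mathcomp Require Import all_boot all_order all_algebra.
From mathcomp Require Import all_classical all_reals all_analysis.
From HB Require Import structures.
From mathcomp Require Import measurable_realfun zify ring lra.
Import Order.TTheory GRing.Theory Num.Theory.
Import numFieldTopology.Exports numFieldNormedType.Exports.
Local Open Scope classical_set_scope.
Local Open Scope ring_scope.

(** The theorem is a Gibbs conditioning principle for shrinking constraint sets,
made quantitative enough to survive thickenings of size [1 / (ln n) ^ r].

Write [N] for the number of samples, [D] for the conditioning event seen as a
set of sequences, [p] for its probability, and [H] for the entropy of [Wstar]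
relative to [W], which is the mean of the log-density [phi] under [Wstar].
Tilting [N] samples by [phi] turns [W] into [Wstar].  If [B] is an event on [k]
samples and [K] disjoint blocks of length [k] fit into the sample, the
variational formula for the entropy of a conditional law, tested with [s] times
the number of blocks in [B] plus the sum of [phi], gives
(lemma [conditional_block_bound])
   [s * (P (B | D) - Wstar^k B) <= 2 * s^2 + (- ln p - N * mean Pi phi) / K],
where [Pi] is the mean of the empirical measure conditionally on [D].  Both signs
of [s] are allowed, and [B] enters only through the left-hand side.  So total
variation convergence follows (lemma [gibbs_conditioning]) once
[- ln p <= N * (H + o(1))] and [mean Pi phi] tends to [H].

For the second point, conditioning costs [- ln p] in entropy, hence the entropy
of [Pi] is at most [- ln p / N <= H + o(1)]; and [Pi] nearly satisfies the
marginal constraints because the empirical measure does on [D].  The set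
[relaxed_constraint] replaces the thickened constraint by linear inequalities
that are stable under averaging and that shrink to the constraint itself.  By
strong convexity of the entropy (lemma [dv_entropy_midpoint]), near minimisers
over such sets are close to each other in total variation, and their limits
satisfy the constraint, so near minimisers are close to the projection
(lemma [mean_near_projection]).

For the first point, changing the measure from [W] to [Wstar] costs
[exp (- N * (H + o(1)))] by the law of large numbers for [phi], so it is enough
that [D] has probability at least [1 / 2] under [Wstar].  Since [Wstar] satisfies
the constraint, it suffices that the empirical measure of a sample of [Wstar] is
within [1 / (ln N) ^ r] of [Wstar].  Paths are sorted into finitely many cells
according to their rounded values on a dyadic grid of level [L].  As Brownian
paths are Hoelder of any exponent below [1 / 2], some [rho < 2 ^ (- r)] makes
the cells have diameter of order [rho ^ L] and miss a set of [W]-measure of that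
order; the tail of the initial law enters here, and the bound on [phi] transfers
the estimate to [Wstar] (lemma [wiener_cells]).  There are about
[exp (L * 2 ^ L)] cells, which is a small power of [N] when [2 ^ L] is about
[ln N / ln (ln N)].  Then Chernoff bounds control all the cells together
(lemma [sample_event_lower]), and [rho ^ L] is smaller than [1 / (ln N) ^ r].

Entropies are handled in Donsker-Varadhan form, through exponential moments of
bounded functions, so that densities appear only when relating that form to the
entropy defined by a Radon-Nikodym derivative. *)

Set Implicit Arguments.
Unset Strict Implicit.
Unset Printing Implicit Defensive.

(** * Means of bounded measurable functions *)

(** Only such functions are integrated: sums, products, exponentials and partial
means stay in the class, and no integrability condition ever has to be checked. *)
Definition bounded_measurable d (T : measurableType d) (R : realType)
    (f : T -> R) : Prop :=
  measurable_fun setT f /\ exists M : R, forall x, `|f x| <= M.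

Definition mean d (T : measurableType d) (R : realType)
    (mu : {measure set T -> \bar R}) (f : T -> R) : R := \int[mu]_x f x.

Section bounded_measurable.
Context d (T : measurableType d) (R : realType).
Implicit Types f g : T -> R.
Local Notation bm := (@bounded_measurable d T R).

Lemma bm_measurable f : bm f -> measurable_fun setT f.
Proof. by case. Qed.

Lemma bm_bound f : bm f -> exists2 M : R, 0 < M & forall x, `|f x| <= M.
Proof.
case=> _ [M Mf]; exists (`|M| + 1); first by rewrite ltr_wpDl.
move=> x; rewrite (le_trans (Mf x))// (le_trans (ler_norm _))//.
by rewrite lerDl.
Qed.

Lemma bm_cst (c : R) : bm (fun=> c).
Proof. by split; [exact: measurable_cst|exists `|c|]. Qed.

Lemma bmN f : bm f -> bm (fun x => - f x).
Proof.
move=> [mf [M Mf]]; split; first exact: measurableT_comp.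
by exists M => x; rewrite normrN.
Qed.

Lemma bmD f g : bm f -> bm g -> bm (fun x => f x + g x).
Proof.
move=> [mf [M Mf]] [mg [N Ng]]; split; first exact: measurable_funD.
by exists (M + N) => x; rewrite (le_trans (ler_normD _ _))// lerD.
Qed.

Lemma bmB f g : bm f -> bm g -> bm (fun x => f x - g x).
Proof. by move=> bf bg; apply: bmD => //; exact: bmN. Qed.

Lemma bmM f g : bm f -> bm g -> bm (fun x => f x * g x).
Proof.
move=> [mf [M Mf]] [mg [N Ng]]; split; first exact: measurable_funM.
by exists (M * N) => x; rewrite normrM ler_pM.
Qed.

Lemma bmZ (c : R) f : bm f -> bm (fun x => c * f x).
Proof. by apply: bmM; exact: bm_cst. Qed.

Lemma bm_expR f : bm f -> bm (fun x => expR (f x)).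
Proof.
move=> [mf [M Mf]]; split; first exact: measurableT_comp.
exists (expR M) => x; rewrite ger0_norm ?expR_ge0// ler_expR.
exact: le_trans (ler_norm _) (Mf x).
Qed.

Lemma bm_indic (A : set T) : measurable A -> bm (\1_A : T -> R).
Proof.
move=> mA; split; first exact: measurable_indic.
by exists 1 => x; rewrite indicE; case: (_ \in _); rewrite ?normr1// normr0.
Qed.

Lemma bm_sum (I : Type) (s : seq I) (F : I -> T -> R) :
  (forall i, bm (F i)) -> bm (fun x => \sum_(i <- s) F i x).
Proof.
move=> bF; elim: s => [|i s ih].
  by under eq_fun do rewrite big_nil; exact: bm_cst.
by under eq_fun do rewrite big_cons; exact: bmD.
Qed.

Lemma bm_prod (I : Type) (s : seq I) (F : I -> T -> R) :
  (forall i, bm (F i)) -> bm (fun x => \prod_(i <- s) F i x).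
Proof.
move=> bF; elim: s => [|i s ih].
  by under eq_fun do rewrite big_nil; exact: bm_cst.
by under eq_fun do rewrite big_cons; exact: bmM.
Qed.

End bounded_measurable.

Lemma bm_comp d d' (T : measurableType d) (T' : measurableType d')
    (R : realType) (f : T' -> R) (g : T -> T') :
  measurable_fun setT g -> bounded_measurable f ->
  bounded_measurable (fun x => f (g x)).
Proof.
move=> mg [mf [M Mf]]; split; last by exists M.
exact: (measurableT_comp mf mg).
Qed.

Section mean_theory.
Context d (T : measurableType d) (R : realType).
Implicit Types (f g : T -> R) (mu : probability T R) (A : set T).
Local Notation bm := (@bounded_measurable d T R).

Lemma bm_integrable mu f : bm f -> mu.-integrable setT (EFin \o f).
Proof.
move=> [mf [M Mf]]; apply: measurable_bounded_integrable => //.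
  by rewrite fin_num_fun_lty// ; exact: fin_num_measure.
by exists M; split; rewrite ?num_real// => N MN x _ /=; rewrite (le_trans (Mf x))// ltW.
Qed.

Lemma mean_EFin mu f : bm f -> (\int[mu]_x (f x)%:E)%E = (mean mu f)%:E.
Proof.
move=> bf; rewrite /mean /Rintegral fineK//.
exact: (integrable_fin_num measurableT (bm_integrable mu bf)).
Qed.

Lemma mean_cst mu (c : R) : mean mu (fun=> c) = c.
Proof. by rewrite /mean Rintegral_cst// -[X in fine X](_ : 1%E = _) ?mulr1//= probability_setT. Qed.

Lemma meanD mu f g : bm f -> bm g ->
  mean mu (fun x => f x + g x) = mean mu f + mean mu g.
Proof. by move=> bf bg; rewrite /mean RintegralD//; exact: bm_integrable. Qed.

Lemma meanZ mu (c : R) f : bm f -> mean mu (fun x => c * f x) = c * mean mu f.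
Proof. by move=> bf; rewrite /mean RintegralZl//; exact: bm_integrable. Qed.

Lemma meanN mu f : bm f -> mean mu (fun x => - f x) = - mean mu f.
Proof.
move=> bf; rewrite -mulN1r -meanZ//.
by congr mean; apply/funext => x; rewrite mulN1r.
Qed.

Lemma meanB mu f g : bm f -> bm g ->
  mean mu (fun x => f x - g x) = mean mu f - mean mu g.
Proof. by move=> bf bg; rewrite meanD ?meanN//; exact: bmN. Qed.

Lemma le_mean mu f g : bm f -> bm g -> (forall x, f x <= g x) ->
  mean mu f <= mean mu g.
Proof.
by move=> bf bg fg; apply: le_Rintegral => //; exact: bm_integrable.
Qed.

Lemma mean_ge0 mu f : (forall x, 0 <= f x) -> 0 <= mean mu f.
Proof. by move=> f0; apply: Rintegral_ge0. Qed.

Lemma mean_gt0 mu f (c : R) : bm f -> 0 < c -> (forall x, c <= f x) ->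
  0 < mean mu f.
Proof.
move=> bf c0 cf; apply: (lt_le_trans c0).
by rewrite -[leLHS](mean_cst mu); apply: le_mean => //; exact: bm_cst.
Qed.

Lemma mean_expR_gt0 mu f : bm f -> 0 < mean mu (fun x => expR (f x)).
Proof.
move=> bf; have [M M0 fM] := bm_bound bf.
apply: (@mean_gt0 _ _ (expR (- M))); rewrite ?expR_gt0//.
  exact: bm_expR.
by move=> x; rewrite ler_expR; have := fM x; rewrite ler_norml => /andP[].
Qed.

Lemma mean_sum mu (I : Type) (s : seq I) (F : I -> T -> R) :
  (forall i, bm (F i)) ->
  mean mu (fun x => \sum_(i <- s) F i x) = \sum_(i <- s) mean mu (F i).
Proof.
move=> bF; elim: s => [|i s ih].
  by under [F in mean _ F]funext do rewrite big_nil; rewrite big_nil mean_cst.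
under [F in mean _ F]funext do rewrite big_cons.
by rewrite big_cons meanD ?ih//; exact: bm_sum.
Qed.

Lemma normr_mean mu f (M : R) : bm f -> (forall x, `|f x| <= M) ->
  `|mean mu f| <= M.
Proof.
move=> bf fM; have fb x : - M <= f x <= M by rewrite -ler_norml.
rewrite ler_norml; apply/andP; split.
  rewrite -[leLHS](mean_cst mu); apply: le_mean => // [|x].
    exact: bm_cst.
  by case/andP: (fb x).
rewrite -[leRHS](mean_cst mu); apply: le_mean => // [|x].
  exact: bm_cst.
by case/andP: (fb x).
Qed.

Lemma mean_indic mu A : measurable A -> mean mu (\1_A) = fine (mu A).
Proof. by move=> mA; rewrite /mean /Rintegral integral_indic// setIT. Qed.

Lemma fine_prob mu A : measurable A -> (fine (mu A))%:E = mu A.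
Proof. by move=> mA; rewrite fineK// fin_num_measure. Qed.

Lemma fine_prob_ge0 mu A : 0 <= fine (mu A).
Proof. by rewrite fine_ge0. Qed.

Lemma fine_prob_le1 mu A : measurable A -> fine (mu A) <= 1.
Proof. by move=> mA; rewrite -lee_fin fine_prob// probability_le1. Qed.

Lemma le_fine_prob mu A B : measurable A -> measurable B -> A `<=` B ->
  fine (mu A) <= fine (mu B).
Proof. by move=> mA mB AB; rewrite -lee_fin !fine_prob// le_measure// inE. Qed.

Lemma fine_probC mu A : measurable A -> fine (mu (~` A)) = 1 - fine (mu A).
Proof.
move=> mA; apply: EFin_inj; rewrite fine_prob; last exact: measurableC.
by rewrite probability_setC// EFinB fine_prob.
Qed.

(** Jensen's inequality for the logarithm, from [1 + u <= expR u] at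
[u = f x - ln (mean mu (expR f))]. *)
Lemma mean_le_ln_mean_expR mu f : bm f ->
  mean mu f <= ln (mean mu (fun x => expR (f x))).
Proof.
move=> bf; set Z := mean mu (fun x => expR (f x)).
have Z0 : 0 < Z := mean_expR_gt0 mu bf.
have be : bm (fun x => expR (f x)) by exact: bm_expR.
suff : 1 + (mean mu f - ln Z) <= 1 by rewrite -subr_ge0 opprD addrA subrr add0r oppr_ge0 subr_le0.
rewrite -[leRHS](_ : Z^-1 * Z = 1); last by rewrite mulVf// gt_eqF.
rewrite -meanZ// -(mean_cst mu (ln Z)) -meanB//; last exact: bm_cst.
rewrite -[X in X + _](mean_cst mu) -meanD; [|exact: bm_cst|]; last first.
  by apply: bmB => //; exact: bm_cst.
apply: le_mean.
- by apply: bmD; [exact: bm_cst|apply: bmB => //; exact: bm_cst].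
- exact: bmZ.
move=> x; rewrite (le_trans (expR_ge1Dx _))// expRD expRN lnK ?posrE//.
by rewrite mulrC.
Qed.

End mean_theory.

Lemma mean_pushforward d d' (T : measurableType d) (T' : measurableType d')
    (R : realType) (mu : probability T R) (h : {mfun T >-> T'}) (f : T' -> R) :
  bounded_measurable f ->
  mean (distribution mu h) f = mean mu (fun x => f (h x)).
Proof.
move=> bf; congr fine; rewrite /distribution.
rewrite (@integral_pushforward _ _ _ _ _ _ _ _ setT (EFin \o f))//.
  by apply/measurable_EFinP; exact: bm_measurable bf.
rewrite preimage_setT.
have := bm_integrable mu (bm_comp (@measurable_funPT _ _ _ _ h) bf).
by [].
Qed.

Section mean_product.
Context d d' (T : measurableType d) (T' : measurableType d') (R : realType).
Variables (mu : probability T R) (mu' : probability T' R) (f : T * T' -> R).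
Hypothesis bf : bounded_measurable f.

Lemma bm_pair1 x : bounded_measurable (fun y => f (x, y)).
Proof. by apply: bm_comp bf; exact: pair1_measurable. Qed.

Lemma bm_pair2 y : bounded_measurable (fun x => f (x, y)).
Proof. by apply: bm_comp bf; exact: pair2_measurable. Qed.

Let bm_fubini : (mu \x mu')%E.-integrable setT (EFin \o f).
Proof. exact: bm_integrable. Qed.

Lemma bm_mean1 : bounded_measurable (fun x => mean mu' (fun y => f (x, y))).
Proof.
split; last first.
  have [M M0 fM] := bm_bound bf; exists M => x.
  by apply: normr_mean => //; exact: bm_pair1.
apply/measurable_EFinP.
rewrite (_ : _ \o _ = fun x => (\int[mu']_y (f (x, y))%:E)%E); last first.
  by apply/funext => x /=; rewrite mean_EFin//; exact: bm_pair1.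
exact: (@measurable_fubini_F _ _ _ _ _ mu mu' _ bm_fubini).
Qed.

Lemma bm_mean2 : bounded_measurable (fun y => mean mu (fun x => f (x, y))).
Proof.
split; last first.
  have [M M0 fM] := bm_bound bf; exists M => y.
  by apply: normr_mean => //; exact: bm_pair2.
apply/measurable_EFinP.
rewrite (_ : _ \o _ = fun y => (\int[mu]_x (f (x, y))%:E)%E); last first.
  by apply/funext => y /=; rewrite mean_EFin//; exact: bm_pair2.
exact: (@measurable_fubini_G _ _ _ _ _ mu mu' _ bm_fubini).
Qed.

Lemma mean_prod1 :
  mean (mu \x mu')%E f = mean mu (fun x => mean mu' (fun y => f (x, y))).
Proof.
apply: EFin_inj; rewrite -!mean_EFin//; last exact: bm_mean1.
rewrite -(@integral12_prod_meas1 _ _ _ _ _ mu mu' _ bm_fubini).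
by apply: eq_integral => x _; rewrite -mean_EFin//; exact: bm_pair1.
Qed.

Lemma mean_prod2 :
  mean (mu \x mu')%E f = mean mu' (fun y => mean mu (fun x => f (x, y))).
Proof.
apply: EFin_inj; rewrite -!mean_EFin//; last exact: bm_mean2.
rewrite -(@integral21_prod_meas1 _ _ _ _ _ mu mu' _ bm_fubini).
by apply: eq_integral => x _; rewrite -mean_EFin//; exact: bm_pair2.
Qed.

End mean_product.

(** * Means over independent samples *)

(** Functions of a sample are defined on sequences of any length, so that blocks
can be cut and concatenated without casts between types of tuples. *)
Definition bm_seq d (T : measurableType d) (R : realType) (F : seq T -> R) :=
  forall n, bounded_measurable (fun t : n.-tuple T => F t).

Definition measurable_seq d (T : measurableType d) (D : set (seq T)) :=
  forall n, measurable [set t : n.-tuple T | D t].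

Definition mean_seq d (T : measurableType d) (R : realType)
    (mu : probability T R) (n : nat) (F : seq T -> R) : R :=
  mean (tuple_power mu n) (fun t => F t).

Section mean_seq.
Context d (T : measurableType d) (R : realType).
Implicit Types (mu : probability T R) (F G : seq T -> R) (D : set (seq T)).

Lemma measurable_reindex m n (h : n.-tuple T -> m.-tuple T) :
  (forall i, exists j, forall t, tnth (h t) i = tnth t j) ->
  measurable_fun setT h.
Proof.
move=> hP; apply/measurable_fun_tnthP => i; have [j hj] := hP i.
rewrite (_ : _ \o _ = (@tnth n T)^~ j); first exact: measurable_tnth.
by apply/funext => t /=; rewrite hj.
Qed.

Lemma measurable_take k n :
  measurable_fun setT (fun t : n.-tuple T => [tuple of take k t]).
Proof.
apply: measurable_reindex => i.
have ik : (i < k)%N by rewrite (leq_trans (ltn_ord i))// geq_minl.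
have jn : (i < n)%N by rewrite (leq_trans (ltn_ord i))// geq_minr.
exists (Ordinal jn) => t; pose x0 := tnth t (Ordinal jn).
by rewrite (tnth_nth x0) /= nth_take// (tnth_nth x0).
Qed.

Lemma measurable_drop k n :
  measurable_fun setT (fun t : n.-tuple T => [tuple of drop k t]).
Proof.
apply: measurable_reindex => i.
have jn : (k + i < n)%N by rewrite -ltn_subRL.
exists (Ordinal jn) => t; pose x0 := tnth t (Ordinal jn).
by rewrite (tnth_nth x0) /= nth_drop (tnth_nth x0).
Qed.

Lemma measurable_rot k n :
  measurable_fun setT (fun t : n.-tuple T => [tuple of rot k t]).
Proof.
have [nk|kn] := leqP n k.
  rewrite (_ : (fun _ => _) = id); first exact: measurable_id.
  by apply/funext => t; apply: val_inj; rewrite /= rot_oversize// size_tuple.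
apply: measurable_reindex => i.
have [ik|ki] := ltnP i (n - k).
  have jn : (k + i < n)%N by rewrite -ltn_subRL.
  exists (Ordinal jn) => t; pose x0 := tnth t (Ordinal jn).
  by rewrite (tnth_nth x0) /= nth_cat size_drop size_tuple ik nth_drop (tnth_nth x0).
have ik' : (i - (n - k) < k)%N by rewrite ltn_subLR// subnK// ltnW.
have jn : (i - (n - k) < n)%N by rewrite (leq_trans ik')// ltnW.
exists (Ordinal jn) => t; pose x0 := tnth t (Ordinal jn).
rewrite (tnth_nth x0) /= nth_cat size_drop size_tuple ltnNge ki/=.
by rewrite nth_take// (tnth_nth x0).
Qed.

Lemma measurable_cat m n :
  measurable_fun setT
    (fun p : m.-tuple T * n.-tuple T => [tuple of p.1 ++ p.2]).
Proof.
apply/measurable_fun_tnthP => i.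
have [im|mi] := ltnP i m.
  rewrite (_ : _ \o _ = (@tnth m T)^~ (Ordinal im) \o fst).
    by apply: measurableT_comp => //; exact: measurable_tnth.
  apply/funext => -[s t] /=; pose x0 := tnth s (Ordinal im).
  by rewrite (tnth_nth x0) /= nth_cat size_tuple im (tnth_nth x0).
have jn : (i - m < n)%N by rewrite ltn_subLR.
rewrite (_ : _ \o _ = (@tnth n T)^~ (Ordinal jn) \o snd).
  by apply: measurableT_comp => //; exact: measurable_tnth.
apply/funext => -[s t] /=; pose x0 := tnth t (Ordinal jn).
by rewrite (tnth_nth x0) /= nth_cat size_tuple ltnNge mi (tnth_nth x0).
Qed.

Lemma measurable_cons_pair n :
  measurable_fun setT (fun p : T * n.-tuple T => [tuple of p.1 :: p.2]).
Proof. exact: measurable_cons. Qed.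

Lemma bm_seq_cons x F : bm_seq F -> bm_seq (fun s => F (x :: s)).
Proof.
move=> bF n; have := bm_comp (measurable_cons_pair (n := n)) (bF n.+1).
by move/bm_pair1 => /(_ x).
Qed.

Lemma bm_seq_take k F : bm_seq F -> bm_seq (fun s => F (take k s)).
Proof. by move=> bF n; exact: (bm_comp (@measurable_take k n) (bF _)). Qed.

Lemma bm_seq_drop k F : bm_seq F -> bm_seq (fun s => F (drop k s)).
Proof. by move=> bF n; exact: (bm_comp (@measurable_drop k n) (bF _)). Qed.

Lemma bm_seq_rot k F : bm_seq F -> bm_seq (fun s => F (rot k s)).
Proof. by move=> bF n; exact: (bm_comp (@measurable_rot k n) (bF _)). Qed.

Lemma bm_seqD F G : bm_seq F -> bm_seq G -> bm_seq (fun s => F s + G s).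
Proof. by move=> bF bG n; apply: bmD. Qed.

Lemma bm_seqM F G : bm_seq F -> bm_seq G -> bm_seq (fun s => F s * G s).
Proof. by move=> bF bG n; apply: bmM. Qed.

Lemma bm_seq_cst (c : R) : bm_seq (fun _ : seq T => c).
Proof. by move=> n; exact: bm_cst. Qed.

Lemma bm_seq_expR F : bm_seq F -> bm_seq (fun s => expR (F s)).
Proof. by move=> bF n; exact: bm_expR. Qed.

Lemma indic_tuple D n : (fun t : n.-tuple T => \1_D (tval t) : R) =
  \1_[set t : n.-tuple T | D t].
Proof.
by apply/funext => t; rewrite !indicE; congr (_%:R); apply/idP/idP;
  rewrite !inE.
Qed.

Lemma bm_seq_indic D : measurable_seq D -> bm_seq (\1_D : seq T -> R).
Proof. by move=> mD n; rewrite indic_tuple; apply: bm_indic; exact: mD. Qed.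

Lemma bm_seq_sum (f : T -> R) : bounded_measurable f ->
  bm_seq (fun s => \sum_(x <- s) f x).
Proof.
move=> bf n; under eq_fun do rewrite big_tuple.
apply: bm_sum => i; apply: bm_comp bf; exact: measurable_tnth.
Qed.

Lemma bm_seq_prod (f : T -> R) : bounded_measurable f ->
  bm_seq (fun s => \prod_(x <- s) f x).
Proof.
move=> bf n; under eq_fun do rewrite big_tuple.
apply: bm_prod => i; apply: bm_comp bf; exact: measurable_tnth.
Qed.

Lemma mean_seq0 mu F : bm_seq F -> mean_seq mu 0 F = F [::].
Proof.
move=> bF; rewrite /mean_seq.
rewrite (_ : (fun t : 0.-tuple T => F t) = fun=> F [::]); last first.
  by apply/funext => t; rewrite tuple0.
exact: mean_cst.
Qed.

Lemma mean_seqS mu n F : bm_seq F ->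
  mean_seq mu n.+1 F = mean mu (fun x => mean_seq mu n (fun s => F (x :: s))).
Proof.
move=> bF; rewrite /mean_seq /= mean_pushforward; last exact: bF.
by rewrite mean_prod1//; exact: bm_comp (measurable_cons_pair (n := n)) (bF n.+1).
Qed.

Lemma le_mean_seq mu n F G : bm_seq F -> bm_seq G ->
  (forall s, size s = n -> F s <= G s) -> mean_seq mu n F <= mean_seq mu n G.
Proof. by move=> bF bG FG; apply: le_mean; [exact: bF|exact: bG|move=> t; apply: FG; rewrite size_tuple]. Qed.

Lemma eq_mean_seq mu n F G :
  (forall s, size s = n -> F s = G s) -> mean_seq mu n F = mean_seq mu n G.
Proof.
move=> FG; rewrite /mean_seq; congr mean; apply/funext => t.
by apply: FG; rewrite size_tuple.
Qed.

Lemma mean_seqD mu n F G : bm_seq F -> bm_seq G ->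
  mean_seq mu n (fun s => F s + G s) = mean_seq mu n F + mean_seq mu n G.
Proof. by move=> bF bG; rewrite /mean_seq meanD; [|exact: bF|exact: bG]. Qed.

Lemma mean_seqZ mu n (c : R) F : bm_seq F ->
  mean_seq mu n (fun s => c * F s) = c * mean_seq mu n F.
Proof. by move=> bF; rewrite /mean_seq meanZ; [|exact: bF]. Qed.

Lemma mean_seq_indic mu n D : measurable_seq D ->
  mean_seq mu n \1_D = fine (tuple_power mu n [set t : n.-tuple T | D t]).
Proof. by move=> mD; rewrite /mean_seq indic_tuple mean_indic; [|exact: mD]. Qed.

Lemma bm_cat_pair m n F : bm_seq F ->
  bounded_measurable (fun p : m.-tuple T * n.-tuple T => F (p.1 ++ p.2)).
Proof. by move=> bF; exact: (bm_comp (@measurable_cat m n) (bF _)). Qed.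

Lemma bm_seq_mean_cat mu n F : bm_seq F ->
  bm_seq (fun s => mean_seq mu n (fun t => F (s ++ t))).
Proof.
move=> bF m; rewrite /mean_seq.
exact: (bm_mean1 (tuple_power mu m) (tuple_power mu n) (@bm_cat_pair _ _ _ bF)).
Qed.

Lemma mean_seq_cat mu m n F : bm_seq F ->
  mean_seq mu (m + n) F =
  mean_seq mu m (fun s => mean_seq mu n (fun t => F (s ++ t))).
Proof.
elim: m F => [|m ih] F bF.
  by rewrite mean_seq0//; exact: bm_seq_mean_cat.
rewrite addSn !mean_seqS//; last exact: bm_seq_mean_cat.
congr mean; apply/funext => x; rewrite ih//; exact: bm_seq_cons.
Qed.

(** Independent samples are exchangeable; rotations are all that is needed to
bring a block of consecutive samples to the front. *)
Lemma mean_seq_rot mu k n F : (k <= n)%N -> bm_seq F ->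
  mean_seq mu n (fun s => F (rot k s)) = mean_seq mu n F.
Proof.
move=> kn bF; rewrite -{1}(subnKC kn) mean_seq_cat; last exact: bm_seq_rot.
rewrite -{2}(subnK kn) mean_seq_cat//.
transitivity (mean_seq mu k (fun s => mean_seq mu (n - k) (fun t => F (t ++ s)))).
  apply: eq_mean_seq => s sk; apply: eq_mean_seq => t tk.
  by rewrite -sk rot_size_cat.
rewrite /mean_seq.
have bF' := @bm_cat_pair (n - k) k _ bF.
by rewrite -(mean_prod2 (tuple_power mu (n - k)) (tuple_power mu k) bF') mean_prod1.
Qed.

Lemma mean_seqM mu m n F G : bm_seq F -> bm_seq G ->
  mean_seq mu (m + n) (fun s => F (take m s) * G (drop m s)) =
  mean_seq mu m F * mean_seq mu n G.
Proof.
move=> bF bG; rewrite mean_seq_cat; last first.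
  by apply: bm_seqM; [exact: bm_seq_take|exact: bm_seq_drop].
rewrite mulrC -mean_seqZ//; apply: eq_mean_seq => s sm.
rewrite mulrC -mean_seqZ//; apply: eq_mean_seq => t _.
by rewrite -sm take_size_cat// drop_size_cat.
Qed.

Lemma mean_seq_prod mu n (f : T -> R) : bounded_measurable f ->
  mean_seq mu n (fun s => \prod_(x <- s) f x) = mean mu f ^+ n.
Proof.
move=> bf; elim: n => [|n ih].
  by rewrite mean_seq0 ?big_nil//; exact: bm_seq_prod.
rewrite mean_seqS; last exact: bm_seq_prod.
rewrite exprS mulrC -meanZ//; congr mean; apply/funext => x.
rewrite mulrC -ih -mean_seqZ; last exact: bm_seq_prod.
by apply: eq_mean_seq => s _; rewrite big_cons.
Qed.

Lemma mean_seq_expR_sum mu n (f : T -> R) : bounded_measurable f ->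
  mean_seq mu n (fun s => expR (\sum_(x <- s) f x)) =
  mean mu (fun x => expR (f x)) ^+ n.
Proof.
move=> bf; rewrite -mean_seq_prod; last exact: bm_expR.
by apply: eq_mean_seq => s _; rewrite expR_sum.
Qed.

(** The density of a product is the product of the densities. *)
Lemma mean_seq_density mu mu' (phi : T -> R) n F : bounded_measurable phi ->
  (forall f, bounded_measurable f ->
    mean mu' f = mean mu (fun x => f x * expR (phi x))) ->
  bm_seq F ->
  mean_seq mu' n F = mean_seq mu n (fun s => F s * expR (\sum_(x <- s) phi x)).
Proof.
move=> bphi H; have be := bm_seq_expR (bm_seq_sum bphi).
elim: n F => [|n ih] F bF.
  by rewrite !mean_seq0//; [rewrite big_nil expR0 mulr1|exact: bm_seqM].
rewrite !mean_seqS//; last exact: bm_seqM.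
rewrite H; last exact: (bm_mean1 mu (tuple_power mu' n) (bm_comp (measurable_cons_pair (n := n)) (bF n.+1))).
congr mean; apply/funext => x; rewrite ih; last exact: bm_seq_cons.
rewrite mulrC -mean_seqZ; last by apply: bm_seqM => //; exact: bm_seq_cons.
by apply: eq_mean_seq => s _; rewrite big_cons expRD; ring.
Qed.

(** From [expR u <= 1 / (1 - u)]. *)
Lemma expR_le_quadratic (u : R) : `|u| <= 2^-1 -> expR u <= 1 + u + 2 * u ^+ 2.
Proof.
rewrite ler_norml => /andP[u1 u2].
have e0 : 0 < 1 - u by lra.
have : expR u <= (1 - u)^-1.
  by rewrite -[u in leLHS]opprK expRN lef_pV2 ?posrE ?expR_gt0// expR_ge1Dx.
move/le_trans; apply; rewrite -div1r ler_pdivrMr//.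
have : 0 <= u ^+ 2 * (1 - 2 * u) by rewrite mulr_ge0 ?sqr_ge0//; lra.
rewrite expr2; nra.
Qed.

Lemma mean_expR_scale mu (h : T -> R) (s : R) : bounded_measurable h ->
  (forall x, `|h x| <= 1) -> `|s| <= 2^-1 ->
  mean mu (fun x => expR (s * h x)) <= expR (s * mean mu h + 2 * s ^+ 2).
Proof.
move=> bh h1 s1; apply: le_trans (expR_ge1Dx _).
rewrite -(meanZ mu s)// -{1}(mean_cst mu (2 * s ^+ 2)) -[X in X + (_ + _)](mean_cst mu 1).
rewrite -!meanD; try by [exact: bm_cst|exact: bmZ|apply: bmD; [exact: bmZ|exact: bm_cst]].
apply: le_mean.
- by apply: bm_expR; exact: bmZ.
- by apply: bmD; [exact: bm_cst|apply: bmD; [exact: bmZ|exact: bm_cst]].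
move=> x; apply: le_trans (expR_le_quadratic _) _.
  by rewrite normrM (le_trans _ s1)// ler_piMr.
suff : (s * h x) ^+ 2 <= s ^+ 2 by lra.
rewrite exprMn ler_piMr ?sqr_ge0//.
by rewrite -[_ ^+ 2]ger0_norm ?sqr_ge0// normrX expr_le1.
Qed.

(** Markov's inequality for the exponential moment at parameter [a / 4], which
minimises the quadratic bound [2 * u ^+ 2 - u * a] in [u]. *)
Lemma chernoff_bound mu n (h : T -> R) (a : R) : bounded_measurable h ->
  (forall x, `|h x| <= 1) -> 0 <= a <= 2 -> mean mu h <= 0 ->
  forall D, measurable_seq D ->
  (forall s, D s -> n%:R * a <= \sum_(x <- s) h x) ->
  mean_seq mu n \1_D <= expR (- (n%:R * a ^+ 2 / 8)).
Proof.
move=> bh h1 /andP[a0 a2] mh D mD DP.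
have be := bm_seq_expR (bm_seq_sum (bmZ (a / 4) bh)).
apply: (@le_trans _ _ (mean_seq mu n (fun s => expR (- (n%:R * a * (a / 4))) *
    expR (\sum_(x <- s) (a / 4) * h x)))).
  apply: le_mean_seq; first exact: bm_seq_indic.
    by apply: bm_seqM => //; exact: bm_seq_cst.
  move=> s _; rewrite indicE; case: (boolP (s \in D)) => [|_]; last first.
    by rewrite mulr_ge0 ?expR_ge0.
  rewrite inE => /DP sD; rewrite -expRD -[leLHS]expR0 ler_expR -mulr_sumr.
  have : n%:R * a * (a / 4) <= (\sum_(j <- s) h j) * (a / 4).
    by apply: ler_wpM2r => //; lra.
  lra.
rewrite mean_seqZ// mean_seq_expR_sum; last exact: bmZ.
have M0 : 0 <= mean mu (fun x => expR (a / 4 * h x)).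
  by apply: mean_ge0 => x; exact: expR_ge0.
have : mean mu (fun x => expR (a / 4 * h x)) <= expR (2 * (a / 4) ^+ 2).
  apply: le_trans (mean_expR_scale mu bh h1 _) _.
    by rewrite ger0_norm; lra.
  rewrite ler_expR gerDr; have := mulr_ge0_le0 (_ : 0 <= a / 4) mh; apply; lra.
move=> /(lerXn2r n) /[!nnegrE] /(_ M0 (expR_ge0 _)).
rewrite -expRM_natl => le1.
apply: (le_trans (ler_wpM2l (expR_ge0 _) le1)); rewrite -expRD ler_expR.
by rewrite le_eqVlt; apply/orP; left; apply/eqP; field.
Qed.

(** The entropy of the law conditioned on [D] is [- ln p]; this is its variational
form, and again amounts to [1 + u <= expR u]. *)
Lemma gibbs_conditional mu n D F (p := mean_seq mu n \1_D) :
  measurable_seq D -> bm_seq F -> 0 < p ->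
  mean_seq mu n (fun s => \1_D s * F s) / p <=
  ln (mean_seq mu n (fun s => expR (F s))) - ln p.
Proof.
move=> mD bF p0; set m := _ / p.
have bD : bm_seq (\1_D : seq T -> R) by exact: bm_seq_indic.
have Z0 : 0 < mean_seq mu n (fun s => expR (F s))
  by apply: mean_expR_gt0; exact: bF.
suff : p * expR m <= mean_seq mu n (fun s => expR (F s)).
  rewrite -ler_ln ?posrE ?mulr_gt0 ?expR_gt0//.
  by rewrite lnM ?posrE ?expR_gt0// expRK; lra.
have pE : p = mean_seq mu n (fun s => (1 - m) * \1_D s + \1_D s * F s).
  rewrite mean_seqD ?mean_seqZ//; last 2 first.
  - by apply: bm_seqM => //; exact: bm_seq_cst.
  - exact: bm_seqM.
  by rewrite -/p /m; field; rewrite gt_eqF.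
rewrite {1}pE mulrC -mean_seqZ; last first.
  by apply: bm_seqD; apply: bm_seqM => //; exact: bm_seq_cst.
apply: le_mean_seq.
- apply: bm_seqM; first exact: bm_seq_cst.
  by apply: bm_seqD; apply: bm_seqM => //; exact: bm_seq_cst.
- exact: bm_seq_expR.
move=> s _; rewrite -[F s in leRHS](subrKC m) expRD ler_pM2l ?expR_gt0//.
rewrite indicE; case: (s \in D); last by rewrite !(mul0r,mulr0,addr0) expR_ge0.
by rewrite !(mul1r,mulr1) -addrA (addrC (- m)) expR_ge1Dx.
Qed.

End mean_seq.

(** * Probabilities from set functions and from positive functionals *)

Section probability_of_set_function.
Context d (T : measurableType d) (R : realType).
Implicit Types (V : probability T R) (g : T -> R) (A : set T).

Lemma fine_sigma_additive V (F : (set T)^nat) : (forall i, measurable (F i)) ->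
  trivIset setT F ->
  (fun n => \sum_(0 <= i < n) fine (V (F i)) : R) @ \oo --> fine (V (\bigcup_n F n)).
Proof.
move=> mF tF; have mU : measurable (\bigcup_n F n) by exact: bigcupT_measurable.
have := @measure_semi_sigma_additive _ _ _ V F mF tF mU.
rewrite (_ : (fun _ => _) = fun n => (\sum_(0 <= i < n) fine (V (F i)))%:E); last first.
  by apply/funext => n; rewrite -sumEFin; apply: eq_bigr => i _; rewrite fine_prob.
by rewrite -[X in _ --> X -> _](fine_prob V mU) => /fine_cvgP[].
Qed.

(** The set function is total, but only its values on measurable sets are
constrained; this allows definitions by limits or by cases. *)
Lemma probability_of_set_function (v : set T -> R) :
  (forall A, 0 <= v A) -> v set0 = 0 -> v setT = 1 ->
  (forall F : (set T)^nat, (forall i, measurable (F i)) -> trivIset setT F ->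
    (fun n => \sum_(0 <= i < n) v (F i)) @ \oo --> v (\bigcup_n F n)) ->
  exists V : probability T R, forall A, V A = (v A)%:E.
Proof.
move=> v_ge0 v0 v1 vS; pose w A := (v A)%:E.
have w0 : w set0 = 0%E by rewrite /w v0.
have w_ge0 A : (0 <= w A)%E by rewrite lee_fin.
have wS : semi_sigma_additive w.
  move=> F mF tF mU; rewrite /w.
  under eq_fun do rewrite sumEFin.
  by apply: cvg_EFin; [exact: nearW|exact: vS].
pose H1 := isMeasure.Build _ _ _ w w0 w_ge0 wS.
pose m : {measure set T -> \bar R} := HB.pack w H1.
have m1 : m setT = 1%E by rewrite /= /w v1.
pose H2 := Measure_isProbability.Build _ _ _ m m1.
pose p : probability T R := HB.pack (Measure.sort m) H2.
by exists p.
Qed.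

End probability_of_set_function.

Lemma sum_ltn_ord (K t : nat) :
  (\sum_(i < K) ((i < t)%N : nat))%N = minn K t.
Proof.
elim: K => [|K ih]; first by rewrite big_ord0 min0n.
by rewrite big_ord_recr/= ih; lia.
Qed.

(** A positive functional [L] that is [e]-close to [V] on indicators is [e]-close
to the mean on functions with values in [[0, 1]]: such a function is the average
of the indicators of its [K] level sets up to [1 / K], and an average of errors
at most [e] is at most [e]. *)
Section mean_extension.
Context d (T : measurableType d) (R : realType).
Variables (V : probability T R) (L : (T -> R) -> R) (e : R).
Local Notation bm := (@bounded_measurable d T R).
Hypothesis LD : forall f g, bm f -> bm g -> L (fun x => f x + g x) = L f + L g.
Hypothesis LZ : forall c f, bm f -> L (fun x => c * f x) = c * L f.
Hypothesis L_le : forall f g, bm f -> bm g -> (forall x, f x <= g x) -> L f <= L g.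
Hypothesis L1 : forall A, measurable A -> `|L \1_A - fine (V A)| <= e.

Let level (g : T -> R) K i : set T := [set x | i.+1%:R <= K%:R * g x].
Let step (g : T -> R) K x : R := K%:R^-1 * \sum_(i < K) \1_(level g K i) x.

Let measurable_level g K i : bm g -> measurable (level g K i).
Proof.
move=> bg; have /bm_measurable := bmZ K%:R bg.
move=> /(_ measurableT _ (measurable_itv `[i.+1%:R, +oo[%R)).
by rewrite setTI; congr measurable; apply/funext => x; rewrite /= in_itv/= andbT.
Qed.

Let step_approx g K x : (0 < K)%N -> 0 <= g x <= 1 ->
  step g K x <= g x <= step g K x + K%:R^-1.
Proof.
move=> K0 /andP[g0 g1]; have Kp : 0 < K%:R :> R by rewrite ltr0n.
set y := K%:R * g x; have y0 : 0 <= y by rewrite mulr_ge0// ltW.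
have tK : (Num.truncn y <= K)%N.
  by rewrite -ltnS truncn_lt_nat// (le_lt_trans (_ : _ <= K%:R))// ?ltr_nat// ler_piMr.
have -> : step g K x = K%:R^-1 * (Num.truncn y)%:R.
  congr (_ * _); rewrite (eq_bigr (fun i : 'I_K => ((i < Num.truncn y)%N : nat)%:R)).
    by rewrite -natr_sum sum_ltn_ord (minn_idPr tK).
  move=> i _; rewrite indicE; congr ((nat_of_bool _)%:R).
  by apply/idP/idP; rewrite inE /level/= truncn_gt_nat.
have /andP[t1 t2] := truncn_itv y0.
apply/andP; split; first by rewrite ler_pdivrMl.
have -> : K%:R^-1 * (Num.truncn y)%:R + K%:R^-1 = K%:R^-1 * (Num.truncn y).+1%:R :> R.
  by rewrite [in RHS]mulrSr mulrDr mulr1.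
by rewrite ler_pdivlMl// ltW.
Qed.

Lemma mean_extension_unit g : bm g -> (forall x, 0 <= g x <= 1) ->
  `|L g - mean V g| <= e.
Proof.
move=> bg g01.
have bs K : bm (step g K).
  by apply: bmZ; apply: bm_sum => i; apply: bm_indic; exact: measurable_level.
have LT : L (cst 1) <= 1 + e.
  have := L1 measurableT; rewrite probability_setT/= indicT ler_distl => /andP[_].
  by [].
have L0 (f : T -> R) : L (fun=> 0) = 0.
  rewrite -[RHS](mul0r (L (cst 1))) -LZ; last exact: bm_cst.
  by congr L; apply/funext => x; rewrite mul0r.
have Lsum (K : nat) (F : nat -> T -> R) : (forall i, bm (F i)) ->
    L (fun x => \sum_(i < K) F i x) = \sum_(i < K) L (F i).
  move=> bF; elim: K => [|K ih].
    by rewrite big_ord0 -[RHS](L0 g); congr L; apply/funext => x; rewrite big_ord0.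
  rewrite big_ord_recr/= -ih -LD//; last exact: bm_sum.
  by congr L; apply/funext => x; rewrite big_ord_recr.
have key (K : nat) : (0 < K)%N -> `|L g - mean V g| <= e + (2 + e) * K%:R^-1.
  move=> K0; have Kp : 0 < K%:R :> R by rewrite ltr0n.
  have Ls : `|L (step g K) - mean V (step g K)| <= e.
    have bI i : bm (\1_(level g K i) : T -> R).
      by apply: bm_indic; exact: measurable_level.
    rewrite /step LZ; last exact: bm_sum.
    rewrite meanZ; last exact: bm_sum.
    rewrite -mulrBr (Lsum _ (fun i => \1_(level g K i)))// mean_sum// -sumrB.
    rewrite normrM ger0_norm ?invr_ge0 ?ler0n// mulrC ler_pdivrMr//.
    apply: le_trans (ler_norm_sum _ _ _) _.
    rewrite mulr_natr -[X in _ *+ X]card_ord -sumr_const; apply: ler_sum => i _.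
    by rewrite mean_indic; [apply: L1|]; exact: measurable_level.
  have sg x : step g K x <= g x by case/andP: (step_approx K0 (g01 x)).
  have gs x : g x <= step g K x + K%:R^-1 by case/andP: (step_approx K0 (g01 x)).
  have bc : bm (fun=> K%:R^-1 : R) by exact: bm_cst.
  have := L_le (bs K) bg sg; have := le_mean V (bs K) bg sg.
  have := L_le bg (bmD (bs K) bc) gs; have := le_mean V bg (bmD (bs K) bc) gs.
  rewrite meanD// mean_cst LD//.
  have -> : L (fun=> K%:R^-1) = K%:R^-1 * L (cst 1).
    by rewrite -LZ; [congr L; apply/funext => x; rewrite mulr1|exact: bm_cst].
  have : K%:R^-1 * L (cst 1) <= K%:R^-1 * (1 + e).
    by rewrite ler_pM2l// invr_gt0.
  have : 0 < K%:R^-1 :> R by rewrite invr_gt0.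
  move: Ls; rewrite !ler_distl => /andP[].
  move: (L g) (mean V g) (L (step g K)) (mean V (step g K)) (L (cst 1)) K%:R^-1.
  clear=> a b a' b' c k ? ? ? ? ? ? ? ?; apply/andP; split; lra.
rewrite leNgt; apply/negP => lt_e; set D := `|_ - _| in lt_e key.
have De : 0 < D - e by rewrite subr_gt0.
have := truncnS_gt ((2 + e) / (D - e)); set K := (Num.truncn _).+1 => ltK.
have := key K isT; have Kp : 0 < K%:R :> R by rewrite ltr0n.
move: ltK; rewrite ltr_pdivrMr// mulrC -ltr_pdivrMr// => ltK.
by apply/negP; rewrite -ltNge -ltrBrDl.
Qed.

End mean_extension.

Section mean_extension_corollaries.
Context d (T : measurableType d) (R : realType).
Implicit Types (V : probability T R) (g : T -> R) (A : set T).
Local Notation bm := (@bounded_measurable d T R).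

Lemma bm_affine g (M : R) : bm g -> 0 < M -> (forall x, `|g x| <= M) ->
  exists h : T -> R, [/\ bm h, forall x, 0 <= h x <= 1 &
    g = fun x => 2 * M * h x + - M].
Proof.
move=> bg M0 gM; exists (fun x => (2 * M)^-1 * (g x + M)); split.
- by apply: bmZ; apply: bmD => //; exact: bm_cst.
- move=> x; have := gM x; rewrite ler_norml => /andP[g1 g2].
  by rewrite mulrC ler_pdivrMr ?mulr_gt0// divr_ge0//; lra.
- by apply/funext => x; field; rewrite gt_eqF.
Qed.

Lemma mean_unique V (L : (T -> R) -> R) :
  (forall f g, bm f -> bm g -> L (fun x => f x + g x) = L f + L g) ->
  (forall c f, bm f -> L (fun x => c * f x) = c * L f) ->
  (forall f g, bm f -> bm g -> (forall x, f x <= g x) -> L f <= L g) ->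
  (forall A, measurable A -> L \1_A = fine (V A)) ->
  forall g, bm g -> L g = mean V g.
Proof.
move=> LD LZ L_le L1 g bg; have [M M0 gM] := bm_bound bg.
have [h [bh h01 ->]] := bm_affine bg M0 gM.
have L1' A : measurable A -> `|L \1_A - fine (V A)| <= 0.
  by move=> mA; rewrite L1// subrr normr0.
have := mean_extension_unit LD LZ L_le L1' bh h01.
rewrite normr_le0 subr_eq0 => /eqP Lh.
have LM : L (fun=> - M) = - M.
  have -> : (fun=> - M) = fun x : T => - M * \1_(@setT T) x.
    by apply/funext => x; rewrite indicT mulr1.
  rewrite LZ; last exact: bm_indic.
  by rewrite L1// probability_setT mulr1.
have bh2 := bmZ (2 * M) bh; have bc : bm (fun=> - M : R) by exact: bm_cst.
rewrite LD ?LZ ?LM ?Lh//.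
by rewrite meanD ?meanZ ?mean_cst.
Qed.

Lemma mean_tv V V' (e M : R) g :
  (forall A, measurable A -> `|fine (V A) - fine (V' A)| <= e) ->
  bm g -> 0 < M -> (forall x, `|g x| <= M) ->
  `|mean V g - mean V' g| <= 2 * M * e.
Proof.
move=> VV' bg M0 gM; have [h [bh h01 ->]] := bm_affine bg M0 gM.
have bh2 := bmZ (2 * M) bh; have bc : bm (fun=> - M : R) by exact: bm_cst.
have := @mean_extension_unit _ _ _ V' (mean V) e _ _ _ _ h bh h01.
rewrite !meanD ?meanZ ?mean_cst//.
have -> (a b : R) : 2 * M * a + - M - (2 * M * b + - M) = 2 * M * (a - b) by ring.
rewrite normrM gtr0_norm ?mulr_gt0// ler_pM2l ?mulr_gt0//; apply.
- by move=> f f' bf bf'; exact: meanD.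
- by move=> c f bf; exact: meanZ.
- by move=> f f' bf bf' ff'; exact: le_mean.
- by move=> A mA; rewrite mean_indic//; exact: VV'.
Qed.

(** Total variation is complete: the limit of the values on each set is countably
additive because the convergence is uniform over sets. *)
Lemma tv_complete (V : nat -> probability T R) (e : nat -> R) :
  e @ \oo --> 0 ->
  (forall n m A, (n <= m)%N -> measurable A ->
    `|fine (V n A) - fine (V m A)| <= e n) ->
  exists V' : probability T R, forall n A, measurable A ->
    `|fine (V n A) - fine (V' A)| <= e n.
Proof.
move=> e0 Ve.
pose v A := if `[< measurable A >] then lim (fine (V n A) @[n --> \oo]) else 0.
have cV A : measurable A -> fine (V n A) @[n --> \oo] --> v A.
  move=> mA; rewrite /v asboolT//; apply: cauchy_cvg; apply/cauchy_exP => eps eps0.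
  have /cvgrPdist_lt /(_ eps eps0) [N _ NP] := e0.
  exists (fine (V N A)); exists N => // n Nn.
  apply: le_lt_trans (Ve _ _ _ Nn mA) _.
  by have := NP N (leqnn N); rewrite /= sub0r normrN; apply: le_lt_trans; exact: ler_norm.
have Vv n A : measurable A -> `|fine (V n A) - v A| <= e n.
  move=> mA.
  have cn : `|fine (V n A) - fine (V m A)| @[m --> \oo] --> `|fine (V n A) - v A|.
    by apply: cvg_norm; apply: cvgB; [exact: cvg_cst|exact: cV].
  rewrite -(cvg_lim _ cn)//; apply: limr_le; first by apply/cvg_ex; eexists; exact: cn.
  by exists n => // m nm; exact: Ve.
have [||||V' V'E] := @probability_of_set_function _ T R v.
- move=> A; rewrite /v; case: asboolP => // mA; have := cV A mA; rewrite /v asboolT//.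
  move=> /cvg_lim <-//.
  by apply: limr_ge; [apply/cvg_ex; eexists; exact: cV|apply: nearW => n; exact: fine_prob_ge0].
- have := cV set0 measurable0.
  by under eq_fun do rewrite measure0; move=> /cvg_lim <-//; rewrite lim_cst.
- have := cV setT measurableT.
  by under eq_fun do rewrite probability_setT; move=> /cvg_lim <-//; rewrite lim_cst.
- move=> F mF tF; have mU : measurable (\bigcup_n F n) by exact: bigcupT_measurable.
  apply/cvgrPdist_le => eps eps0.
  have eps3 : 0 < eps / 3 by rewrite divr_gt0.
  have /cvgrPdist_le /(_ _ eps3) [N _ NP] := e0.
  have eN : e N <= eps / 3.
    by have := NP N (leqnn N); rewrite /= sub0r normrN; apply: le_trans; exact: ler_norm.
  have /cvgrPdist_le /(_ _ eps3) := fine_sigma_additive (V := V N) mF tF.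
  apply: filterS => n Hn.
  have H1 := Vv N _ mU.
  have H2 : `|\sum_(0 <= i < n) fine (V N (F i)) - \sum_(0 <= i < n) v (F i)| <= e N.
    have mUn : measurable (\big[setU/set0]_(0 <= i < n) F i).
      by apply: bigsetU_measurable.
    have add m : \sum_(0 <= i < n) fine (V m (F i)) =
        fine (V m (\big[setU/set0]_(0 <= i < n) F i)).
      rewrite !big_mkord in mUn *; rewrite measure_semi_additive_ord_I//=; last first.
        by apply: sub_trivIset tF.
      rewrite -[LHS]/(fine (_)%:E) -sumEFin; congr fine.
      by apply: eq_bigr => i _; rewrite fine_prob.
    rewrite add (_ : \sum_(0 <= i < n) v (F i) = v (\big[setU/set0]_(0 <= i < n) F i)).
      exact: Vv.
    have C1 : fine (V m (\big[setU/set0]_(0 <= i < n) F i)) @[m --> \oo] -->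
        \sum_(0 <= i < n) v (F i).
      under eq_fun do rewrite -add.
      by apply: cvg_big => [|i _]; [exact: add_continuous|exact: cV].
    by rewrite -(cvg_lim _ C1)// (cvg_lim _ (cV _ mUn)).
  move: H1 H2 Hn eN; rewrite !ler_distl => /andP[? ?] /andP[? ?] /andP[? ?] ?.
  by apply/andP; split; lra.
exists V' => n A mA; rewrite V'E; exact: Vv.
Qed.

Lemma midpoint_ex V V' : exists M : probability T R,
  forall g, bm g -> mean M g = (mean V g + mean V' g) / 2.
Proof.
have [||||M ME] := @probability_of_set_function _ T R
    (fun A => (fine (V A) + fine (V' A)) / 2).
- by move=> A; rewrite divr_ge0// addr_ge0// fine_prob_ge0.
- by rewrite !measure0/= addr0 mul0r.
- by rewrite !probability_setT/=; lra.
- move=> F mF tF; under eq_fun do rewrite -mulr_suml big_split/=.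
  by apply: cvgMl; apply: cvgD; exact: fine_sigma_additive.
exists M => g bg; symmetry; apply: (@mean_unique M
  (fun g => (mean V g + mean V' g) / 2)) => //.
- by move=> f f' bf bf'; rewrite !meanD//; lra.
- by move=> c f bf; rewrite !meanZ//; lra.
- move=> f f' bf bf' ff'; have := le_mean V bf bf' ff'.
  by have := le_mean V' bf bf' ff'; lra.
- by move=> A mA; rewrite !mean_indic// ME.
Qed.

End mean_extension_corollaries.

(** * Entropy in Donsker-Varadhan form *)

(** The Donsker-Varadhan form of the statement that the entropy of [V] relative to
[W] is at most [c].  Being a family of inequalities that are affine in [V], it
passes to mixtures and to limits without any density. *)
Definition dv_entropy_le d (T : measurableType d) (R : realType)
    (W V : probability T R) (c : R) : Prop :=
  forall g : T -> R, bounded_measurable g ->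
    mean V g <= ln (mean W (fun x => expR (g x))) + c.

Section dv_entropy.
Context d (T : measurableType d) (R : realType).
Variable W : probability T R.
Implicit Types (V : probability T R) (g h : T -> R) (c : R).
Local Notation bm := (@bounded_measurable d T R).
Local Notation ent := (dv_entropy_le W).

Lemma dv_entropy_ge0 V c : ent V c -> 0 <= c.
Proof.
move=> /(_ (fun=> 0) (bm_cst _ 0)); rewrite expR0 !mean_cst ln1.
by rewrite add0r.
Qed.

Lemma dv_entropy_leW V c c' : c <= c' -> ent V c -> ent V c'.
Proof. by move=> cc' H g bg; apply: le_trans (H g bg) _; rewrite lerD2l. Qed.

(** The slope [m] is the mean of [h] under the law of density proportional to
[expR g]; the remainder is quadratic because [h] is bounded by [1]. *)
Lemma ln_mean_expR_tilt g h : bm g -> bm h -> (forall x, `|h x| <= 1) ->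
  exists m : R, forall s, `|s| <= 2^-1 ->
  ln (mean W (fun x => expR (g x + s * h x))) <=
  ln (mean W (fun x => expR (g x))) + s * m + 2 * s ^+ 2.
Proof.
move=> bg bh h1; pose Z := mean W (fun x => expR (g x)).
have Z0 : 0 < Z by exact: mean_expR_gt0.
have be := bm_expR bg.
exists (mean W (fun x => expR (g x) * h x) / Z) => s s1.
have bsh : bm (fun x => s * h x) by exact: bmZ.
have bgsh : bm (fun x => g x + s * h x) by exact: bmD.
rewrite -ler_expR lnK ?posrE ?mean_expR_gt0// !expRD lnK ?posrE//.
set m := _ / Z.
apply: (@le_trans _ _ (Z * (1 + (s * m + 2 * s ^+ 2)))); last first.
  by rewrite -mulrA -expRD ler_pM2l// expR_ge1Dx.
have beh : bm (fun x => expR (g x) * h x) by exact: bmM.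
have -> : Z * (1 + (s * m + 2 * s ^+ 2)) = mean W (fun x =>
    (1 + 2 * s ^+ 2) * expR (g x) + s * (expR (g x) * h x)).
  rewrite meanD ?meanZ//; [|exact: bmZ|exact: bmZ].
  by rewrite /m -/Z; field; rewrite gt_eqF.
apply: le_mean; [exact: bm_expR|by apply: bmD; exact: bmZ|].
move=> x; rewrite expRD.
have -> : (1 + 2 * s ^+ 2) * expR (g x) + s * (expR (g x) * h x) =
  expR (g x) * (1 + s * h x + 2 * s ^+ 2) by ring.
rewrite ler_pM2l ?expR_gt0//.
apply: le_trans (expR_le_quadratic _) _.
  by rewrite normrM (le_trans _ s1)// ler_piMr.
suff : (s * h x) ^+ 2 <= s ^+ 2 by lra.
rewrite exprMn ler_piMr ?sqr_ge0//.
by rewrite -[_ ^+ 2]ger0_norm ?sqr_ge0// normrX expr_le1.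
Qed.

(** Strong convexity of the entropy, with the distance measured by one test
function: a test function that nearly attains the entropy of the midpoint can
be tilted by [s * h] for [V] and by [- s * h] for [V']. *)
Lemma dv_entropy_midpoint V V' (M : probability T R) h (a b c : R) :
  (forall g, bm g -> mean M g = (mean V g + mean V' g) / 2) ->
  ent V a -> ent V' b -> ~ ent M c -> bm h -> (forall x, `|h x| <= 1) ->
  (mean V h - mean V' h) ^+ 2 <= 16 * (a + b - 2 * c).
Proof.
move=> ME eV eV' /existsNP[g /not_implyP[bg /negP]]; rewrite -ltNge => Mg bh h1.
(* [s = D / 8] maximises the gain [s * D - 4 * s ^+ 2]. *)
set D := mean V h - mean V' h; pose s := D / 8.
have D2 : `|D| <= 2.
  rewrite (le_trans (ler_normB _ _))// -(_ : 1 + 1 = 2 :> R)//.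
  by apply: lerD; exact: normr_mean.
have s1 : `|s| <= 2^-1.
  by rewrite /s normrM [X in _ * X]ger0_norm ?invr_ge0//; lra.
have [m Hm] := ln_mean_expR_tilt bg bh h1.
have bsh : bm (fun x => s * h x) by exact: bmZ.
have bsh' : bm (fun x => - s * h x) by exact: bmZ.
have := eV _ (bmD bg bsh); have := eV' _ (bmD bg bsh').
have := Hm _ s1; have := Hm (- s); rewrite normrN => /(_ s1).
rewrite !meanD ?meanZ//.
move: Mg; rewrite ME// sqrrN.
have -> : D ^+ 2 = 8 * (s * (mean V h - mean V' h)).
  by rewrite -/D /s; field.
have -> : s ^+ 2 = s * (mean V h - mean V' h) / 8.
  by rewrite -/D /s; field.
move: (ln _) (ln (mean W (fun x => expR (g x + s * _)))) (ln (mean W (fun x => expR (g x + _)))).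
move: (mean V g) (mean V' g) (mean V h) (mean V' h) => *; lra.
Qed.

(** Each inequality tests one bounded function, whose mean is continuous for total
variation. *)
Lemma dv_entropy_tv_lim (V_ : nat -> probability T R) V (e c : nat -> R) (c' : R) :
  (forall n A, measurable A -> `|fine (V_ n A) - fine (V A)| <= e n) ->
  e @ \oo --> 0 -> (forall n, ent (V_ n) (c n)) -> c @ \oo --> c' -> ent V c'.
Proof.
move=> Ve e0 entV cc' g bg; have [M M0 gM] := bm_bound bg.
have le n : mean V g <= ln (mean W (fun x => expR (g x))) + c n + 2 * M * e n.
  have := entV n g bg; have := mean_tv (Ve n) bg M0 gM.
  by rewrite ler_distl => /andP[+ _]; lra.
rewrite -[leRHS]addr0 -(mulr0 (2 * M)).
have cv : (ln (mean W (fun x => expR (g x))) + c n + 2 * M * e n) @[n --> \oo] -->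
  ln (mean W (fun x => expR (g x))) + c' + 2 * M * 0.
  apply: cvgD; last by apply: cvgMr.
  by apply: cvgD => //; exact: cvg_cst.
rewrite -(cvg_lim _ cv)//; apply: limr_ge; first by apply/cvg_ex; eexists; exact: cv.
exact: nearW.
Qed.

End dv_entropy.

(** A decreasing family of convex constraints closed under total variation
limits: near minimisers of the entropy form a Cauchy sequence, their limit
satisfies all the constraints, so the minimal entropies converge to the entropy
of the projection. *)
Section constraint_relaxation.
Context d (T : measurableType d) (R : realType).
Variables (W Wstar : probability T R) (H : R).
Variable K : nat -> set (probability T R).
Local Notation ent := (dv_entropy_le W).
Local Notation bm := (@bounded_measurable d T R).
Hypothesis K_midpoint : forall n (V V' M : probability T R), K n V -> K n V' ->
  (forall g, bm g -> mean M g = (mean V g + mean V' g) / 2) -> K n M.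
Hypothesis K_decr : forall n m, (n <= m)%N -> K m `<=` K n.
Hypothesis KWstar : forall n, K n Wstar.
Hypothesis entWstar : ent Wstar H.
Hypothesis K_min : forall (V_ : nat -> probability T R) (V : probability T R) (e : nat -> R) c,
  (forall n, K n (V_ n)) -> e @ \oo --> 0 ->
  (forall n A, measurable A -> `|fine (V_ n A) - fine (V A)| <= e n) ->
  ent V c -> H <= c.

Let E n := [set c | exists2 V, K n V & ent V c].
Let J n := inf (E n).

Let hasE n : has_inf (E n).
Proof.
split; first by exists H, Wstar.
by exists 0 => c [V _ /dv_entropy_ge0].
Qed.

Let J_le n V c : K n V -> ent V c -> J n <= c.
Proof. by move=> KV eV; apply: ge_inf; [exact: (hasE n).2|exists V]. Qed.

Let J_ub n : J n <= H. Proof. exact: J_le (KWstar n) entWstar. Qed.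

Let J_nd n m : (n <= m)%N -> J n <= J m.
Proof.
move=> nm; apply: lb_le_inf; first by have [] := hasE m.
by move=> c [V KV eV]; apply: J_le eV; exact: K_decr nm _ KV.
Qed.

(** Near minimisers are close to each other: their midpoint satisfies the
constraint, so that its entropy is not below the minimum. *)
Let near_min n V V' a b h : K n V -> K n V' -> ent V a -> ent V' b -> bm h ->
  (forall x, `|h x| <= 1) ->
  (mean V h - mean V' h) ^+ 2 <= 16 * (a + b - 2 * J n).
Proof.
move=> KV KV' eV eV' bh h1; have [M ME] := midpoint_ex V V'.
have KM := K_midpoint KV KV' ME.
apply/ler_addgt0Pr => eps eps0.
have : ~ ent M (J n - eps / 32).
  by move=> /(J_le KM); rewrite lerBrDr gerDl; apply/negP; rewrite -ltNge divr_gt0.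
by move/(dv_entropy_midpoint ME eV eV') => /(_ _ bh h1) /le_trans; apply; lra.
Qed.

Lemma min_entropy_cvg : J @ \oo --> H.
Proof.
have cJ : cvgn J.
  apply: nondecreasing_is_cvgn; first exact: J_nd.
  by exists H => _ [n _ <-].
set L := limn J in cJ *; have JL n : J n <= L.
  by apply: nondecreasing_cvgn_le => //; exact: J_nd.
suff : H <= L.
  move=> HL; suff -> : H = L by [].
  apply/eqP; rewrite eq_le HL/=; apply: limr_le => //; exact: nearW.
have ex n : exists V, K n V /\ ent V (J n + n.+1%:R^-1).
  have := @inf_adherent _ (E n) n.+1%:R^-1 _ (hasE n).
  rewrite invr_gt0 ltr0n => /(_ isT)[c [V KV eV] cJn].
  by exists V; split => //; apply: dv_entropy_leW eV; exact: ltW.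
have [V_ V_P] := choice ex.
pose e n := Num.sqrt (16 * (2 * (L - J n) + 2 * n.+1%:R^-1)).
have e0 : e @ \oo --> 0.
  rewrite -(sqrtr0 R); apply: (@continuous_cvg _ _ _ _ _ _ (fun x => Num.sqrt x)).
    exact: sqrt_continuous.
  rewrite -(mulr0 16); apply: cvgMr.
  rewrite -(addr0 0) -(mulr0 2); apply: cvgD; apply: cvgMr.
    by rewrite -(subrr L); apply: cvgB => //; exact: cvg_cst.
  exact: cvg_harmonic.
have V_cauchy n m A : (n <= m)%N -> measurable A ->
    `|fine (V_ n A) - fine (V_ m A)| <= e n.
  move=> nm mA; rewrite -sqrtr_sqr ler_wsqrtr//.
  have [Kn en] := V_P n; have [Km em] := V_P m.
  have := near_min Kn (K_decr nm Km) en em (bm_indic _ mA).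
  rewrite !mean_indic// => /(_ _)/le_trans; apply.
    by move=> x; rewrite indicE; case: (_ \in _); rewrite ?normr1// normr0.
  rewrite ler_pM2l//.
  have : m.+1%:R^-1 <= n.+1%:R^-1 :> R by rewrite lef_pV2 ?posrE// ler_nat.
  have := JL n; have := JL m; move: n.+1%:R^-1 m.+1%:R^-1 => x y.
  by move: (J n) (J m) => a b; lra.
have [V VP] := tv_complete e0 V_cauchy.
apply: (K_min (fun n => (V_P n).1) e0 VP).
apply: (dv_entropy_tv_lim VP e0 (fun n => (V_P n).2)).
by rewrite -[X in _ --> X]addr0; apply: cvgD => //; exact: cvg_harmonic.
Qed.

Lemma mean_near_projection (eta : R) : 0 < eta -> exists n, forall V c h,
  K n V -> ent V c -> bm h -> (forall x, `|h x| <= 1) ->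
  (mean V h - mean Wstar h) ^+ 2 <= 16 * (c - H + eta).
Proof.
move=> eta0; have eta2 : 0 < eta / 2 by rewrite divr_gt0.
have /cvgrPdist_le /(_ _ eta2) [n _ /(_ n (leqnn n))] := min_entropy_cvg.
rewrite /= ler_distl => /andP[_ Hn]; exists n => V c h KV eV bh h1.
apply: le_trans (near_min KV (KWstar n) eV entWstar bh h1) _.
by rewrite ler_pM2l//; lra.
Qed.

End constraint_relaxation.

(** * Comparison with the entropy defined by densities *)

Section entropy_comparison.
Context d (T : measurableType d) (R : realType).
Variables W V : probability T R.
Local Notation bm := (@bounded_measurable d T R).

(** Test with [K * \1_A] for a [W]-null set [A] and all [K]. *)
Lemma dv_entropy_dominates (c : R) : dv_entropy_le W V c -> V `<< W.
Proof.
move=> eV; apply/null_content_dominatesP => A mA WA0.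
have bA : bm \1_A by exact: bm_indic.
have key (K : nat) : K%:R * fine (V A) <= c.
  have := eV _ (bmZ K%:R bA); rewrite meanZ// mean_indic//.
  suff -> : mean W (fun x => expR (K%:R * \1_A x)) = 1 by rewrite ln1 add0r.
  have -> : (fun x : T => expR (K%:R * \1_A x)) =
      fun x : T => 1 + (expR K%:R - 1) * \1_A x :> R.
    apply/funext => x; rewrite indicE.
    by case: (_ \in _); rewrite ?mulr1 ?mulr0 ?expR0; ring.
  rewrite meanD; [|exact: bm_cst|exact: bmZ].
  by rewrite mean_cst meanZ// mean_indic// WA0 mulr0 addr0.
rewrite -(fine_prob V mA); apply/eqP; rewrite eqe eq_le fine_prob_ge0 andbT.
rewrite leNgt; apply/negP => VA0.
have := truncnS_gt (c / fine (V A)); rewrite ltr_pdivrMr//.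
by apply/negP; rewrite -leNgt; exact: key.
Qed.

Let f0 := Radon_Nikodym_SigmaFinite.f V W.
Let rho x := fine (f0 x).

Hypothesis VW : V `<< W.

Let rhoE x : (rho x)%:E = f0 x.
Proof. by rewrite /rho fineK//; exact: Radon_Nikodym_SigmaFinite.f_fin_num. Qed.

Let rho_ge0 x : 0 <= rho x.
Proof. by rewrite -lee_fin rhoE; exact: Radon_Nikodym_SigmaFinite.f_ge0. Qed.

Let measurable_rho : measurable_fun setT rho.
Proof.
apply/measurable_EFinP; rewrite (_ : _ \o _ = f0); last exact/funext.
exact: measurable_int (Radon_Nikodym_SigmaFinite.f_integrable VW).
Qed.

Let int_rho : (\int[W]_x (rho x)%:E = 1)%E.
Proof.
under eq_integral do rewrite rhoE.
rewrite -Radon_Nikodym_SigmaFinite.f_integral//; exact: probability_setT.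
Qed.

Let N : set T := [set x | rho x = 0].

Let mN : measurable N.
Proof.
by have := measurable_rho measurableT (measurable_set1 0); rewrite setTI.
Qed.

Let VN0 : V N = 0%E.
Proof.
rewrite (Radon_Nikodym_SigmaFinite.f_integral VW)//.
by apply: integral0_eq => x Nx; rewrite -[LHS]rhoE Nx.
Qed.

Let u x := ln (rho x).

Let measurable_u : measurable_fun setT u.
Proof. exact: measurableT_comp. Qed.

Let log_densityE : ae_eq V setT (log_density V W) (EFin \o u).
Proof.
have h1 : ae_eq V setT (Radon_Nikodym (charge_of_finite_measure V) W) f0.
  apply: (null_dominates_ae_eq measurableT VW).
  by apply: ae_eq_sym; exact: ae_eq_Radon_Nikodym_SigmaFinite.
have h2 : {ae V, forall x, ~ N x}.
  by exists N; split => // x /=; rewrite notK.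
near=> x; rewrite /log_density => _.
have -> : Radon_Nikodym (charge_of_finite_measure V) W x = f0 x by near: x; apply: filterS h1 => x; apply.
rewrite -rhoE lne_EFin// lt_neqAle rho_ge0 andbT eq_sym; apply/eqP.
by near: x.
Unshelve. all: by end_near. Qed.

Let measurable_log_density : measurable_fun setT (log_density V W).
Proof.
have mf := measurable_int _ (Radon_Nikodym_integrable (nu := charge_of_finite_measure V) VW).
pose r x := fine (Radon_Nikodym (charge_of_finite_measure V) W x).
have mr : measurable_fun setT r by exact: measurableT_comp.
have -> : log_density V W = fun x => if r x <= 0 then -oo%E else (ln (r x))%:E.
  apply/funext => x; rewrite /log_density -[X in lne X]fineK//.
  exact: (Radon_Nikodym_fin_num (nu := charge_of_finite_measure V) _ VW).
apply: measurable_fun_ifT => //; first exact: measurable_fun_ler.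
by apply/measurable_EFinP; exact: measurableT_comp.
Qed.

Lemma integral_log_density :
  (\int[V]_x log_density V W x = \int[V]_x (u x)%:E)%E.
Proof.
by apply: ae_eq_integral => //; apply/measurable_EFinP.
Qed.

(** The function [t * ln t] is bounded below, so the negative part of the
log-density is integrable and the entropy is a well-defined integral. *)
Let u_neg x : (0 <= u x -> Num.max (- u x) 0 = 0) /\ Num.max (- u x) 0 * rho x <= 1.
Proof.
split=> [u0|]; first by apply/max_idPr; rewrite oppr_le0.
have [u0|u0] := leP 0 (u x).
  by rewrite (max_idPr _) ?oppr_le0// mul0r.
rewrite (max_idPl _) ?oppr_ge0 ?ltW//.
have rho0 : 0 < rho x.
  rewrite lt_neqAle rho_ge0 andbT eq_sym; apply/eqP => r0.
  by move: u0; rewrite /u r0 ln0// ltxx.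
by rewrite -ltr_pdivlMr// div1r /u -lnV ?posrE// ln_sublinear// invr_gt0.
Qed.

Let int_u_neg : (\int[V]_x (Num.max (- u x) 0)%:E <= 1)%E.
Proof.
have mu_neg : measurable_fun setT (fun x => Num.max (- u x) 0).
  by apply: measurable_maxr => //; exact: measurableT_comp.
rewrite -(Radon_Nikodym_SigmaFinite.change_of_variables VW)//; last 2 first.
- by move=> x; rewrite lee_fin le_max lexx orbT.
- exact/measurable_EFinP.
apply: (@le_trans _ _ (\int[W]_x 1%:E)%E).
  apply: ge0_le_integral => //.
  - by move=> x _; rewrite -/f0 -rhoE -EFinM lee_fin mulr_ge0// le_max lexx orbT.
  - apply: emeasurable_funM; first exact/measurable_EFinP.
    exact: measurable_int (Radon_Nikodym_SigmaFinite.f_integrable VW).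
  - by move=> x _; rewrite -/f0 -rhoE -EFinM lee_fin (u_neg x).2.
by rewrite (mean_EFin W (bm_cst _ 1)) mean_cst.
Qed.

(** The log-density truncated at both ends; its exponential is at most
[rho + expR (- K)], so its exponential moment under [W] is almost [1]. *)
Let tilt (M K : R) x := Num.min (ln (Num.max (rho x) (expR (- K)))) M.

Let bm_tilt M K : 0 <= M -> 0 <= K -> bm (tilt M K).
Proof.
move=> M0 K0; split.
  apply: measurable_minr => //; apply: measurableT_comp => //.
  exact: measurable_maxr.
exists (M + K) => x; rewrite /tilt ler_norml; apply/andP; split.
  rewrite le_min; apply/andP; split; last by lra.
  apply: (@le_trans _ _ (- K)); first by lra.
  by rewrite -[leLHS]expRK ler_ln ?posrE ?expR_gt0// ?lt_max ?expR_gt0 ?orbT// le_max lexx orbT.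
by rewrite ge_min; apply/orP; right; lra.
Qed.

Let mean_tilt (c M K : R) : dv_entropy_le W V c -> 0 <= M -> 0 <= K ->
  mean V (tilt M K) <= c + expR (- K).
Proof.
move=> eV M0 K0; have bt := bm_tilt M0 K0.
have /le_trans := eV _ bt; apply; rewrite addrC lerD2l.
have : mean W (fun x => expR (tilt M K x)) <= 1 + expR (- K).
  have be := bm_expR bt.
  rewrite -lee_fin -mean_EFin// EFinD -int_rho.
  rewrite -[X in (_ + X)%E](_ : (\int[W]_x (expR (- K))%:E)%E = _); last first.
    by rewrite (mean_EFin W (bm_cst _ (expR (- K)))) mean_cst.
  rewrite -ge0_integralD//;
    try by [move=> x _; rewrite lee_fin ?expR_ge0 ?rho_ge0|exact/measurable_EFinP].
  apply: ge0_le_integral => //.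
  - by apply/measurable_EFinP; exact: bm_measurable be.
  - by apply: emeasurable_funD; exact/measurable_EFinP.
  move=> x _; rewrite -EFinD lee_fin.
  apply: (@le_trans _ _ (expR (ln (Num.max (rho x) (expR (- K)))))).
    by rewrite ler_expR /tilt ge_min lexx.
  rewrite lnK ?posrE ?lt_max ?expR_gt0 ?orbT//.
  by rewrite ge_max lerDl expR_ge0/= lerDr.
have m0 := mean_expR_gt0 W bt.
rewrite -ler_ln ?posrE ?addr_gt0 ?expR_gt0//.
move/le_trans; apply.
rewrite -[leRHS]expRK ler_ln ?posrE ?addr_gt0 ?expR_gt0//.
exact: expR_ge1Dx.
Qed.

(** On the [V]-null set [N] where the density vanishes the logarithm has a default
value, hence the correction [K * \1_N] in the test function. *)
Let int_u_pos_trunc (c : R) (n : nat) : dv_entropy_le W V c ->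
  (\int[V]_x (Num.min (Num.max (u x) 0) n%:R)%:E <=
   c%:E + \int[V]_x (Num.max (- u x) 0)%:E)%E.
Proof.
move=> eV.
have mu_neg : measurable_fun setT (fun x => Num.max (- u x) 0).
  by apply: measurable_maxr => //; exact: measurableT_comp.
have iu_neg : V.-integrable setT (fun x => (Num.max (- u x) 0)%:E).
  apply/integrableP; split; first exact/measurable_EFinP.
  rewrite (eq_integral (fun x => (Num.max (- u x) 0)%:E)); last first.
    by move=> x _; rewrite gee0_abs// lee_fin le_max lexx orbT.
  by apply: le_lt_trans int_u_neg _; rewrite ltry.
have bmin : bm (fun x => Num.min (Num.max (u x) 0) n%:R).
  split; first by apply: measurable_minr => //; apply: measurable_maxr.
  exists n%:R => x; rewrite ger0_norm ?ge_min ?lexx ?orbT//.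
  by rewrite le_min le_max lexx orbT ler0n.
have key (K : nat) : (\int[V]_x (Num.min (Num.max (u x) 0) n%:R)%:E <=
   (c + expR (- K%:R))%:E + \int[V]_x (Num.max (- u x) 0)%:E)%E.
  have bt := bm_tilt (ler0n R n) (ler0n R K).
  have bK : bm (fun x => K%:R * \1_N x) by apply: bmZ; exact: bm_indic.
  have bg := bmD bt bK.
  apply: (@le_trans _ _ ((mean V (fun x => tilt n%:R K%:R x + K%:R * \1_N x))%:E
      + \int[V]_x (Num.max (- u x) 0)%:E)%E); last first.
    rewrite leeD2r// lee_fin meanD// meanZ ?mean_indic//; last exact: bm_indic.
    by rewrite VN0 mulr0 addr0; exact: mean_tilt.
  rewrite -mean_EFin// -integralD//; last exact: (bm_integrable V bg).
  apply: le_integral => //; first exact: (bm_integrable V bmin).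
    by apply: integrableD => //; exact: (bm_integrable V bg).
  move=> x _; rewrite -EFinD lee_fin indicE.
  have [xN|xN] := boolP (x \in N).
    have r0 : rho x = 0 by rewrite inE in xN.
    rewrite /u /tilt r0 ln0// oppr0 maxxx mulr1.
    rewrite (max_idPr _) ?expR_ge0// expRK (min_idPl _) ?ler0n//.
    have := ler0n R K; have := ler0n R n.
    by rewrite addr0 minEle; case: ifP => _; lra.
  have r0 : 0 < rho x.
    by rewrite lt_neqAle rho_ge0 andbT eq_sym; apply/eqP => r0; move: xN; rewrite notin_setE.
  rewrite mulr0 addr0.
  have ut : Num.min (u x) n%:R <= tilt n%:R K%:R x.
    rewrite /tilt le_min ge_min [X in _ && X]ge_min lexx orbT andbT.
    by rewrite /u ler_ln ?posrE ?lt_max ?r0// le_max lexx.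
  have [u0|] := boolP (0 <= u x); last rewrite -ltNge => u0.
    rewrite (max_idPl u0); apply: (le_trans ut).
    by rewrite lerDl le_max lexx orbT.
  rewrite (max_idPr (ltW u0)) (min_idPl (ler0n _ _)).
  rewrite (max_idPl _) ?oppr_ge0 ?(ltW u0)//.
  have un : u x <= n%:R by rewrite (le_trans (ltW u0)).
  by move: ut; rewrite (min_idPl un); lra.
apply/lee_addgt0Pr => eps eps0.
have := truncnS_gt eps^-1; set K := (Num.truncn _).+1 => ltK.
apply: le_trans (key K) _.
have ltKeps : expR (- K%:R) <= eps.
  rewrite expRN -[leRHS]invrK lef_pV2 ?posrE ?expR_gt0 ?invr_gt0//.
  by apply: le_trans (ltW ltK) _; apply: le_trans (expR_ge1Dx _); rewrite lerDr.
rewrite EFinD -addeA -[leRHS]addeA; apply: leeD => //.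
by rewrite addeC; apply: leeD => //; rewrite lee_fin.
Qed.

(** The entropy defined with the Radon-Nikodym density is bounded by its
Donsker-Varadhan counterpart: test with truncations of the log-density. *)
Lemma relative_entropy_le_dv (c : R) : dv_entropy_le W V c ->
  (relative_entropy V W <= c%:E)%E.
Proof.
move=> eV.
have upos : (\int[V]_x (Num.max (u x) 0)%:E <=
   c%:E + \int[V]_x (Num.max (- u x) 0)%:E)%E.
  have mpos : measurable_fun setT (fun x => Num.max (u x) 0).
    exact: measurable_maxr.
  have := @monotone_convergence _ _ _ V setT measurableT
    (fun n x => (Num.min (Num.max (u x) 0) n%:R)%:E).
  rewrite (eq_integral (fun x => (Num.max (u x) 0)%:E)); last first.
    move=> x _; apply: cvg_lim => //; apply: cvg_near_cst.
    exists (Num.truncn (Num.max (u x) 0)).+1 => // n /= ltn.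
    rewrite (min_idPl _)//; apply: (le_trans (ltW (truncnS_gt _))).
    by rewrite ler_nat.
  move=> ->; last 3 first.
  - by move=> n; apply/measurable_EFinP; apply: measurable_minr.
  - by move=> n x _; rewrite lee_fin le_min le_max lexx orbT ler0n.
  - move=> x _ n m nm; rewrite lee_fin le_min ge_min lexx/= ge_min.
    by rewrite ler_nat nm orbT.
  apply: lime_le; last by apply: nearW => n; exact: int_u_pos_trunc.
  apply: ereal_nondecreasing_is_cvgn => n m nm; apply: ge0_le_integral => //.
  - by move=> x _; rewrite lee_fin le_min le_max lexx orbT ler0n.
  - by apply/measurable_EFinP; apply: measurable_minr.
  - by apply/measurable_EFinP; apply: measurable_minr.
  - move=> x _; rewrite lee_fin le_min ge_min lexx/= ge_min.
    by rewrite ler_nat nm orbT.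
have uneg0 : (0 <= \int[V]_x (Num.max (- u x) 0)%:E)%E.
  by apply: integral_ge0 => x _; rewrite lee_fin le_max lexx orbT.
have upos0 : (0 <= \int[V]_x (Num.max (u x) 0)%:E)%E.
  by apply: integral_ge0 => x _; rewrite lee_fin le_max lexx orbT.
have uneg_fin : (\int[V]_x (Num.max (- u x) 0)%:E \is a fin_num)%E.
  by rewrite ge0_fin_numE//; apply: le_lt_trans int_u_neg _; rewrite ltry.
have upos_fin : (\int[V]_x (Num.max (u x) 0)%:E \is a fin_num)%E.
  rewrite ge0_fin_numE//; apply: le_lt_trans upos _.
  by rewrite -(fineK uneg_fin) -EFinD ltry.
have intE : (\int[V]_x log_density V W x =
    \int[V]_x (Num.max (u x) 0)%:E - \int[V]_x (Num.max (- u x) 0)%:E)%E.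
  rewrite integral_log_density integralE; congr (_ - _)%E.
    by apply: eq_integral => x _; rewrite funeposE -EFin_max.
  by apply: eq_integral => x _; rewrite funenegE -EFinN -EFin_max.
rewrite /relative_entropy; case: asboolP => [_|]; last first.
  by case; split => //; rewrite intE fin_numB upos_fin.
by rewrite intE leeBlDr.
Qed.
End entropy_comparison.

(** * Conditioning a sample *)

Section bounded_log_density.
Context d (T : measurableType d) (R : realType).
Variables (W Wstar : probability T R) (phi : T -> R).
Local Notation bm := (@bounded_measurable d T R).
Hypothesis bphi : bm phi.
Hypothesis phiE : {ae W, forall x, log_density Wstar W x = (phi x)%:E}.
Hypothesis finite_entropy : (relative_entropy Wstar W < +oo)%E.

Let dom : Wstar `<< W.
Proof. by move: finite_entropy; rewrite /relative_entropy; case: asboolP => // -[]. Qed.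

Let RN := Radon_Nikodym (charge_of_finite_measure Wstar) W.

Let RN_fin x : RN x \is a fin_num.
Proof. exact: (Radon_Nikodym_fin_num (nu := charge_of_finite_measure Wstar) x dom). Qed.

Let measurable_RN : measurable_fun setT RN.
Proof. exact: measurable_int _ (Radon_Nikodym_integrable (nu := charge_of_finite_measure Wstar) dom). Qed.

Let RN_phi : ae_eq W setT RN (fun x => (expR (phi x))%:E).
Proof.
apply: filterS phiE => x; rewrite /log_density -/RN -(fineK (RN_fin x)) /=.
case: ifPn => // /negbTE; rewrite leNgt => /negbFE r0 [<-] _.
by rewrite lnK.
Qed.

Lemma mean_density f : bm f -> mean Wstar f = mean W (fun x => f x * expR (phi x)).
Proof.
move=> bf; have be := bm_expR bphi.
apply: EFin_inj; rewrite -!mean_EFin//; last exact: bmM.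
rewrite -(Radon_Nikodym_change_of_variables dom measurableT (bm_integrable Wstar bf)).
apply: ae_eq_integral => //.
- by apply: emeasurable_funM => //; apply/measurable_EFinP; exact: bm_measurable bf.
- by apply/measurable_EFinP; exact: bm_measurable (bmM bf be).
by apply: filterS RN_phi => x /= /(_ I); rewrite -/RN EFinM => ->.
Qed.

Lemma relative_entropy_mean : relative_entropy Wstar W = (mean Wstar phi)%:E.
Proof.
have phiE' : ae_eq Wstar setT (log_density Wstar W) (EFin \o phi).
  apply: (null_dominates_ae_eq measurableT dom).
  by apply: filterS phiE => x + _.
have -> : relative_entropy Wstar W = (\int[Wstar]_x log_density Wstar W x)%E.
  by move: finite_entropy; rewrite /relative_entropy; case: asboolP.
rewrite -mean_EFin//; apply: ae_eq_integral => //.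
  pose r x := fine (RN x).
  have mr : measurable_fun setT r by exact: measurableT_comp.
  have -> : log_density Wstar W = fun x => if r x <= 0 then -oo%E else (ln (r x))%:E.
    by apply/funext => x; rewrite /log_density -/RN -[X in lne X]fineK.
  apply: measurable_fun_ifT => //; first exact: measurable_fun_ler.
  by apply/measurable_EFinP; exact: measurableT_comp.
by apply/measurable_EFinP; exact: bm_measurable bphi.
Qed.

(** Gibbs' variational principle: this is Jensen's inequality for [g - phi]. *)
Lemma dv_entropy_projection : dv_entropy_le W Wstar (mean Wstar phi).
Proof.
move=> g bg; have bgp := bmB bg bphi.
have := mean_le_ln_mean_expR Wstar bgp; rewrite meanB//.
rewrite (mean_density (bm_expR bgp)).
under [F in mean W F]eq_fun do rewrite -expRD subrK.
by lra.
Qed.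

End bounded_log_density.

Definition rot_invariant (T : Type) (D : set (seq T)) :=
  forall k s, D s -> D (rot k s).

Lemma rot_invariantE (T : Type) (D : set (seq T)) : rot_invariant D ->
  forall k s, D (rot k s) = D s.
Proof.
move=> Drot k s; apply/propext; split=> [|/Drot//].
by move=> /(Drot (size (rot k s) - k)%N); rewrite -/(rotr k (rot k s)) rotK.
Qed.

Section conditioning_on_rot_invariant.
Context d (T : measurableType d) (R : realType).
Variables (W : probability T R) (n : nat) (D : set (seq T)).
Local Notation bm := (@bounded_measurable d T R).
Hypothesis n_gt0 : (0 < n)%N.
Hypothesis mD : measurable_seq D.
Let p : R := mean_seq W n \1_D.
Hypothesis p_gt0 : 0 < p.

Let bD : bm_seq (\1_D : seq T -> R) := bm_seq_indic R mD.

Let n0 : 0 < n%:R :> R. Proof. by rewrite ltr0n. Qed.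

(** [Pi] is the mean of the empirical measure of the sample conditioned on [D];
for an exchangeable event it is the conditional law of the first term. *)
Lemma mean_empirical_ex : exists Pi : probability T R, forall g, bm g ->
  mean Pi g = mean_seq W n (fun s => \1_D s * \sum_(x <- s) g x) / (p * n%:R).
Proof.
pose L (g : T -> R) := mean_seq W n (fun s => \1_D s * \sum_(x <- s) g x) / (p * n%:R).
have c0 : 0 < p * n%:R by rewrite mulr_gt0.
have bL g : bm g -> bm_seq (fun s => \1_D s * \sum_(x <- s) g x).
  by move=> bg; apply: bm_seqM => //; exact: bm_seq_sum.
have LD f g : bm f -> bm g -> L (fun x => f x + g x) = L f + L g.
  move=> bf bg; rewrite /L -mulrDl -mean_seqD; [|exact: bL|exact: bL].
  congr (_ / _); apply: eq_mean_seq => s _.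
  by rewrite big_split/= mulrDr.
have LZ c f : bm f -> L (fun x => c * f x) = c * L f.
  move=> bf; rewrite /L mulrA -mean_seqZ; last exact: bL.
  congr (_ / _); apply: eq_mean_seq => s _.
  by rewrite -mulr_sumr; ring.
have L_le f g : bm f -> bm g -> (forall x, f x <= g x) -> L f <= L g.
  move=> bf bg fg; rewrite /L ler_pM2r ?invr_gt0//.
  apply: le_mean_seq; [exact: bL|exact: bL|] => s _.
  by apply: ler_wpM2l; [rewrite indicE|exact: ler_sum].
pose C i (A : set T) := [set t : n.-tuple T | D t] `&` (fun t => tnth t i) @^-1` A.
have mC i A : measurable A -> measurable (C i A).
  move=> mA; apply: measurableI; first exact: mD.
  by rewrite -[_ @^-1` _]setTI; exact: measurable_tnth.
have L1 A : measurable A ->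
    L \1_A = (\sum_(i < n) fine (tuple_power W n (C i A))) / (p * n%:R).
  move=> mA; rewrite /L; congr (_ / _); rewrite /mean_seq.
  transitivity (mean (tuple_power W n) (fun t => \sum_(i < n) \1_(C i A) t)).
    congr mean; apply/funext => t; rewrite big_tuple mulr_sumr.
    apply: eq_bigr => i _; by rewrite /C indicI.
  rewrite mean_sum; last by move=> i; apply: bm_indic; exact: mC.
  by apply: eq_bigr => i _; rewrite mean_indic//; exact: mC.
pose v A := (\sum_(i < n) fine (tuple_power W n (C i A))) / (p * n%:R).
have [||||Pi PiE] := @probability_of_set_function _ T R v.
- move=> A; rewrite /v divr_ge0//; last exact: ltW.
  by apply: sumr_ge0 => i _; exact: fine_prob_ge0.
- rewrite /v big1 ?mul0r// => i _.
  by rewrite /C preimage_set0 setI0 measure0.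
- rewrite /v (eq_bigr (fun=> p)); last first.
    by move=> i _; rewrite /C preimage_setT setIT /p mean_seq_indic.
  by rewrite sumr_const card_ord -[p *+ n]mulr_natr divff// gt_eqF.
- move=> F mF tF; rewrite /v.
  under eq_fun do rewrite -mulr_suml exchange_big/=.
  apply: cvgMl; apply: cvg_big => [|i _]; first exact: add_continuous.
  have -> : C i (\bigcup_k F k) = \bigcup_k C i (F k).
    by rewrite /C preimage_bigcup setI_bigcupr.
  apply: fine_sigma_additive => [k|]; first exact: mC.
  move=> j k _ _ [t [[_ tj] [_ tk]]]; apply: tF => //.
  by exists (tnth t i).
exists Pi => g bg; symmetry; apply: (@mean_unique _ _ _ Pi L) => // A mA.
by rewrite L1// PiE.
Qed.

Variable Pi : probability T R.
Hypothesis PiE : forall g, bm g ->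
  mean Pi g = mean_seq W n (fun s => \1_D s * \sum_(x <- s) g x) / (p * n%:R).

(** The entropy [- ln p] of the conditional law of the sample is shared by its [n]
terms: apply [gibbs_conditional] to sums [\sum_(x <- s) g x]. *)
Lemma dv_entropy_mean_empirical : dv_entropy_le W Pi (- ln p / n%:R).
Proof.
move=> g bg; rewrite PiE// invfM mulrA ler_pdivrMr// mulrDl divfK ?gt_eqF//.
have := gibbs_conditional mD (bm_seq_sum bg) p_gt0.
by rewrite mean_seq_expR_sum// lnXn ?mean_expR_gt0// mulr_natr.
Qed.

(** Linear inequalities satisfied by the empirical measure on [D] are inherited by
its conditional mean. *)
Lemma mean_empirical_set (F : set T) (b : R) : measurable F ->
  (forall s, size s = n -> D s -> \sum_(x <- s) \1_F x <= n%:R * b) ->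
  fine (Pi F) <= b.
Proof.
move=> mF sF; have bF : bm (\1_F) by exact: bm_indic.
rewrite -mean_indic// PiE// ler_pdivrMr ?mulr_gt0//.
have -> : b * (p * n%:R) = (n%:R * b) * p by ring.
rewrite -mean_seqZ//; apply: le_mean_seq.
- by apply: bm_seqM => //; exact: bm_seq_sum.
- by apply: bm_seqM => //; exact: bm_seq_cst.
move=> s sn; rewrite mulrC indicE; have [sD|_] := boolP (s \in D); last by rewrite !mulr0.
by rewrite !mulr1; apply: sF => //; rewrite inE in sD.
Qed.

Hypothesis Drot : rot_invariant D.
Variables (Wstar : probability T R) (phi : T -> R).
Hypothesis bphi : bm phi.
Hypothesis WstarE : forall f, bm f ->
  mean Wstar f = mean W (fun x => f x * expR (phi x)).

(** Tilting by [phi] turns [W] into [Wstar], under which the [K] consecutive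
blocks of length [k] are independent; exchangeability makes all blocks equal in
law under the conditioning. *)
Lemma conditional_block_bound (k K : nat) (B : set (seq T)) (s : R) :
  measurable_seq B -> (K * k <= n)%N -> `|s| <= 2^-1 ->
  K%:R * s * (mean_seq W n (fun t => \1_D t * \1_B (take k t)) / p -
              mean_seq Wstar k \1_B) + n%:R * mean Pi phi <=
  2 * K%:R * s ^+ 2 - ln p.
Proof.
move=> mB Kk s1; set b := mean_seq Wstar k \1_B.
have bB : bm_seq (\1_B : seq T -> R) := bm_seq_indic R mB.
(* The last [n - K * k] terms of the sample belong to no block. *)
pose blk i (t : seq T) := take k (drop (i * k) t).
have bblk i F : bm_seq F -> bm_seq (fun t => F (blk i t) : R).
  move=> bF m.
  exact: (bm_comp (@measurable_drop _ _ (i * k) m) (bm_seq_take k bF _)).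
pose h (t : seq T) : R := \1_B t - b.
have bh : bm_seq h by move=> m; apply: bmB; [exact: bB|exact: bm_cst].
pose Psi (t : seq T) := \sum_(i < K) s * h (blk i t).
have bPsi : bm_seq Psi.
  move=> m; rewrite /Psi; apply: bm_sum => i; apply: bmZ; exact: (bblk i _ bh m).
have bphis := bm_seq_sum bphi.
have := gibbs_conditional mD (bm_seqD bPsi bphis) p_gt0.
rewrite -/p.
have -> : mean_seq W n (fun t => \1_D t * (Psi t + \sum_(x <- t) phi x)) / p =
    K%:R * s * (mean_seq W n (fun t => \1_D t * \1_B (take k t)) / p - b) +
    n%:R * mean Pi phi.
  have bDB i : bm_seq (fun t => \1_D t * \1_B (blk i t) : R).
    by apply: bm_seqM => //; exact: bblk.
  have -> : (fun t => \1_D t * (Psi t + \sum_(x <- t) phi x)) =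
      (fun t => (\sum_(i < K) s * (\1_D t * \1_B (blk i t)) + (- (K%:R * s * b)) * \1_D t) +
         \1_D t * \sum_(x <- t) phi x :> R).
    apply/funext => t; rewrite mulrDr; congr (_ + _).
    rewrite /Psi /h -!mulr_sumr sumrB sumr_const card_ord -mulr_natl; ring.
  rewrite mean_seqD; last 2 first.
  - apply: bm_seqD.
      by move=> m; apply: bm_sum => i; apply: bmZ; exact: bDB.
    by apply: bm_seqM => //; exact: bm_seq_cst.
  - exact: bm_seqM.
  rewrite mean_seqD; last 2 first.
  - by move=> m; apply: bm_sum => i; apply: bmZ; exact: bDB.
  - by apply: bm_seqM => //; exact: bm_seq_cst.
  rewrite mean_seqZ// PiE// -/p.
  have -> : mean_seq W n (fun t => \sum_(i < K) s * (\1_D t * \1_B (blk i t))) =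
      K%:R * s * mean_seq W n (fun t => \1_D t * \1_B (take k t)).
    rewrite /mean_seq mean_sum; last by move=> i; apply: bmZ; exact: bDB.
    rewrite (eq_bigr (fun=> s * mean_seq W n (fun t => \1_D t * \1_B (take k t)))).
      by rewrite sumr_const card_ord -[LHS]mulr_natl mulrA.
    move=> i _; rewrite meanZ; last exact: bDB.
    congr (_ * _).
    have ikn : (i * k + k <= n)%N.
      by rewrite addnC -mulSn (leq_trans _ Kk)// leq_mul2r ltn_ord orbT.
    rewrite -(@mean_seq_rot _ _ _ W (i * k) n (fun t => \1_D t * \1_B (take k t))).
    - rewrite /mean_seq; congr mean; apply/funext => t; have tn := size_tuple t.
      congr (_ * _).
        rewrite !indicE; have -> // : (rot (i * k) (tval t) \in D) = (tval t \in D).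
        by apply/idP/idP; rewrite !inE rot_invariantE.
      by rewrite /blk /rot takel_cat// size_drop tn leq_subRL// (leq_trans _ ikn)// leq_addr.
    - by rewrite (leq_trans _ ikn)// leq_addr.
    - by apply: bm_seqM => //; exact: bm_seq_take.
  by field; rewrite !gt_eqF.
move/le_trans; apply; rewrite lerD2r.
have be : bm_seq (fun t => expR (Psi t)) by exact: bm_seq_expR.
have -> : mean_seq W n (fun t => expR (Psi t + \sum_(x <- t) phi x)) =
    mean_seq Wstar n (fun t => expR (Psi t)).
  rewrite (mean_seq_density n bphi WstarE be); apply: eq_mean_seq => t _.
  exact: expRD.
have -> : mean_seq Wstar n (fun t => expR (Psi t)) =
    mean_seq Wstar k (fun t => expR (s * h t)) ^+ K.
  have -> : n = (K * k + (n - K * k))%N by rewrite subnKC.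
  move: (n - K * k)%N => r; rewrite {be bPsi} /Psi.
  have bE : bm_seq (fun t => expR (s * h t)).
    by move=> m; apply: bm_expR; apply: bmZ; exact: bh.
  elim: K {Kk} => [|K' ih].
    rewrite expr0; under [F in mean_seq _ _ F]funext do rewrite big_ord0 expR0.
    exact: mean_cst.
  rewrite exprS -ih mulSn -addnA -mean_seqM//; last first.
    move=> m; apply: bm_expR; apply: bm_sum => i; apply: bmZ; exact: (bblk i _ bh m).
  apply: eq_mean_seq => t _; rewrite big_ord_recl expRD /blk mul0n drop0.
  congr (_ * expR _); apply: eq_bigr => i _.
  by rewrite drop_drop lift0 mulSn addnC.
have bhk := bh k; have bBk := bB k.
have h1 (t : k.-tuple T) : `|h t| <= 1.
  have b01 : 0 <= b <= 1.
    rewrite /b mean_seq_indic// fine_prob_ge0/= fine_prob_le1//; exact: mB.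
  by rewrite /h indicE ler_norml; case: (_ \in _) => /=; move/andP: b01 => [? ?]; apply/andP; split; lra.
have := mean_expR_scale (tuple_power Wstar k) bhk h1 s1.
have -> : mean (tuple_power Wstar k) (fun t => h t) = 0.
  by rewrite /h meanB ?mean_cst; [rewrite -/(mean_seq Wstar k _) subrr|exact: bB|exact: bm_cst].
rewrite mulr0 add0r -/(mean_seq Wstar k (fun t => expR (s * h t))) => le1.
have m0 : 0 < mean_seq Wstar k (fun t => expR (s * h t)).
  by apply: mean_expR_gt0; apply: bmZ; exact: bh.
have lm : ln (mean_seq Wstar k (fun t => expR (s * h t))) <= 2 * s ^+ 2.
  by rewrite -[leRHS]expRK ler_ln ?posrE ?expR_gt0.
rewrite lnXn// -[X in X <= _]mulr_natl (_ : 2 * K%:R * s ^+ 2 = K%:R * (2 * s ^+ 2)).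
  exact: ler_wpM2l.
by ring.
Qed.

End conditioning_on_rot_invariant.

(** On [D] the law of a sample of [Wstar] has density at most [expR h] with respect
to the law of a sample of [W]. *)
Lemma change_of_measure_lower_bound d (T : measurableType d) (R : realType)
    (W Wstar : probability T R) (phi : T -> R) (n : nat) (D : set (seq T)) (h : R) :
  bounded_measurable phi ->
  (forall f, bounded_measurable f ->
    mean Wstar f = mean W (fun x => f x * expR (phi x))) ->
  measurable_seq D ->
  (forall s, D s -> \sum_(x <- s) phi x <= h) ->
  expR (- h) * mean_seq Wstar n \1_D <= mean_seq W n \1_D.
Proof.
move=> bphi WstarE mD Dh; have bD := bm_seq_indic R mD.
have bs := bm_seq_expR (bm_seq_sum bphi).
rewrite (mean_seq_density n bphi WstarE bD) -mean_seqZ; last exact: bm_seqM.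
apply: le_mean_seq => //; first by apply: bm_seqM; [exact: bm_seq_cst|exact: bm_seqM].
move=> s _; rewrite indicE; have [sD|_] := boolP (s \in D); last by rewrite mul0r mulr0.
rewrite mul1r -expRD -[leRHS]expR0 ler_expR; rewrite inE in sD.
by have := Dh s sD; lra.
Qed.

(** * Law of the sample *)

Section joint_law.
Context d d' (Omega : measurableType d) (T : measurableType d') (R : realType).
Variables (P : probability Omega R) (W : probability T R).
Variable X : nat -> {mfun Omega >-> T}.
Hypothesis X_indep : mutually_independent P (fun j => X j : Omega -> T).
Hypothesis X_law : forall j A, measurable A -> distribution P (X j) A = W A.

Let sample a n w := [tuple X (a + j) w | j < n].

Let measurable_sample a n : measurable_fun setT (sample a n).
Proof.
apply/measurable_fun_tnthP => i.
rewrite (_ : _ \o _ = X (a + i)%N); first exact: measurable_funPT.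
by apply/funext => w /=; rewrite tnth_mktuple.
Qed.

Let cyl a (A : nat -> set T) : set Omega :=
  [set w | forall j, j \in iota 0 a -> A j (X j w)].

Let cylS a A B : cyl a A `&` X a @^-1` B =
  cyl a.+1 (fun j => if j == a then B else A j).
Proof.
rewrite /cyl -addn1 iotaD add0n; apply/seteqP; split => w /=.
  move=> [wA wB] j; rewrite mem_cat mem_iota/= inE; have [->//|ja] := eqVneq j a.
  by rewrite orbF => ja'; apply: wA; rewrite mem_iota.
move=> H; split.
  move=> j; rewrite mem_iota/= add0n => ja; have := H j.
  by rewrite mem_cat mem_iota/= add0n ja (ltn_eqF ja); apply.
by have := H a; rewrite mem_cat inE eqxx orbT; apply.
Qed.

Let measurable_cyl a A : (forall j, measurable (A j)) -> measurable (cyl a A).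
Proof.
move=> mA; elim: a => [|a ih].
  rewrite (_ : cyl 0 A = setT)//.
  by apply/seteqP; split.
rewrite (_ : cyl a.+1 A = cyl a A `&` X a @^-1` (A a)).
  by apply: measurableI => //; rewrite -[_ @^-1` _]setTI; exact: measurable_funPT.
rewrite cylS; congr cyl; apply/funext => j.
by have [->|] := eqVneq j a.
Qed.

(** Induction on the length [n] of the sample, for all starting indices [a]: the
earlier terms are kept in a cylinder, because independence is only given for
events that constrain each term separately. *)
Let sample_law a n A S : (forall j, measurable (A j)) -> measurable S ->
  P (cyl a A `&` sample a n @^-1` S) =
  ((\prod_(j <- iota 0 a) W (A j)) * tuple_power W n S)%E.
Proof.
elim: n a A S => [|n ih] a A S mA mS.
  have PA : P (cyl a A) = (\prod_(j <- iota 0 a) W (A j))%E.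
    rewrite [LHS](X_indep (iota_uniq 0 a) mA).
    by apply: eq_bigr => j _; rewrite -(X_law j (mA j)).
  have [S0|S0] := pselect (S [tuple]).
    have -> : sample a 0 @^-1` S = setT.
      by apply/seteqP; split => // w _ /=; rewrite (tuple0 (sample a 0 w)).
    have -> : S = setT by apply/seteqP; split => // t _; rewrite (tuple0 t).
    by rewrite setIT PA probability_setT mule1.
  have -> : S = set0 by apply/seteqP; split => // t; rewrite (tuple0 t).
  by rewrite preimage_set0 setI0 !measure0 mule0.
have fW j : W (A j) \is a fin_num by exact: fin_num_measure.
pose c : R := \prod_(j <- iota 0 a) fine (W (A j)).
have c0 : 0 <= c by apply: prodr_ge0 => j _; exact: fine_prob_ge0.
have cE : (\prod_(j <- iota 0 a) W (A j))%E = c%:E.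
  rewrite /c -prodEFin; apply: eq_bigr => j _; by rewrite fineK.
pose h w := (X a w, sample a.+1 n w).
have mh : measurable_fun setT h.
  by apply/measurable_fun_pair => //; exact: measurable_sample.
have sampleS w : sample a n.+1 w = [tuple of (h w).1 :: (h w).2].
  apply: eq_from_tnth => i; rewrite tnth_mktuple.
  case: (unliftP ord0 i) => [j|] ->; last by rewrite addn0.
  by rewrite tnthS tnth_mktuple lift0 addnS.
have mcyl := measurable_cyl a mA.
pose m1_ : {measure set (T * n.-tuple T) -> \bar R} :=
  pushforward (mrestr P mcyl) h.
pose m1 := m1_ mh.
pose m2 : {measure set (T * n.-tuple T) -> \bar R} :=
  mscale (NngNum c0) (W \x tuple_power W n)%E.
have m12 Z : measurable Z -> m1 Z = m2 Z.
  apply: (measure_unique [set A `*` B | A in measurable & B in measurable]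
            (fun=> setT)).
  - exact: measurable_prod_measurableType.
  - move=> _ _ [A1 mA1 [B1 mB1 <-]] [A2 mA2 [B2 mB2 <-]].
    exists (A1 `&` A2); first exact: measurableI.
    by exists (B1 `&` B2); [exact: measurableI|rewrite setXI].
  - by move=> i; exists setT => //; exists setT => //; rewrite setXTT.
  - by apply/seteqP; split => // x _; exists 0.
  - move=> _ [B mB [S' mS' <-]].
    rewrite /m2 /= /mscale/= product_measure1E//.
    have -> : m1 (B `*` S') = P (cyl a.+1 (fun j => if j == a then B else A j) `&`
        sample a.+1 n @^-1` S').
      rewrite -cylS /m1 /m1_ /= /pushforward /mrestr; congr (P _).
      by apply/seteqP; split => w /=; [move=> [[? ?] ?]|move=> [[? ?] ?]].
    rewrite ih//; last by move=> j; case: ifP.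
    rewrite -addn1 iotaD big_cat big_seq1/= add0n eqxx muleA; congr (_ * _ * _)%E.
    rewrite -cE big_seq [RHS]big_seq; apply: eq_bigr => j.
    by rewrite mem_iota add0n/= => ja; rewrite (ltn_eqF ja).
  - move=> k; rewrite /m1 /m1_ /= /pushforward /mrestr preimage_setT setTI.
    by apply: le_lt_trans (probability_le1 P mcyl) _; rewrite ltry.
have mS' : measurable [set p : T * n.-tuple T | S [tuple of p.1 :: p.2]].
  by rewrite -[X in measurable X]setTI; exact: measurable_cons_pair.
have := m12 _ mS'; rewrite /m1 /m1_ /m2 /= /mscale /pushforward /mrestr/= -cE => <-.
congr (P _); rewrite setIC; congr (_ `&` _).
by apply/seteqP; split => w /=; rewrite sampleS.
Qed.

Lemma joint_law n (S : set (n.-tuple T)) : measurable S ->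
  P ((fun w => [tuple X j w | j < n]) @^-1` S) = tuple_power W n S.
Proof.
move=> mS; have := @sample_law 0 n (fun=> setT) S (fun=> measurableT) mS.
by rewrite /= big_nil mul1e (_ : cyl 0 _ = setT) ?setTI//; apply/seteqP; split.
Qed.

End joint_law.

(** * Path space and the relaxed marginal constraint *)

Lemma le_lim_seq (R : realType) (u v : nat -> R) (a b : R) :
  u @ \oo --> a -> v @ \oo --> b -> (forall n, u n <= v n) -> a <= b.
Proof.
move=> ua vb uv; rewrite -(cvg_lim _ ua)// -(cvg_lim _ vb)//.
apply: ler_lim; [by apply/cvg_ex; exists a|by apply/cvg_ex; exists b|].
exact: nearW.
Qed.

Section path_space_facts.
Context {R : realType} {q : nat}.
Local Notation E := (path_space R q).
Implicit Types (x y : E) (t : unit_itv R) (v w : 'rV[R]_q).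

Lemma normr_coord_le_enorm v j : `|v 0 j| <= enorm v.
Proof.
rewrite -sqrtr_sqr; apply: ler_wsqrtr.
by rewrite (bigD1 j)//= lerDl sumr_ge0// => i _; exact: sqr_ge0.
Qed.

Lemma enorm_le_sum v : enorm v <= \sum_(j < q) `|v 0 j|.
Proof.
have s0 : 0 <= \sum_(j < q) `|v 0 j| by apply: sumr_ge0.
rewrite -[leRHS]ger0_norm// -[leRHS]sqrtr_sqr; apply: ler_wsqrtr.
rewrite expr2 mulr_sumr; apply: ler_sum => j _.
rewrite -real_normK ?num_real// expr2 ler_wpM2r//.
by rewrite (bigD1 j)//= lerDl sumr_ge0.
Qed.

Lemma cont_path x : continuous (x : unit_itv R -> 'rV[R]_q).
Proof. exact: (@cts_fun _ _ (x : continuousType _ _)). Qed.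

Let has_sup_enorm x y :
  has_sup (range (fun t => enorm (path_eval t x - path_eval t y))).
Proof.
apply: compact_has_sup; first by eexists; exists unit_itv0.
apply: continuous_compact; last exact: compact_unit_itv.
apply: continuous_subspaceT => t.
apply: (@continuous_comp _ _ _ (fun t => path_eval t x - path_eval t y));
  last exact: continuous_enorm.
apply: cvgB; [exact: nbhs_filter|exact: (@cont_path x t)|exact: (@cont_path y t)].
Qed.

Lemma enorm_path_eval x y t : enorm (path_eval t x - path_eval t y) <= mdist x y.
Proof. by apply: sup_upper_bound; [exact: has_sup_enorm|exists t]. Qed.

Lemma mdist_path_le x y (a : R) :
  (forall t, enorm (path_eval t x - path_eval t y) <= a) -> mdist x y <= a.
Proof.
move=> xya; apply: ge_sup; first by have [] := has_sup_enorm x y.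
by move=> _ [t _ <-].
Qed.

Lemma nbhs_enorm v (A : set 'rV[R]_q) (e : R) : 0 < e ->
  (forall w, enorm (v - w) < e -> A w) -> nbhs v A.
Proof.
move=> e0 H; apply/nbhs_ballP; exists (e / q.+1%:R); first by rewrite /= divr_gt0.
move=> w [_ vw]; apply: H; apply: le_lt_trans (enorm_le_sum _) _.
apply: (@le_lt_trans _ _ (\sum_(j < q) e / q.+1%:R)).
  apply: ler_sum => j _; apply: ltW; rewrite mxE mxE.
  exact: vw.
rewrite sumr_const card_ord -[X in X < _]mulr_natl mulrA ltr_pdivrMr// mulrC ltr_pM2l//.
by rewrite ltr_nat.
Qed.

Lemma continuous_path_eval t : continuous (path_eval t : E -> 'rV[R]_q).
Proof.
move=> x A /= /(nbhs_ballP (path_eval t x)) [e e0 es].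
apply/nbhs_ballP; exists e => //= y; rewrite ballEmdist/= => xy; apply: es.
split => // i j; rewrite ord1 /ball/=.
have := normr_coord_le_enorm (path_eval t x - path_eval t y) j.
rewrite !mxE => /le_lt_trans; apply.
exact: le_lt_trans (enorm_path_eval x y t) xy.
Qed.

Lemma measurable_path_eval t : measurable_fun setT (path_eval t : E -> 'rV[R]_q).
Proof.
move=> _ A mA; rewrite setTI; move: A mA.
suff : <<s open >> `<=` [set A | measurable (path_eval t @^-1` A : set E)] by [].
apply: smallest_sub; last first.
  move=> U oU; apply: sub_sigma_algebra.
  by have /continuousP := @continuous_path_eval t; exact.
split => /=.
- by rewrite preimage_set0; exact: measurable0.
- by move=> A mA; rewrite setTD preimage_setC; exact: measurableC.
- by move=> F mF; rewrite preimage_bigcup; exact: bigcupT_measurable.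
Qed.

Lemma measurable_open (U : set E) : open U -> measurable U.
Proof. exact: sub_sigma_algebra. Qed.

Lemma measurable_open_rV (U : set 'rV[R]_q) : open U -> measurable U.
Proof. exact: sub_sigma_algebra. Qed.

Lemma measurable_closed (U : set E) : closed U -> measurable U.
Proof. by move=> cU; rewrite -[U]setCK; apply: measurableC; apply: measurable_open; exact: closed_openC. Qed.

Lemma measurable_closed_rV (U : set 'rV[R]_q) : closed U -> measurable U.
Proof. by move=> cU; rewrite -[U]setCK; apply: measurableC; apply: measurable_open_rV; exact: closed_openC. Qed.

Lemma measurable_continuous (f : E -> R) : continuous f -> measurable_fun setT f.
Proof.
move=> cf; apply: (measurability _ (RGenOInfty.measurableE R)).
move=> _ [_ [a ->] <-]; rewrite setTI; apply: measurable_open.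
by have /continuousP := cf; apply; exact: interval_open.
Qed.

Lemma measurable_continuous_rV (f : 'rV[R]_q -> R) : continuous f -> measurable_fun setT f.
Proof.
move=> cf; apply: (measurability _ (RGenOInfty.measurableE R)).
move=> _ [_ [a ->] <-]; rewrite setTI; apply: measurable_open_rV.
by have /continuousP := cf; apply; exact: interval_open.
Qed.

Lemma measurable_coord t (j : 'I_q) :
  measurable_fun setT (fun x : E => path_eval t x 0 j).
Proof.
apply: (measurableT_comp (f := fun v : 'rV[R]_q => v 0 j)); last exact: measurable_path_eval.
apply: measurable_continuous_rV; exact: coord_continuous.
Qed.

Lemma lipschitz_measurable (f : E -> R) (K : R) :
  (forall x y, `|f x - f y| <= K * mdist x y) -> measurable_fun setT f.
Proof.
move=> fK; apply: measurable_continuous => x A /= /(nbhs_ballP (f x)) [e /= e0 es].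
have K0 : 0 < `|K| + 1 by rewrite ltr_wpDl.
apply/nbhs_ballP; exists (e / (`|K| + 1)) => /=; first by rewrite divr_gt0.
move=> y; rewrite ballEmdist/= ltr_pdivlMr// mulrC => xy; apply: es.
rewrite /ball/=; apply: le_lt_trans (fK x y) _; apply: le_lt_trans xy.
by rewrite ler_wpM2r ?mdist_ge0// (le_trans (ler_norm _))// lerDl.
Qed.

Lemma dist_to_set_lt (A : set E) x (r : R) : (dist_to_set A x < r%:E)%E ->
  exists2 y, A y & mdist x y < r.
Proof. by move=> /ereal_inf_lt[_ [y Ay <-]]; rewrite lte_fin; exists y. Qed.

(** Enlargements of arbitrary sets are countable intersections of open sets. *)
Lemma measurable_enlargement (A : set E) (r : R) : measurable (enlargement A r).
Proof.
rewrite (_ : enlargement A r = \bigcap_n [set x | exists2 y, A y & mdist x y < r + n.+1%:R^-1]).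
  apply: bigcapT_measurable => n; apply: measurable_open.
  rewrite openE => x [y Ay xy].
  apply/nbhs_ballP; exists (r + n.+1%:R^-1 - mdist x y); first by rewrite /= subr_gt0.
  move=> z; rewrite ballEmdist/= ltrBrDr => xz; exists y => //.
  by apply: le_lt_trans xz; rewrite (metric_sym x z) metric_triangle.
apply/seteqP; split => x.
  move=> xr n _; apply: dist_to_set_lt; apply: le_lt_trans xr _.
  by rewrite lte_fin ltrDl invr_gt0.
move=> H; rewrite /enlargement/=; apply/lee_addgt0Pr => e e0.
have := truncnS_gt e^-1; set n := Num.truncn _ => ne.
have [y Ay xy] := H n Logic.I.
apply: ge_ereal_inf; exists (mdist x y)%:E; first by exists y.
rewrite -EFinD lee_fin (le_trans (ltW xy))// lerD2l.
by rewrite -[leRHS]invrK lef_pV2 ?posrE ?invr_gt0// ltW.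
Qed.

End path_space_facts.

Definition fattening (R : realType) (q : nat) (F : set 'rV[R]_q) (delta : R) :
    set 'rV[R]_q :=
  [set y | exists2 z, F z & enorm (y - z) < delta].

Section relaxed_marginal_constraint.
Context {R : realType} {q : nat}.
Local Notation E := (path_space R q).
Implicit Types (x y : E) (t : unit_itv R) (V U : probability E R).
Variable nu : unit_itv R -> probability 'rV[R]_q R.

(** Distances to a set of probabilities are hard to average; these inequalities are
linear in [V], hold on thickened constraints that are thin enough, and become
the marginal constraint as [delta] tends to [0]. *)
Definition relaxed_constraint (delta : R) : set (probability E R) :=
  [set V | forall t (F : set 'rV[R]_q), closed F ->
    fine (V (path_eval t @^-1` F)) <= fine (nu t (fattening F delta)) + delta].

Lemma open_fattening (F : set 'rV[R]_q) delta : open (fattening F delta).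
Proof.
rewrite openE => y [z Fz yz].
apply: (@nbhs_enorm _ _ _ _ (delta - enorm (y - z))); first by rewrite subr_gt0.
move=> w yw; exists z => //.
have -> : w - z = - (y - w) + (y - z) by rewrite opprB addrA subrK.
apply: le_lt_trans (ler_enormD _ _) _; rewrite enormN.
by rewrite -ltrBrDr.
Qed.

Let measurable_fattening (F : set 'rV[R]_q) delta : measurable (fattening F delta).
Proof. exact: (measurable_open_rV (@open_fattening F delta)). Qed.

Let measurable_pre t (F : set 'rV[R]_q) : measurable F ->
  measurable (path_eval t @^-1` F : set E).
Proof. by move=> mF; rewrite -[X in measurable X]setTI; exact: measurable_path_eval. Qed.

Lemma relaxed_constraint_le delta delta' : delta <= delta' ->
  relaxed_constraint delta `<=` relaxed_constraint delta'.
Proof.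
move=> dd V KV t F cF; apply: le_trans (KV t F cF) _; apply: lerD => //.
apply: le_fine_prob => // y [z Fz yz]; exists z => //; exact: lt_le_trans dd.
Qed.

Lemma relaxed_constraint_midpoint delta V V' (M : probability E R) :
  relaxed_constraint delta V -> relaxed_constraint delta V' ->
  (forall g, bounded_measurable g -> mean M g = (mean V g + mean V' g) / 2) ->
  relaxed_constraint delta M.
Proof.
move=> KV KV' ME t F cF.
have mF := measurable_pre t (measurable_closed_rV cF).
rewrite -(mean_indic M mF) ME; last exact: bm_indic.
rewrite !mean_indic//; have := KV t F cF; have := KV' t F cF; lra.
Qed.

Lemma marginal_constraint_relaxed delta V : 0 < delta ->
  marginal_constraint nu V -> relaxed_constraint delta V.
Proof.
move=> d0 CV t F cF; have := CV t F (measurable_closed_rV cF).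
rewrite /pushforward => ->; rewrite -[leLHS]addr0; apply: lerD; last exact: ltW.
apply: le_fine_prob => //; first exact: measurable_closed_rV.
by move=> y Fy; rewrite /fattening/=; exists y => //; rewrite subrr enorm0.
Qed.

Lemma bigcap_fattening (F : set 'rV[R]_q) : closed F ->
  \bigcap_n fattening F n.+1%:R^-1 = F.
Proof.
move=> cF; apply/seteqP; split => y.
  move=> H; apply: contrapT => nFy.
  have := closed_openC cF; rewrite openE => /(_ y nFy) /nbhs_ballP[e /= e0 be].
  have := truncnS_gt e^-1; set n := Num.truncn _ => ne.
  have [z Fz yz] := H n Logic.I.
  suff : (~` F) z by [].
  apply: be; split => // i j; rewrite ord1 /ball/=.
  have := normr_coord_le_enorm (y - z) j; rewrite !mxE => /le_lt_trans; apply.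
  apply: lt_trans yz _.
  by rewrite -[ltRHS]invrK ltf_pV2 ?posrE ?invr_gt0.
by move=> Fy n _; rewrite /fattening/=; exists y => //; rewrite subrr enorm0 invr_gt0.
Qed.

Lemma cvg_fattening (mu : probability 'rV[R]_q R) F : closed F ->
  fine (mu (fattening F n.+1%:R^-1)) @[n --> \oo] --> fine (mu F).
Proof.
move=> cF.
suff : mu (fattening F n.+1%:R^-1) @[n --> \oo] --> (fine (mu F))%:E.
  by move/fine_cvgP => [].
rewrite fine_prob; last exact: measurable_closed_rV.
rewrite -[in X in _ --> X](bigcap_fattening cF).
apply: nonincreasing_cvg_mu => //.
- by rewrite (le_lt_trans (probability_le1 mu _)) ?ltry.
- by apply: bigcapT_measurable.
- move=> n m nm; apply/subsetPset => y [z Fz yz]; exists z => //.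
  by apply: lt_le_trans yz _; rewrite lef_pV2 ?posrE// ler_nat.
Qed.

(** A one-sided comparison is enough: the complements of the fattenings of [F] are
closed and give the reverse inequality in the limit. *)
Lemma eq_prob_closed (m m' : probability 'rV[R]_q R) :
  (forall F, closed F -> fine (m F) <= fine (m' F)) ->
  forall A, measurable A -> m A = m' A.
Proof.
move=> mm'.
have eqF F : closed F -> m F = m' F.
  move=> cF; have mF := measurable_closed_rV cF.
  rewrite -(fine_prob m mF) -(fine_prob m' mF); congr (_%:E).
  apply/eqP; rewrite eq_le mm'//=.
  apply: (le_lim_seq (cvg_fattening (mu := m') cF) (cvg_fattening (mu := m) cF)) => n.
  have oG := @open_fattening F n.+1%:R^-1; set G := fattening _ _ in oG *.
  have := mm' _ (open_closedC oG).
  by rewrite !fine_probC//; [lra|exact: measurable_open_rV..].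
have mE : @measurable _ ('rV[R]_q : measurableType _) = <<s @open 'rV[R]_q >> by [].
have openI_ : setI_closed (@open 'rV[R]_q) by move=> B C; exact: openI.
have cover : \bigcup_(k in [set: nat]) (fun=> setT) k = [set: 'rV[R]_q].
  by apply/seteqP; split => // x _; exists 0%N.
have fin (k : nat) : (m setT < +oo)%E.
  by have /= -> := probability_setT m; rewrite ltry.
apply: (measure_unique _ _ mE openI_ (fun=> openT) cover m m' _ fin) => U oU.
have mU := measurable_open_rV oU; have e := eqF _ (open_closedC oU).
have {}e : fine (m (~` U)) = fine (m' (~` U)) by rewrite e.
rewrite !fine_probC// in e.
have {}e : fine (m U) = fine (m' U) by move: e => /addrI/oppr_inj.
by apply: eq_trans (esym (fine_prob m mU)) _; rewrite e fine_prob.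
Qed.

Lemma relaxed_constraint_lim (V_ : nat -> probability E R) V (e : nat -> R) :
  (forall n, relaxed_constraint n.+1%:R^-1 (V_ n)) -> e @ \oo --> 0 ->
  (forall n A, measurable A -> `|fine (V_ n A) - fine (V A)| <= e n) ->
  marginal_constraint nu V.
Proof.
move=> KV e0 Ve t A mA.
pose h : {mfun E >-> 'rV[R]_q} :=
  HB.pack (path_eval t : E -> 'rV[R]_q) (isMeasurableFun.Build _ _ _ _ _ (measurable_path_eval t)).
rewrite -[LHS]/(distribution V h A).
apply: eq_prob_closed mA => F cF.
have mF := measurable_pre t (measurable_closed_rV cF).
have c1 : fine (nu t (fattening F n.+1%:R^-1)) + n.+1%:R^-1 + e n @[n --> \oo] -->
    fine (nu t F) + 0 + 0.
  by apply: cvgD => //; apply: cvgD; [exact: cvg_fattening|exact: cvg_harmonic].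
rewrite addr0 addr0 in c1.
apply: (le_lim_seq (cvg_cst (fine (V (path_eval t @^-1` F)))) c1) => n.
have := Ve n _ mF; rewrite ler_distl => /andP[H _].
by rewrite lerBlDr in H; apply: (le_trans H); rewrite lerD2r; exact: KV.
Qed.

End relaxed_marginal_constraint.

(** * The Prohorov and Fortet-Mourier metrics *)

Section empirical_measure.
Context d (T : measurableType d) (R : realType).
Local Notation bm := (@bounded_measurable d T R).

Lemma empiricalE n (x : nat -> T) (A : set T) :
  @empirical _ T R n x A = (n.+1%:R^-1 * \sum_(j < n.+1) \1_A (x j))%:E.
Proof. by rewrite /empirical /mscale /= /msum EFinM -sumEFin. Qed.

Lemma fine_empirical n (x : nat -> T) (A : set T) :
  fine ((@empirical _ T R n x : probability T R) A) =
  n.+1%:R^-1 * \sum_(j < n.+1) \1_A (x j).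
Proof. by rewrite -[RHS]/(fine (_)%:E) -empiricalE. Qed.

Lemma mean_empirical n (x : nat -> T) (f : T -> R) : bm f ->
  mean (@empirical _ T R n x) f = n.+1%:R^-1 * \sum_(j < n.+1) f (x j).
Proof.
move=> bf; symmetry.
apply: (@mean_unique _ T R (@empirical _ T R n x)
  (fun f => n.+1%:R^-1 * \sum_(j < n.+1) f (x j))) => //.
- by move=> g h _ _; rewrite big_split/= mulrDr.
- by move=> c g _; rewrite -mulr_sumr; ring.
- move=> g h _ _ gh; rewrite ler_pM2l ?invr_gt0//; exact: ler_sum.
- by move=> A mA; rewrite fine_empirical.
Qed.

End empirical_measure.

Section metrics.
Context {R : realType} {q : nat}.
Local Notation E := (path_space R q).
Implicit Types (x y : E) (t : unit_itv R) (V U : probability E R) (f : E -> R).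
Local Notation bm := (@bounded_measurable _ E R).

Definition fm_class : set (E -> R) := [set f | (sup_norm f + lip_norm f <= 1)%E].

Let sup_norm_ge f x : (`|f x|%:E <= sup_norm f)%E.
Proof. by apply: ereal_sup_ubound; exists x. Qed.

Let lip_norm_ge f x y : ((`|f x - f y| / mdist x y)%:E <= lip_norm f)%E.
Proof. by apply: ereal_sup_ubound; exists (x, y). Qed.

Lemma fm_class_le1 f x : fm_class f -> `|f x| <= 1.
Proof.
move=> cf; rewrite -lee_fin; apply: le_trans cf; apply: le_trans (sup_norm_ge f x) _.
rewrite leeDl//; apply: le_trans (lip_norm_ge f point point).
by rewrite lee_fin divr_ge0// mdist_ge0.
Qed.

Lemma fm_class_lip f x y : fm_class f -> `|f x - f y| <= mdist x y.
Proof.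
move=> cf; have : `|f x - f y| / mdist x y <= 1.
  rewrite -lee_fin; apply: le_trans cf; apply: le_trans (lip_norm_ge f x y) _.
  by rewrite leeDr//; apply: le_trans (sup_norm_ge f point); rewrite lee_fin.
have [d0|d0] := eqVneq (mdist x y) 0.
  by rewrite (mdist_positivity _ _ d0) subrr normr0 mdist_ge0.
by rewrite ler_pdivrMr ?mul1r// lt_neqAle eq_sym d0 mdist_ge0.
Qed.

Lemma fm_classP f (a b : R) : a + b <= 1 -> 0 <= b -> (forall x, `|f x| <= a) ->
  (forall x y, `|f x - f y| <= b * mdist x y) -> fm_class f.
Proof.
move=> ab b0 fa fb; rewrite /fm_class/=; apply: (@le_trans _ _ (a%:E + b%:E)%E); last by rewrite -EFinD lee_fin.
apply: leeD; apply: ge_ereal_sup.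
  by move=> _ [x _ <-]; rewrite lee_fin.
move=> _ [[x y] _ <-] /=; rewrite lee_fin.
have [d0|d0] := eqVneq (mdist x y) 0; first by rewrite d0 invr0 mulr0.
by rewrite ler_pdivrMr// lt_neqAle eq_sym d0 mdist_ge0.
Qed.

Lemma fm_class_bm f : fm_class f -> bm f.
Proof.
move=> cf; split; last by exists 1 => x; exact: fm_class_le1.
by apply: (@lipschitz_measurable _ _ _ 1) => x y; rewrite mul1r; exact: fm_class_lip.
Qed.

Lemma fortet_mourier_le V U (e : R) :
  (forall f, fm_class f -> mean V f - mean U f <= e) ->
  (fortet_mourier V U <= e%:E)%E.
Proof.
move=> H; apply: ge_ereal_sup => _ [f cf <-].
have bf := fm_class_bm cf.
by rewrite (mean_EFin V bf) (mean_EFin U bf) -EFinB lee_fin; exact: H.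
Qed.

Lemma fortet_mourier_ge V U f : fm_class f ->
  ((mean V f - mean U f)%:E <= fortet_mourier V U)%E.
Proof.
move=> cf; have bf := fm_class_bm cf; apply: ereal_sup_ubound; exists f => //.
by rewrite (mean_EFin V bf) (mean_EFin U bf) EFinB.
Qed.

(** The radii over which the Prohorov metric takes an infimum, without extended
reals. *)
Definition prohorov_radius V U (r : R) : Prop :=
  0 < r /\ forall A, measurable A -> fine (V A) <= fine (U (enlargement A r)) + r.

Lemma prohorov_radiusP V U (r : R) : prohorov_radius V U r <->
  [set r : R | (0 < r)%R /\
    (ereal_sup [set V A - U (enlargement A r) | A in measurable] <= r%:E)%E] r.
Proof.
split=> -[r0 H]; split => //.
  apply: ge_ereal_sup => _ [A mA <-].
  rewrite -(fine_prob V mA) -(fine_prob U (measurable_enlargement A r)) -EFinB.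
  by rewrite lee_fin lerBlDl; exact: H.
move=> A mA; rewrite -lerBlDl -lee_fin EFinB fine_prob// fine_prob; last exact: measurable_enlargement.
by apply: le_trans H; apply: ereal_sup_ubound; exists A.
Qed.

Lemma prohorov_le V U (r : R) : prohorov_radius V U r -> (prohorov V U <= r%:E)%E.
Proof. by move=> /prohorov_radiusP H; apply: ereal_inf_lbound; exists r. Qed.

Lemma prohorov_lt V U (r : R) : (prohorov V U < r%:E)%E ->
  exists2 r', r' < r & prohorov_radius V U r'.
Proof.
by move=> /ereal_inf_lt[_ [r' /prohorov_radiusP Hr' <-]]; rewrite lte_fin; exists r'.
Qed.

Lemma mem_enlargement (A : set E) (r : R) x y : A y -> mdist x y <= r -> enlargement A r x.
Proof.
by move=> Ay xy; apply: ge_ereal_inf; exists (mdist x y)%:E; [exists y|rewrite lee_fin].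
Qed.

Lemma enlargement_lt (A : set E) (r r' : R) x : enlargement A r x -> r < r' ->
  exists2 y, A y & mdist x y < r'.
Proof.
move=> Ax rr'; apply: dist_to_set_lt; apply: le_lt_trans Ax _; by rewrite lte_fin.
Qed.

Lemma enlargement_add (A : set E) (r s : R) :
  enlargement (enlargement A r) s `<=` enlargement A (r + s).
Proof.
move=> x Ax; apply/lee_addgt0Pr => e e0.
have e2 : 0 < e / 2 by rewrite divr_gt0.
have [|y Ay xy] := enlargement_lt (r' := s + e / 2) Ax; first by rewrite ltrDl.
have [|z Az yz] := enlargement_lt (r' := r + e / 2) Ay; first by rewrite ltrDl.
apply: ge_ereal_inf; exists (mdist x z)%:E; first by exists z.
rewrite -EFinD lee_fin; apply: le_trans (metric_triangle x y z) _.
by apply: le_trans (lerD (ltW xy) (ltW yz)) _; lra.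
Qed.

Variable nu : unit_itv R -> probability 'rV[R]_q R.

Let measurable_pre t (F : set 'rV[R]_q) : measurable F ->
  measurable (path_eval t @^-1` F : set E).
Proof. by move=> mF; rewrite -[X in measurable X]setTI; exact: measurable_path_eval. Qed.

Let measurable_fattening (F : set 'rV[R]_q) delta : measurable (fattening F delta).
Proof. exact: (measurable_open_rV (@open_fattening _ _ F delta)). Qed.

Let constraint_pre U t (G : set 'rV[R]_q) : marginal_constraint nu U -> measurable G ->
  fine (U (path_eval t @^-1` G)) = fine (nu t G).
Proof. by move=> CU mG; rewrite -(CU t G mG). Qed.

Lemma prohorov_thickened_relaxed (eps delta : R) V : eps < delta ->
  thickened_constraint prohorov nu eps V -> relaxed_constraint nu delta V.
Proof.
move=> ed HV t F cF.
have /ereal_inf_lt[_ [U CU <-] /prohorov_lt[r rd [r0 Hr]]] :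
    (ereal_inf [set prohorov V U | U in marginal_constraint nu] < delta%:E)%E.
  by apply: le_lt_trans HV _; rewrite lte_fin.
have mF := measurable_pre t (measurable_closed_rV cF).
apply: le_trans (Hr _ mF) _; apply: lerD; last exact: ltW.
rewrite -(constraint_pre t CU (measurable_fattening F delta)).
apply: le_fine_prob; [exact: measurable_enlargement|exact: measurable_pre|].
move=> x /enlargement_lt /(_ rd)[y Fy xy]; exists (path_eval t y) => //.
exact: le_lt_trans (enorm_path_eval x y t) xy.
Qed.

(** A Lipschitz cut-off of [F] at distance [delta]; the infimum of truncated
distances avoids the infinite distance to the empty set. *)
Let trunc_dist (F : set 'rV[R]_q) (delta : R) (v : 'rV[R]_q) : R :=
  inf [set Num.min 1 (enorm (v - z) / delta) | z in F].

Let trunc_distP (F : set 'rV[R]_q) (delta : R) : F !=set0 -> 0 < delta ->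
  [/\ forall v, 0 <= trunc_dist F delta v <= 1,
      forall v, F v -> trunc_dist F delta v = 0,
      forall v, ~ fattening F delta v -> trunc_dist F delta v = 1 &
      forall v w, trunc_dist F delta v <= trunc_dist F delta w + enorm (v - w) / delta].
Proof.
move=> [z0 Fz0] d0; pose S v := [set Num.min 1 (enorm (v - z) / delta) | z in F].
have m0 (v z : 'rV[R]_q) : 0 <= Num.min 1 (enorm (v - z) / delta).
  by rewrite le_min ler01 divr_ge0 ?enorm_ge0// ltW.
have lbS v : has_lbound (S v) by exists 0 => _ [z Fz <-].
have S0 v : S v !=set0 by exists (Num.min 1 (enorm (v - z0) / delta)), z0.
have ge0 v : 0 <= trunc_dist F delta v.
  by apply: lb_le_inf; [exact: S0|move=> _ [z Fz <-]].
have le v z : F z -> trunc_dist F delta v <= Num.min 1 (enorm (v - z) / delta).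
  by move=> Fz; apply: ge_inf; [exact: lbS|exists z].
split.
- move=> v; rewrite ge0/=; apply: le_trans (le v z0 Fz0) _.
  by rewrite ge_min lexx.
- move=> v Fv; apply/eqP; rewrite eq_le ge0 andbT; apply: le_trans (le v v Fv) _.
  by rewrite subrr enorm0 mul0r ge_min lexx orbT.
- move=> v nv; apply/eqP; rewrite eq_le; apply/andP; split.
    by apply: le_trans (le v z0 Fz0) _; rewrite ge_min lexx.
  apply: lb_le_inf; [exact: S0|move=> _ [z Fz <-]]; rewrite le_min lexx/= ler_pdivlMr// mul1r.
  by rewrite leNgt; apply/negP => vz; apply: nv; exists z.
- move=> v w; rewrite -lerBlDr; apply: lb_le_inf; first exact: S0.
  move=> _ [z Fz <-]; rewrite lerBlDr; apply: le_trans (le v z Fz) _.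
  have vwz : enorm (v - z) / delta <= enorm (v - w) / delta + enorm (w - z) / delta.
    rewrite -mulrDl ler_pM2r ?invr_gt0//.
    by rewrite -[v in v - z](subrK w) -addrA ler_enormD.
  have vw0 : 0 <= enorm (v - w) / delta by rewrite divr_ge0 ?enorm_ge0// ltW.
  rewrite -lerBlDr le_min; apply/andP; split.
    by rewrite lerBlDr (@le_trans _ _ 1)// ?ge_min ?lexx// lerDl.
  rewrite lerBlDr [leRHS]addrC; apply: le_trans vwz.
  by rewrite ge_min lexx orbT.
Qed.

Lemma fortet_mourier_thickened_relaxed (eps delta : R) V : 0 < delta ->
  eps < delta ^+ 2 / (1 + delta) ->
  thickened_constraint fortet_mourier nu eps V -> relaxed_constraint nu delta V.
Proof.
move=> d0; set e' := delta ^+ 2 / _ => ee' HV t F cF.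
have [F0|F0] := pselect (F !=set0); last first.
  rewrite (_ : F = set0) ?preimage_set0 ?measure0/=.
    by rewrite addr_ge0 ?fine_prob_ge0// ltW.
  by apply/seteqP; split => // z Fz; case: F0; exists z.
have /ereal_inf_lt[_ [U CU <-] VU] :
    (ereal_inf [set fortet_mourier V U | U in marginal_constraint nu] < e'%:E)%E.
  by apply: le_lt_trans HV _; rewrite lte_fin.
have [g01 gF gnF glip] := trunc_distP F0 d0; set g := trunc_dist F delta in g01 gF gnF glip.
have d1 : 0 < 1 + delta by rewrite addr_gt0.
(* Scaled by [c] the cut-off has sup norm [delta / (1 + delta)] and Lipschitz norm
   [1 / (1 + delta)], which add up to [1]. *)
pose c := delta / (1 + delta); have c0 : 0 < c by rewrite divr_gt0.
pose f (x : E) := c * (1 - g (path_eval t x)).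
have cf : fm_class f.
  apply: (@fm_classP _ c (1 / (1 + delta))).
  - by rewrite /c -mulrDl addrC divff// gt_eqF.
  - by rewrite divr_ge0// ltW.
  - move=> x; have /andP[g0 g1] := g01 (path_eval t x).
    by rewrite /f normrM gtr0_norm// ger0_norm ?subr_ge0// ler_piMr ?(ltW c0)// gerBl.
  move=> x y; rewrite /f -mulrBr normrM gtr0_norm// opprB addrC addrA subrK.
  apply: (@le_trans _ _ (c * (mdist x y / delta))); last first.
    rewrite /c le_eqVlt; apply/orP; left; apply/eqP; field.
    by rewrite !gt_eqF.
  rewrite ler_pM2l// ler_norml.
  have h1 := glip (path_eval t x) (path_eval t y).
  have h2 := glip (path_eval t y) (path_eval t x).
  rewrite -enormN opprB in h2.
  have h3 : enorm (path_eval t x - path_eval t y) / delta <= mdist x y / delta.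
    by rewrite ler_pM2r ?invr_gt0// enorm_path_eval.
  by apply/andP; split; lra.
have mF := measurable_pre t (measurable_closed_rV cF).
have mG := measurable_pre t (measurable_fattening F delta).
have bf := fm_class_bm cf.
have h1 : c * fine (V (path_eval t @^-1` F)) <= mean V f.
  rewrite -mean_indic// -meanZ; last exact: bm_indic.
  apply: le_mean => //; first by apply: bmZ; exact: bm_indic.
  move=> x; rewrite /f ler_pM2l// indicE; have [xF|_] := boolP (_ \in _).
    by rewrite inE in xF; rewrite gF// subr0.
  by rewrite subr_ge0; have /andP[] := g01 (path_eval t x).
have h2 : mean U f <= c * fine (nu t (fattening F delta)).
  rewrite -(constraint_pre t CU (measurable_fattening F delta)).
  rewrite -mean_indic// -meanZ; last exact: bm_indic.
  apply: le_mean => //; first by apply: bmZ; exact: bm_indic.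
  move=> x; rewrite /f ler_pM2l// indicE; have [xF|xF] := boolP (_ \in _).
    by rewrite gerBl; have /andP[] := g01 (path_eval t x).
  by rewrite gnF ?subrr//; rewrite notin_setE in xF.
have h3 : mean V f - mean U f < e'.
  by rewrite -lte_fin; apply: le_lt_trans VU; exact: fortet_mourier_ge.
rewrite -(ler_pM2l c0) mulrDr.
have -> : c * delta = e' by rewrite /c /e'; field; rewrite gt_eqF.
by lra.
Qed.

(** Moving each term by at most [delta] moves the empirical measure by at most
[delta], in both metrics. *)
Lemma fortet_mourier_empirical n (s s' : nat -> E) U (delta : R) :
  (forall j, (j < n.+1)%N -> mdist (s j) (s' j) <= delta) ->
  (fortet_mourier (empirical n s') U <= fortet_mourier (empirical n s) U + delta%:E)%E.
Proof.
move=> ss'; apply: ge_ereal_sup => _ [f cf <-].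
have bf := fm_class_bm cf.
rewrite (mean_EFin (empirical n s') bf) (mean_EFin U bf) -EFinB.
apply: (@le_trans _ _ ((mean (empirical n s) f - mean U f)%:E + delta%:E)%E).
  rewrite -EFinD lee_fin addrAC lerD2r !mean_empirical//.
  rewrite -[X in _ + X](mulKf (_ : n.+1%:R != 0)) ?pnatr_eq0// -mulrDr.
  rewrite ler_pM2l ?invr_gt0//.
  rewrite -[X in X%:R * _](card_ord n.+1) mulr_natl -sumr_const -big_split/=.
  apply: ler_sum => j _.
  have := fm_class_lip (s' j) (s j) cf; rewrite ler_distl => /andP[_].
  by rewrite metric_sym; have := ss' j (ltn_ord j); lra.
by rewrite leeD2r//; exact: fortet_mourier_ge.
Qed.

Lemma prohorov_empirical n (s s' : nat -> E) U (delta : R) :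
  (forall j, (j < n.+1)%N -> mdist (s j) (s' j) <= delta) ->
  (prohorov (empirical n s') U <= prohorov (empirical n s) U + delta%:E)%E.
Proof.
move=> ss'; rewrite -leeBlDr//; apply: le_ereal_inf_tmp => _ [r /prohorov_radiusP[r0 Hr] <-].
have d0 : 0 <= delta by apply: le_trans (ss' 0%N isT); exact: mdist_ge0.
rewrite leeBlDr// -EFinD; apply: prohorov_le; split; first by rewrite ltr_wpDr.
move=> A mA.
have m1 := measurable_enlargement A delta.
apply: (@le_trans _ _ (fine (empirical n s (enlargement A delta)))).
  rewrite !fine_empirical ler_pM2l ?invr_gt0//; apply: ler_sum => j _.
  rewrite !indicE; have [sA|_] := boolP (s' j \in A); last by [].
  rewrite mem_set//; rewrite inE in sA.
  by apply: mem_enlargement sA _; exact: ss'.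
apply: le_trans (Hr _ m1) _; apply: lerD; last by rewrite lerDl.
apply: le_fine_prob; [exact: measurable_enlargement..|].
rewrite addrC; exact: enlargement_add.
Qed.

(** On a small cell, Lipschitz functions and enlargements of sets can be replaced by
a constant coefficient [c i]; means then reduce to finite sums of masses of
cells, up to the mass outside of the cells. *)
Section cells.
Variables (I : finType) (S : I -> set E) (V V' : probability E R) (delta a : R).
Hypothesis delta_gt0 : 0 < delta.
Hypothesis mS : forall i, measurable (S i).
Hypothesis S_disj : forall i j x, S i x -> S j x -> i = j.
Hypothesis S_diam : forall i x y, S i x -> S i y -> mdist x y <= delta.
Hypothesis S_mass : 1 - delta <= \sum_i fine (V' (S i)).
Hypothesis VV' : forall i, `|fine (V (S i)) - fine (V' (S i))| <= a.
Hypothesis a_small : #|I|%:R * a <= delta.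

Let bS i : bm \1_(S i). Proof. exact: bm_indic. Qed.

Let a_ge0 (i : I) : 0 <= a. Proof. exact: le_trans (VV' i). Qed.

Let bsum (c : I -> R) : bm (fun x => \sum_i c i * \1_(S i) x).
Proof. by apply: bm_sum => i; apply: bmZ. Qed.

Let sum_in (c : I -> R) i x : S i x -> \sum_j c j * \1_(S j) x = c i.
Proof.
move=> Six; rewrite (bigD1 i)//= big1 ?addr0 => [|j ji]; last first.
  rewrite indicE memNset ?mulr0// => Sjx.
  by move/eqP: ji; apply; exact: S_disj Sjx Six.
by rewrite indicE mem_set// mulr1.
Qed.

Let sum_out (c : I -> R) x : (forall i, ~ S i x) -> \sum_j c j * \1_(S j) x = 0.
Proof. by move=> H; rewrite big1// => j _; rewrite indicE memNset ?mulr0//; exact: H. Qed.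

Let mean_sum_cells (W : probability E R) (c : I -> R) :
  mean W (fun x => \sum_i c i * \1_(S i) x) = \sum_i c i * fine (W (S i)).
Proof.
rewrite (mean_sum W (index_enum I) (F := fun i x => c i * \1_(S i) x)) => [|i]; last exact: bmZ.
by apply: eq_bigr => i _; rewrite meanZ// mean_indic.
Qed.

Let cells_close (c : I -> R) : (forall i, `|c i| <= 1) ->
  `|\sum_i c i * fine (V (S i)) - \sum_i c i * fine (V' (S i))| <= delta.
Proof.
move=> c1; rewrite -sumrB; apply: le_trans (ler_norm_sum _ _ _) _.
apply: le_trans a_small; rewrite mulr_natl -sumr_const; apply: ler_sum => i _.
rewrite -mulrBr normrM -[leRHS]mul1r; apply: ler_pM => //.
Qed.

Let mass_V : 1 - 2 * delta <= \sum_i fine (V (S i)).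
Proof.
have := cells_close (c := fun=> 1); rewrite normr1 => /(_ (fun=> lexx _)).
under eq_bigr do rewrite mul1r; under [X in _ - X]eq_bigr do rewrite mul1r.
by rewrite ler_distl => /andP[+ _]; move: S_mass; lra.
Qed.

Let mean_approx (W : probability E R) f (c : I -> R) (e : R) : bm f -> (forall x, `|f x| <= 1) ->
  (forall i x, S i x -> `|f x - c i| <= delta) ->
  1 - e <= \sum_i fine (W (S i)) ->
  `|mean W f - \sum_i c i * fine (W (S i))| <= delta + e.
Proof.
move=> bf f1 fc We; rewrite -mean_sum_cells -meanB//.
have bd : bm (fun x => f x - \sum_i c i * \1_(S i) x) by exact: bmB.
have b1 := bsum (fun=> 1).
have bb : bm (fun x => delta + (1 - \sum_i 1 * \1_(S i) x)).
  by apply: bmD; [exact: bm_cst|apply: bmB => //; exact: bm_cst].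
have key x : `|f x - \sum_i c i * \1_(S i) x| <= delta + (1 - \sum_i 1 * \1_(S i) x).
  have [[i Six]|nS] := pselect (exists i, S i x).
    by rewrite !(sum_in _ Six) subrr addr0; exact: fc.
  have nS' i : ~ S i x by move=> Six; apply: nS; exists i.
  rewrite !sum_out// !subr0; apply: le_trans (f1 x) _; rewrite lerDr; exact: ltW.
have le2 : mean W (fun x => delta + (1 - \sum_i 1 * \1_(S i) x)) <= delta + e.
  rewrite meanD; [|exact: bm_cst|by apply: bmB => //; exact: bm_cst].
  rewrite mean_cst meanB//; last exact: bm_cst.
  rewrite mean_cst mean_sum_cells; under eq_bigr do rewrite mul1r.
  by move: We; lra.
rewrite ler_norml; apply/andP; split.
  rewrite lerNl -meanN//; apply: le_trans le2; apply: le_mean => //; first exact: bmN.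
  by move=> x; have := key x; rewrite ler_norml lerNl => /andP[].
by apply: le_trans le2; apply: le_mean => // x; apply: le_trans (ler_norm _) (key x).
Qed.

Lemma fortet_mourier_cells : (fortet_mourier V V' <= (6 * delta)%:E)%E.
Proof.
apply: fortet_mourier_le => f cf; have bf := fm_class_bm cf.
pose c i := if pselect (S i !=set0) is left H then f (sval (cid H)) else 0.
have c1 i : `|c i| <= 1.
  by rewrite /c; case: pselect => [H|_]; [exact: fm_class_le1|rewrite normr0].
have fc i x : S i x -> `|f x - c i| <= delta.
  move=> Six; rewrite /c; case: pselect => [H|[]]; last by exists x.
  apply: le_trans (fm_class_lip _ _ cf) _; apply: S_diam Six _.
  exact: (svalP (cid H)).
have f1 x := fm_class_le1 x cf.
have := mean_approx bf f1 fc mass_V; have := mean_approx bf f1 fc S_mass.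
have := cells_close c1; rewrite !ler_distl => /andP[? ?] /andP[? ?] /andP[? ?].
by move: delta_gt0; lra.
Qed.

Lemma prohorov_cells : (prohorov V V' <= (6 * delta)%:E)%E.
Proof.
apply: prohorov_le; split; first by rewrite mulr_gt0.
move=> A mA.
pose c i : R := if `[< S i `&` A !=set0 >] then 1 else 0.
have c1 i : `|c i| <= 1 by rewrite /c; case: ifP; rewrite ?normr1 ?normr0.
have h1 : fine (V A) <= \sum_i c i * fine (V (S i)) + 2 * delta.
  have b1 := bsum (fun=> 1).
  have bb : bm (fun x => \sum_i c i * \1_(S i) x + (1 - \sum_i 1 * \1_(S i) x)).
    by apply: bmD => //; apply: bmB => //; exact: bm_cst.
  rewrite -mean_indic//; apply: (@le_trans _ _ (mean V (fun x => \sum_i c i * \1_(S i) x + (1 - \sum_i 1 * \1_(S i) x)))).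
    apply: le_mean => //; first exact: bm_indic.
    move=> x; have [[i Six]|nS] := pselect (exists i, S i x).
      rewrite !(sum_in _ Six) subrr addr0 indicE; have [xA|_] := boolP (x \in A).
        by rewrite inE in xA; rewrite /c asboolT//; exists x.
      by rewrite /c; case: ifP.
    have nS' i : ~ S i x by move=> Six; apply: nS; exists i.
    by rewrite !sum_out// subr0 add0r indicE; case: (_ \in _).
  rewrite meanD//; last by apply: bmB => //; exact: bm_cst.
  rewrite meanB//; last exact: bm_cst.
  rewrite mean_cst !mean_sum_cells lerD2l; under eq_bigr do rewrite mul1r.
  by move: mass_V; lra.
have h2 : \sum_i c i * fine (V' (S i)) <= fine (V' (enlargement A (6 * delta))).
  have mE := measurable_enlargement A (6 * delta).
  rewrite -mean_indic// -mean_sum_cells; apply: le_mean => //; first exact: bm_indic.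
  move=> x; have [[i Six]|nS] := pselect (exists i, S i x); last first.
    by rewrite sum_out ?indicE// => i Six; apply: nS; exists i.
  rewrite (sum_in _ Six) /c; case: asboolP => [[y [Siy Ay]]|_]; last by rewrite indicE.
  rewrite indicE mem_set//; apply: mem_enlargement Ay _.
  by apply: le_trans (S_diam Six Siy) _; move: delta_gt0; lra.
have := cells_close c1; rewrite ler_distl => /andP[_].
by move: h1 h2 delta_gt0; lra.
Qed.

End cells.

End metrics.

(** * Gaussian tails and dyadic times *)

Section union_bounds.
Context d (T : measurableType d) (R : realType).
Implicit Types (mu : probability T R) (C : set T).

Lemma union_bound mu (I : finType) (A : I -> set T) C : measurable C ->
  (forall i, measurable (A i)) -> (forall x, C x -> exists i, A i x) ->
  fine (mu C) <= \sum_i fine (mu (A i)).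
Proof.
move=> mC mA CA.
have bA i : bounded_measurable (\1_(A i) : T -> R) by exact: bm_indic.
rewrite -(mean_indic mu mC).
rewrite (eq_bigr (fun i => mean mu \1_(A i))) => [|i _]; last by rewrite mean_indic.
rewrite -(mean_sum mu (index_enum I) bA); apply: le_mean.
- exact: bm_indic.
- exact: bm_sum.
move=> x; rewrite [leLHS]indicE; have [xC|_] := boolP (x \in C); last first.
  by apply: sumr_ge0 => i _; rewrite indicE.
rewrite inE in xC; have [i Aix] := CA x xC.
by rewrite (bigD1 i)//= indicE mem_set// lerDl sumr_ge0// => j _.
Qed.

Lemma countable_union_bound mu (A : nat -> set T) C (b : R) : measurable C ->
  (forall n, measurable (A n)) -> (forall x, C x -> exists n, A n x) ->
  (forall n, \sum_(0 <= k < n) fine (mu (A k)) <= b) -> fine (mu C) <= b.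
Proof.
move=> mC mA CA Ab; rewrite -lee_fin fine_prob//.
apply: le_trans (measure_sigma_subadditive mu mA mC _) _.
  by move=> x /CA[n Anx]; exists n.
apply: lime_le; first by apply: is_cvg_nneseries.
apply: nearW => n; apply: le_trans (_ : ((\sum_(0 <= k < n) fine (mu (A k)))%:E <= _)%E); last by rewrite lee_fin.
by rewrite -sumEFin; apply: lee_sum => k _; rewrite fine_prob.
Qed.

End union_bounds.

Section gaussian_tail.
Context {R : realType}.
Local Open Scope ring_scope.

(** Half of the Gaussian exponent is spent on the bound; the other half is a
Gaussian weight of doubled variance. *)
Lemma normal_prob_tail (s lam : R) : 0 < s -> 0 <= lam ->
  (normal_prob 0 s [set u : R | (lam < `|u|)%R] <=
   (Num.sqrt 2 * expR (- (lam ^+ 2 / (4 * s ^+ 2))))%:E)%E.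
Proof.
move=> s0 lam0; set c := Num.sqrt 2 * _.
have c0 : 0 <= c by rewrite mulr_ge0 ?sqrtr_ge0 ?expR_ge0.
pose s' := Num.sqrt 2 * s; have s'0 : 0 < s' by rewrite mulr_gt0 ?sqrtr_gt0.
have s'2 : s' ^+ 2 = 2 * s ^+ 2 by rewrite exprMn sqr_sqrtr.
set A := [set u : R | _].
have mA : measurable A.
  rewrite -[A]setTI; apply: (measurable_fun_ltr (f := cst lam) (g := fun u : R => `|u|)) => //.
have key x : A x -> normal_pdf 0 s x <= c * normal_pdf 0 s' x.
  move=> Ax; rewrite !normal_pdfE ?gt_eqF//.
  have peak : normal_peak s = Num.sqrt 2 * normal_peak s'.
    have -> : normal_peak s' = (Num.sqrt (2 * (s ^+ 2 * pi *+ 2)))^-1.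
      by rewrite /normal_peak s'2 -!mulrA mulrnAr.
    rewrite sqrtrM// /normal_peak.
    by rewrite invfM mulrA divff ?mul1r// gt_eqF// sqrtr_gt0.
  rewrite peak /c -!mulrA ler_pM2l ?sqrtr_gt0// mulrCA.
  rewrite ler_wpM2l ?normal_peak_ge0// /normal_fun -expRD ler_expR !subr0 s'2.
  have lx : lam ^+ 2 <= x ^+ 2.
    by rewrite -[x ^+ 2]real_normK ?num_real// lerXn2r ?nnegrE// ltW.
  have s2 : 0 < s ^+ 2 by rewrite exprn_gt0.
  have s20 : s ^+ 2 *+ 2 = 2 * s ^+ 2 by rewrite -mulr_natl.
  have s21 : 2 * s ^+ 2 *+ 2 = 4 * s ^+ 2 by rewrite -mulr_natl mulrA -natrM.
  have -> : - x ^+ 2 / (s ^+ 2 *+ 2) = - x ^+ 2 / (4 * s ^+ 2) + - x ^+ 2 / (2 * s ^+ 2 *+ 2).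
    by rewrite s20 s21; field; rewrite gt_eqF.
  rewrite lerD2r mulNr lerN2 mulrA -expr2 ler_pM2r// invr_gt0.
  by rewrite mulr_gt0.
rewrite /normal_prob.
apply: (@le_trans _ _ (\int[lebesgue_measure]_(x in A) (c * normal_pdf 0 s' x)%:E)%E).
  apply: ge0_le_integral => //.
  - by move=> x _; rewrite lee_fin normal_pdf_ge0.
  - by apply/measurable_EFinP; apply: measurable_funTS; exact: measurable_normal_pdf.
  - apply/measurable_EFinP; apply: measurable_funTS; apply: measurable_funM => //.
    exact: measurable_normal_pdf.
under eq_integral do rewrite EFinM.
rewrite ge0_integralZl//; last 2 first.
- by apply/measurable_EFinP; apply: measurable_funTS; exact: measurable_normal_pdf.
- by move=> x _; rewrite lee_fin normal_pdf_ge0.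
rewrite -[leRHS]mule1 lee_wpmul2l ?lee_fin//.
rewrite -(integral_normal_pdf 0 s'); apply: ge0_subset_integral => //.
  by apply/measurable_EFinP; exact: measurable_normal_pdf.
by move=> x _; rewrite lee_fin normal_pdf_ge0.
Qed.

Lemma expR_opp_le_expr (u : R) (p : nat) : 0 < u -> (0 < p)%N ->
  expR (- u) <= (p%:R / u) ^+ p.
Proof.
move=> u0 p0; have pR : 0 < p%:R :> R by rewrite ltr0n.
rewrite expRN -[leRHS]invrK lef_pV2 ?posrE ?expR_gt0 ?invr_gt0 ?exprn_gt0 ?divr_gt0//.
rewrite -exprVn invf_div.
have -> : expR u = expR (u / p%:R) ^+ p.
  by rewrite -expRM_natl mulrC divfK// gt_eqF.
apply: lerXn2r; rewrite ?nnegrE ?expR_ge0 ?divr_ge0 ?ltW//.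
by rewrite (lt_le_trans _ (expR_ge1Dx _))// ltrDr.
Qed.

Lemma expr_unbounded (g : R) (B : R) : 1 < g -> exists2 p : nat, (0 < p)%N & B <= g ^+ p.
Proof.
move=> g1; have g0 : 0 < g - 1 by rewrite subr_gt0.
have bern (p : nat) : 1 + p%:R * (g - 1) <= g ^+ p.
  elim: p => [|p ih]; first by rewrite mul0r addr0 expr0.
  rewrite exprS; have gp : 0 < g by exact: lt_trans g1.
  apply: (le_trans _ (ler_wpM2l (ltW gp) ih)).
  rewrite -natr1; have p0 : 0 <= p%:R * (g - 1) ^+ 2 by rewrite mulr_ge0// sqr_ge0.
  rewrite expr2 in p0; nra.
exists (Num.truncn (B / (g - 1))).+1 => //.
apply: le_trans (bern _); have := truncnS_gt (B / (g - 1)).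
by rewrite ltr_pdivrMr//; lra.
Qed.

(** The left-hand side is the Gaussian tail at dyadic level [l]; the power of [4]
pays for the [2 ^ l] intervals of that level and leaves a summable series. *)
Lemma superexponential_decay (g : R) : 1 < g -> exists2 C : R, 0 < C &
  forall l : nat, Num.sqrt 2 * expR (- (g ^+ l / 4)) <= C / 4 ^+ l.
Proof.
move=> g1; have g0 : 0 < g by exact: lt_trans g1.
have [p p0 gp] := expr_unbounded 4 g1.
exists (Num.sqrt 2 * (4 * p%:R) ^+ p).
  by rewrite mulr_gt0 ?sqrtr_gt0// exprn_gt0// mulr_gt0// ltr0n.
move=> l; rewrite -mulrA ler_pM2l ?sqrtr_gt0//.
apply: le_trans (expR_opp_le_expr _ p0) _; first by rewrite divr_gt0// exprn_gt0.
rewrite invf_div mulrA (mulrC p%:R) exprMn exprVn ler_pM2l; last first.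
  by rewrite exprn_gt0// mulr_gt0// ltr0n.
rewrite lef_pV2 ?posrE ?exprn_gt0// -exprM mulnC exprM.
by apply: lerXn2r => //; rewrite nnegrE ?ler0n// exprn_ge0// ltW.
Qed.

End gaussian_tail.

Section dyadic_points.
Context {R : realType}.

Let itv_pt_subproof (r : R) :
  Num.max 0 (Num.min 1 r) \in (`[0, 1]%classic : set R).
Proof. by rewrite inE /= in_itv/= le_max lexx/= ge_max ler01 ge_min lexx. Qed.

(** Clamping to the unit interval makes the point defined for every real. *)
Definition itv_pt (r : R) : unit_itv R :=
  exist (fun x => x \in (`[0, 1]%classic : set R)) _ (itv_pt_subproof r).

Lemma val_itv_pt r : 0 <= r <= 1 -> val (itv_pt r) = r.
Proof. by move=> /andP[r0 r1] /=; rewrite min_r// max_r. Qed.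

Lemma unit_itv_bound (t : unit_itv R) : 0 <= val t <= 1.
Proof. by case: t => r r01 /=; move: (r01); rewrite inE /= in_itv. Qed.

Definition dyadic (l i : nat) : unit_itv R := itv_pt (i%:R / 2 ^+ l).

Lemma val_dyadic l i : (i <= 2 ^ l)%N -> val (dyadic l i) = i%:R / 2 ^+ l.
Proof.
move=> il; rewrite val_itv_pt// divr_ge0//= ler_pdivrMr// mul1r -natrX.
by rewrite ler_nat.
Qed.

Lemma dyadic_double l i : dyadic l.+1 i.*2 = dyadic l i.
Proof.
congr itv_pt; rewrite -muln2 natrM exprS invfM; field.
by rewrite expf_neq0.
Qed.

Definition dyadic_floor (l : nat) (t : unit_itv R) : nat :=
  Num.truncn (2 ^+ l * val t).

Lemma dyadic_floor_le l t : (dyadic_floor l t <= 2 ^ l)%N.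
Proof.
have /andP[t0 t1] := unit_itv_bound t.
rewrite -ltnS truncn_lt_nat; last by rewrite mulr_ge0.
rewrite -[(2 ^ l).+1%:R]natr1 (natrX R 2 l) ltr_pwDr// ler_piMr//.
Qed.

Lemma dyadic_floor_itv l t :
  val (dyadic l (dyadic_floor l t)) <= val t < val (dyadic l (dyadic_floor l t)) + (2 ^+ l)^-1.
Proof.
have /andP[t0 t1] := unit_itv_bound t.
rewrite val_dyadic ?dyadic_floor_le//.
have y0 : 0 <= 2 ^+ l * val t by rewrite mulr_ge0.
have /andP[h1 h2] := truncn_itv y0.
rewrite -[X in _ + X]mul1r -mulrDl natr1 ler_pdivrMr// ltr_pdivlMr// ![val t * _]mulrC.
by rewrite /dyadic_floor h1 h2.
Qed.

Lemma dyadic_floorS l t :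
  dyadic_floor l.+1 t = (dyadic_floor l t).*2 \/
  dyadic_floor l.+1 t = (dyadic_floor l t).*2.+1.
Proof.
have /andP[t0 t1] := unit_itv_bound t.
have y0 : 0 <= 2 ^+ l * val t by rewrite mulr_ge0.
have /andP[h1 h2] := truncn_itv y0.
have -> : dyadic_floor l.+1 t = Num.truncn (2 * (2 ^+ l * val t)).
  by rewrite /dyadic_floor exprS mulrA.
rewrite -/(dyadic_floor l t) in h1 h2; set m := dyadic_floor l t in h1 h2 *.
set y := 2 ^+ l * val t in y0 h1 h2 *.
rewrite -natr1 in h2.
have [ym|ym] := ltP (2 * y) m.*2.+1%:R.
  left; apply: truncn_def; rewrite ym andbT -muln2 natrM; lra.
right; apply: truncn_def; rewrite ym/= -muln2 -!natr1 natrM; lra.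
Qed.

End dyadic_points.

(** * Modulus of continuity of Brownian paths *)

Section wiener_increments.
Context {R : realType} {q : nat}.
Local Notation E := (path_space R q).
Implicit Types (x y : E) (s t : unit_itv R) (j : 'I_q).

Lemma measurable_normr_gt (lam : R) : measurable [set u : R | lam < `|u|].
Proof.
by rewrite -[X in measurable X]setTI; apply: (measurable_fun_ltr (f := cst lam) (g := fun u : R => `|u|)).
Qed.

Lemma measurable_increment s t j (lam : R) :
  measurable [set x : E | lam < `|path_eval t x 0 j - path_eval s x 0 j|].
Proof.
rewrite -[X in measurable X]setTI.
have mf : measurable_fun setT (fun x : E => path_eval t x 0 j - path_eval s x 0 j).
  by apply: measurable_funB; exact: measurable_coord.
exact: (mf measurableT _ (measurable_normr_gt lam)).
Qed.

Variables (mu0 : probability 'rV[R]_q R) (W : probability E R).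
Hypothesis wienerW : is_wiener mu0 W.

Lemma wiener_initial (A : set 'rV[R]_q) : measurable A ->
  W [set x | A (path_eval unit_itv0 x)] = mu0 A.
Proof.
move=> mA.
have := wienerW (n := 0) (t := fun=> unit_itv0) (A := A) (B := fun _ _ => setT)
  erefl (fun i => match i with Ordinal _ h => False_ind _ (notF h) end) mA
  (fun _ _ => measurableT).
rewrite big_ord0 mule1 => <-; congr (W _).
by apply/seteqP; split => [x Ax|x []//]; split => // -[].
Qed.

(** The times of a Brownian path in [is_wiener] start at [0], so an increment between
positive times is the second one of a subdivision. *)
Lemma wiener_increment s t j (lam : R) : val s < val t -> 0 <= lam ->
  fine (W [set x | lam < `|path_eval t x 0 j - path_eval s x 0 j|]) <=
  Num.sqrt 2 * expR (- (lam ^+ 2 / (4 * (val t - val s)))).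
Proof.
move=> st lam0; rewrite -lee_fin fine_prob; last exact: measurable_increment.
have /andP[s0 _] := unit_itv_bound s.
have mu0T : mu0 setT = 1%E by exact: probability_setT.
pose T : set R := [set u | lam < `|u|].
pose Bj j' : set R := if j' == j then T else setT.
have mBj j' : measurable (Bj j').
  by rewrite /Bj; case: ifP => // _; exact: measurable_normr_gt.
have prodB (sg : R) : (\prod_(j' < q) normal_prob 0 sg (Bj j') = normal_prob 0 sg T)%E.
  rewrite (bigD1 j)//= /Bj eqxx big1 ?mule1// => j' /negbTE ->.
  exact: (probability_setT (normal_prob 0 sg)).
have tail : (normal_prob 0 (Num.sqrt (val t - val s)) T <=
    (Num.sqrt 2 * expR (- (lam ^+ 2 / (4 * (val t - val s)))))%:E)%E.
  have ts : 0 < val t - val s by rewrite subr_gt0.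
  apply: le_trans (normal_prob_tail _ lam0) _; first by rewrite sqrtr_gt0.
  by rewrite sqr_sqrtr// ltW.
have [s00|sn0] := eqVneq (val s) 0.
  pose tt (i : nat) := if i is 0 then s else t.
  have := wienerW (n := 1) (t := tt) (A := setT) (B := fun _ => Bj) s00
    _ measurableT (fun _ => mBj).
  rewrite (_ : [set x | _] = [set x | lam < `|path_eval t x 0 j - path_eval s x 0 j|]).
    move=> ->; last by move=> i; rewrite (ord1 i).
    by rewrite mu0T mul1e big_ord_recl big_ord0 mule1/= prodB.
  apply/seteqP; split => [x [_ /(_ ord0 j)]|x /= h]; first by rewrite /Bj eqxx.
  by split => // i j'; rewrite (ord1 i) /Bj; case: eqP => [->|].
have s1 : 0 < val s by rewrite lt_neqAle eq_sym sn0.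
pose tt (i : nat) := if i is i'.+1 then (if i' is 0 then s else t) else unit_itv0.
pose B (i : 'I_2) := if i == ord0 then (fun _ => setT) else Bj.
pose F (i : 'I_2) := (\prod_(j' < q)
  normal_prob 0 (Num.sqrt (val (tt i.+1) - val (tt i))) (B i j'))%E.
have prod_F : (\prod_(i < 2) F i = normal_prob 0 (Num.sqrt (val t - val s)) T)%E.
  have F0 : F ord0 = 1%E.
    by rewrite /F big1// => j' _; exact: (probability_setT (normal_prob 0 _)).
  have F1 : F (lift ord0 ord0) = normal_prob 0 (Num.sqrt (val t - val s)) T.
    exact: prodB.
  rewrite -F1; move: F F0 {F1} => G G0.
  by rewrite big_ord_recl big_ord_recl big_ord0 mule1 G0 mul1e.
have := wienerW (n := 2) (t := tt) (A := setT) (B := B) erefl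
    _ measurableT _.
rewrite (_ : [set x | _] = [set x | lam < `|path_eval t x 0 j - path_eval s x 0 j|]).
  move=> ->.
  - rewrite mu0T mul1e -[X in (X <= _)%E]/(\prod_(i < 2) F i)%E prod_F.
    exact: tail.
  - by move=> [[|[|//]] i2] /=.
  - by move=> i j'; rewrite /B; case: ifP.
apply/seteqP; split => [x [_ /(_ (lift ord0 ord0) j)]|x /= h].
  by rewrite /B /= /Bj eqxx.
split => // i j'; rewrite /B; case: ifPn => // i0.
have -> : i = lift ord0 ord0 by case: i i0 => [[|[|//]] i2] // _; apply: val_inj.
by rewrite /Bj; case: eqP => [->|].
Qed.

End wiener_increments.

Section modulus_of_continuity.
Context {R : realType} {q : nat}.
Local Notation E := (path_space R q).
Implicit Types (x y : E) (s t : unit_itv R) (j : 'I_q).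
Variable rho : R.

Definition dyadic_jump (l i : nat) j : set E :=
  [set x | rho ^+ l < `|path_eval (dyadic l i.+1) x 0 j - path_eval (dyadic l i) x 0 j|].

(** Increments over dyadic intervals of length [2 ^ (- l)] are at most [rho ^+ l]
from level [L] on: Hoelder continuity of exponent [- log_2 rho]. *)
Definition dyadic_holder (L : nat) : set E :=
  [set x | forall l i j, (L <= l)%N -> (i < 2 ^ l)%N -> ~ dyadic_jump l i j x].

Let rough_level (l : nat) : set E :=
  \big[setU/set0]_(p : 'I_(2 ^ l) * 'I_q) dyadic_jump l p.1 p.2.

Let rough_levelP l x : rough_level l x <->
  exists p : 'I_(2 ^ l) * 'I_q, dyadic_jump l p.1 p.2 x.
Proof.
rewrite /rough_level -bigcup_seq; split => [[p _ h]|[p h]]; exists p => //=.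
by rewrite mem_index_enum.
Qed.

Let measurable_rough_level l : measurable (rough_level l).
Proof. by apply: bigsetU_measurable => p _; exact: measurable_increment. Qed.

Let dyadic_holderC L : ~` dyadic_holder L = \bigcup_k rough_level (L + k).
Proof.
apply/seteqP; split => [x nh|x [k _ /rough_levelP[[i j] h]] G].
  apply: contrapT => nb; apply: nh => l i j Ll il h; apply: nb.
  exists (l - L)%N => //; apply/rough_levelP; rewrite subnKC//.
  by exists (Ordinal il, j).
by apply: (G (L + k)%N i j _ _ h); rewrite ?leq_addr.
Qed.

Lemma measurable_dyadic_holder L : measurable (dyadic_holder L).
Proof.
rewrite -[dyadic_holder L]setCK dyadic_holderC; apply: measurableC.
by apply: bigcup_measurable => k _; exact: measurable_rough_level.
Qed.

Hypotheses (rho_gt0 : 0 < rho) (rho_lt1 : rho < 1).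

(** The condition [1 < 2 * rho ^+ 2] says that the Hoelder exponent is below [1 / 2]:
the ratio of the squared jump to the variance then grows geometrically with the
level, and the tails are summable. *)
Lemma wiener_dyadic_holder (mu0 : probability 'rV[R]_q R) (W : probability E R) :
  is_wiener mu0 W -> 1 < 2 * rho ^+ 2 ->
  exists2 C : R, 0 < C & forall L, fine (W (~` dyadic_holder L)) <= C / 2 ^+ L.
Proof.
move=> wW rho2; have [C C0 HC] := superexponential_decay rho2.
have Cq0 : 0 <= q%:R * C by rewrite mulr_ge0 ?ler0n ?ltW.
exists (2 * (q%:R * C) + 1); first by rewrite ltr_wpDl// mulr_ge0.
move=> L.
have lev l : fine (W (rough_level l)) <= q%:R * C / 2 ^+ l.
  apply: le_trans (union_bound W (A := fun p : 'I_(2 ^ l) * 'I_q => dyadic_jump l p.1 p.2) _ _ _) _.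
  - exact: measurable_rough_level.
  - by move=> p; exact: measurable_increment.
  - by move=> x /rough_levelP.
  have one (p : 'I_(2 ^ l) * 'I_q) : fine (W (dyadic_jump l p.1 p.2)) <= C / 4 ^+ l.
    have lt1 := ltn_ord p.1.
    have dif : val (dyadic l p.1.+1) - val (dyadic l p.1) = (2 ^+ l)^-1 :> R.
      rewrite !val_dyadic//; last exact: ltnW.
      by rewrite -mulrBl -natr1 addrAC subrr add0r mul1r.
    apply: le_trans (wiener_increment wW _ _ _) _.
    - by rewrite -subr_gt0 dif invr_gt0 exprn_gt0.
    - by rewrite exprn_ge0// ltW.
    rewrite dif; apply: le_trans (HC l).
    rewrite le_eqVlt; apply/orP; left; apply/eqP; congr (_ * expR (- _)).
    by rewrite exprMn -!exprM (mulnC 2 l); field; rewrite expf_neq0.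
  apply: le_trans (ler_sum _ (fun p _ => one p)) _.
  rewrite sumr_const cardT -cardE card_prod !card_ord -[leLHS]mulr_natl natrM natrX.
  have -> : (4 : R) = 2 * 2 by rewrite -natrM.
  rewrite exprMn le_eqVlt; apply/orP; left; apply/eqP; field.
  by rewrite expf_neq0.
refine (@countable_union_bound _ _ _ W (fun k => rough_level (L + k)) _ _ _ _ _ _).
- by apply: measurableC; exact: measurable_dyadic_holder.
- by move=> k; exact: measurable_rough_level.
- by move=> x; rewrite dyadic_holderC => -[k _]; exists k.
move=> n; apply: le_trans (ler_sum _ (fun k _ => lev (L + k)%N)) _.
have geo : \sum_(0 <= k < n) (q%:R * C / 2 ^+ (L + k)) =
    (2 * (q%:R * C) - 2 * (q%:R * C) / 2 ^+ n) / 2 ^+ L.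
  elim: n => [|n ih]; first by rewrite big_geq// expr0 divr1 subrr mul0r.
  rewrite big_nat_recr//= ih exprD exprS; field.
  by rewrite !expf_neq0.
rewrite geo ler_pM2r ?invr_gt0 ?exprn_gt0//.
have : 0 <= 2 * (q%:R * C) / 2 ^+ n by rewrite divr_ge0 ?exprn_ge0// mulr_ge0.
move: (2 * (q%:R * C) / 2 ^+ n) => u; lra.
Qed.

(** Chaining: two consecutive dyadic approximations of [t] differ by at most one
interval, and [(rho ^+ L - rho ^+ (L + K)) / (1 - rho)] bounds the geometric
sum of the jumps. *)
Lemma dyadic_holder_chain L x t j K : dyadic_holder L x ->
  `|path_eval (dyadic (L + K) (dyadic_floor (L + K) t)) x 0 j -
    path_eval (dyadic L (dyadic_floor L t)) x 0 j| <=
  (rho ^+ L - rho ^+ (L + K)) / (1 - rho).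
Proof.
move=> G; have r1 : 0 < 1 - rho by rewrite subr_gt0.
elim: K => [|K ih]; first by rewrite addn0 !subrr normr0 mul0r.
set a := path_eval (dyadic L _) x 0 j in ih *.
set b := path_eval (dyadic (L + K) _) x 0 j in ih.
have step : `|path_eval (dyadic (L + K.+1) (dyadic_floor (L + K.+1) t)) x 0 j - b| <=
    rho ^+ (L + K).
  have rr : rho ^+ (L + K).+1 <= rho ^+ (L + K).
    by rewrite exprS ler_piMl// ?exprn_ge0// ltW.
  have fl := dyadic_floor_le (L + K).+1 t.
  rewrite addnS; case: (dyadic_floorS (L + K) t) => e; rewrite e.
    by rewrite dyadic_double subrr normr0 exprn_ge0// ltW.
  rewrite e in fl; apply: le_trans rr; rewrite leNgt; apply/negP => h.
  apply: (G (L + K).+1 (dyadic_floor (L + K) t).*2 j); rewrite ?fl//.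
    by rewrite ltnW// ltnS leq_addr.
  by rewrite /dyadic_jump /= dyadic_double.
rewrite -(subrKA b) (le_trans (ler_normD _ _))//.
apply: le_trans (lerD step ih) _.
rewrite -{1}[rho ^+ (L + K)](mulfK (negbT (gt_eqF r1))).
rewrite -mulrDl ler_pM2r ?invr_gt0// addnS [rho ^+ (L + K).+1]exprS.
rewrite le_eqVlt; apply/orP; left; apply/eqP; ring.
Qed.

Lemma dyadic_holder_modulus L x t j : dyadic_holder L x ->
  `|path_eval t x 0 j - path_eval (dyadic L (dyadic_floor L t)) x 0 j| <=
  rho ^+ L / (1 - rho).
Proof.
move=> G; have r1 : 0 < 1 - rho by rewrite subr_gt0.
apply/ler_addgt0Pr => e e0.
have cx : {for t, continuous (fun s => path_eval s x 0 j)}.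
  exact: (continuous_comp (@cont_path _ _ x t) (@coord_continuous _ _ _ 0 j _)).
have /cvgrPdist_lt/(_ e e0) := cx => -[U [[V oV VU] Vt] Ue].
have /nbhs_ballP[dl dl0 Vdl] : nbhs (val t) V by rewrite nbhsE; exists V => //; split => //; rewrite -VU in Vt.
have two1 : (1 : R) < 2 by rewrite ltr1n.
have [K _ HK] := expr_unbounded dl^-1 two1.
have Ut : `|path_eval t x 0 j - path_eval (dyadic (L + K) (dyadic_floor (L + K) t)) x 0 j| < e.
  apply: Ue; rewrite -VU; apply: Vdl.
  have /andP[h1 h2] := dyadic_floor_itv (L + K) t.
  rewrite /ball/= ger0_norm ?subr_ge0// ltrBlDl (lt_le_trans h2)// lerD2l.
  rewrite -[dl]invrK lef_pV2 ?posrE ?invr_gt0 ?exprn_gt0//.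
  by rewrite (le_trans HK)// exprD ler_peMl ?exprn_ge0// exprn_ege1// ler1n.
rewrite -(subrKA (path_eval (dyadic (L + K) (dyadic_floor (L + K) t)) x 0 j)).
rewrite addrC (le_trans (ler_normD _ _))// lerD ?(ltW Ut)//.
rewrite (le_trans (dyadic_holder_chain t j K G))// ler_pM2r ?invr_gt0//.
by rewrite gerBl exprn_ge0// ltW.
Qed.

Lemma dyadic_holder_bound L x j i : dyadic_holder L x -> (i <= 2 ^ L)%N ->
  `|path_eval (dyadic L i) x 0 j| <= `|path_eval unit_itv0 x 0 j| + i%:R.
Proof.
move=> G; elim: i => [_|i ih iL].
  rewrite addr0 (_ : dyadic L 0 = unit_itv0)//; apply: val_inj.
  by rewrite val_dyadic// mul0r.
have jump : `|path_eval (dyadic L i.+1) x 0 j - path_eval (dyadic L i) x 0 j| <= 1.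
  apply: (@le_trans _ _ (rho ^+ L)); last by rewrite exprn_ile1// ltW.
  rewrite leNgt; apply/negP => h; exact: (G L i j).
rewrite -(subrK (path_eval (dyadic L i) x 0 j) (path_eval (dyadic L i.+1) x 0 j)).
rewrite (le_trans (ler_normD _ _))// addrC -natr1 addrA lerD//.
by apply: ih; exact: ltnW.
Qed.

End modulus_of_continuity.

(** * Small cells of the path space *)

Lemma half_pow_le (R : realType) (rho : R) (L : nat) : 0 < rho -> rho < 1 ->
  1 < 2 * rho ^+ 2 -> (2 ^+ L)^-1 <= rho ^+ L.
Proof.
move=> rho_gt0 rho_lt1 rho_sq.
rewrite -exprVn lerXn2r ?nnegrE ?invr_ge0 ?ler0n ?ltW//.
have : 0 < rho * (1 - rho) by rewrite mulr_gt0// subr_gt0.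
move: rho_sq; rewrite expr2; nra.
Qed.

(** A cell consists of the regular paths with prescribed values on the dyadic grid
of level [L], rounded to multiples of [2 ^ (- L)].  Shifting the values by [M]
makes the codes natural numbers below [N] for the paths that start at distance
less than [2 ^ (b * L)] from the origin, as such paths move by at most [2 ^ L]. *)
Section path_cells.
Context {R : realType} {q : nat}.
Local Notation E := (path_space R q).
Implicit Types (x y : E) (s t : unit_itv R) (j : 'I_q).
Variable rho : R.
Hypotheses (rho_gt0 : 0 < rho) (rho_lt1 : rho < 1) (rho_sq : 1 < 2 * rho ^+ 2).
Variables L b : nat.
Hypothesis b_gt0 : (0 < b)%N.

Let M : nat := (2 ^ (b * L) + 2 ^ L)%N.
Let N : nat := (2 * M * 2 ^ L)%N.

Definition path_code : finType := {ffun 'I_(2 ^ L).+1 * 'I_q -> 'I_N}.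

Definition path_cell (c : path_code) : set E :=
  dyadic_holder rho L `&`
  [set x | forall p, (c p)%:R <= (path_eval (dyadic L p.1) x 0 p.2 + M%:R) * 2 ^+ L
                     < (c p).+1%:R].

Lemma measurable_path_cell c : measurable (path_cell c).
Proof.
apply: measurableI; first exact: measurable_dyadic_holder.
pose f (p : 'I_(2 ^ L).+1 * 'I_q) (x : E) : R := (path_eval (dyadic L p.1) x 0 p.2 + M%:R) * 2 ^+ L.
rewrite (_ : [set x | _] = \bigcap_(p in [set: 'I_(2 ^ L).+1 * 'I_q])
    (f p @^-1` `[(c p)%:R, (c p).+1%:R[)); last first.
  apply/seteqP; split => [x h p _|x h p]; first by rewrite /= in_itv /=; exact: h.
  by have := h p I; rewrite /= in_itv.
apply: fin_bigcap_measurable => // p _; rewrite -[X in measurable X]setTI.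
have mf : measurable_fun setT (f p).
  by apply: measurable_funM => //; apply: measurable_funD => //; exact: measurable_coord.
by apply: mf.
Qed.

Lemma path_cell_disj c c' x : path_cell c x -> path_cell c' x -> c = c'.
Proof.
move=> [_ h] [_ h']; apply/ffunP => p; apply: val_inj; apply/eqP.
have /andP[h1 h2] := h p; have /andP[h3 h4] := h' p.
have := le_lt_trans h1 h4; have := le_lt_trans h3 h2.
by rewrite !ltr_nat !ltnS eqn_leq => -> ->.
Qed.

Lemma path_cell_diam c x y : path_cell c x -> path_cell c y ->
  mdist x y <= q%:R * (1 + 2 / (1 - rho)) * rho ^+ L.
Proof.
move=> [Gx hx] [Gy hy]; apply: mdist_path_le => t.
apply: le_trans (enorm_le_sum _) _.
have one j : `|(path_eval t x - path_eval t y) 0 j| <= (1 + 2 / (1 - rho)) * rho ^+ L.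
  have dx := dyadic_holder_modulus rho_gt0 rho_lt1 t j Gx.
  have dy := dyadic_holder_modulus rho_gt0 rho_lt1 t j Gy.
  have fl : (dyadic_floor L t < (2 ^ L).+1)%N by rewrite ltnS dyadic_floor_le.
  have := hx (Ordinal fl, j); have := hy (Ordinal fl, j) => /=.
  rewrite !mxE -/(path_eval t x 0 j) -/(path_eval t y 0 j).
  move: dx dy; set X := path_eval (dyadic L _) x 0 j; set Y := path_eval (dyadic L _) y 0 j.
  move=> dx dy; rewrite -natr1 => /andP[y1 y2] /andP[x1 x2].
  have p2 : 0 < 2 ^+ L :> R by rewrite exprn_gt0.
  have XY : `|X - Y| <= rho ^+ L.
    apply: le_trans (half_pow_le L rho_gt0 rho_lt1 rho_sq); rewrite -[leRHS]mul1r ler_pdivlMr//.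
    rewrite -{1}[2 ^+ L]ger0_norm ?(ltW p2)// -normrM ler_norml.
    move: x1 x2 y1 y2; rewrite !mulrDl mulNr.
    move: (X * 2 ^+ L) (Y * 2 ^+ L) (M%:R * 2 ^+ L) => u v w h1 h2 h3 h4.
    by apply/andP; split; lra.
  have -> : path_eval t x 0 j - path_eval t y 0 j =
      (path_eval t x 0 j - X) + (X - Y) - (path_eval t y 0 j - Y) by ring.
  apply: le_trans (ler_normB _ _) _; apply: le_trans (lerD (ler_normD _ _) (lexx _)) _.
  apply: le_trans (lerD (lerD dx XY) dy) _.
  rewrite le_eqVlt; apply/orP; left; apply/eqP; field.
  by rewrite subr_eq0 gt_eqF.
apply: le_trans (ler_sum _ (fun j _ => one j)) _.
by rewrite sumr_const cardT -cardE card_ord -[leLHS]mulr_natl mulrA.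
Qed.

Lemma path_cell_cover x : dyadic_holder rho L x ->
  enorm (path_eval unit_itv0 x) < 2 ^+ (b * L) -> exists c, path_cell c x.
Proof.
move=> G x0.
have codes (p : 'I_(2 ^ L).+1 * 'I_q) : exists c : 'I_N,
    c%:R <= (path_eval (dyadic L p.1) x 0 p.2 + M%:R) * 2 ^+ L < c.+1%:R.
  have p2 : 0 < 2 ^+ L :> R by rewrite exprn_gt0.
  have h1 := dyadic_holder_bound rho_gt0 rho_lt1 p.2 G (ltn_ord p.1 : (p.1 <= 2 ^ L)%N).
  have h2 := normr_coord_le_enorm (path_eval unit_itv0 x) p.2.
  have h3 : p.1%:R <= 2 ^+ L :> R by rewrite -natrX ler_nat -ltnS ltn_ord.
  have ME : M%:R = 2 ^+ (b * L) + 2 ^+ L :> R by rewrite natrD !natrX.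
  have : `|path_eval (dyadic L p.1) x 0 p.2| < M%:R.
    by rewrite ME; apply: le_lt_trans h1 _; apply: ltr_leD => //; apply: le_lt_trans h2 _.
  set u := path_eval _ _ _ _; rewrite ltr_norml => /andP[u1 u2].
  have y0 : 0 <= (u + M%:R) * 2 ^+ L.
    by rewrite mulr_ge0 ?(ltW p2)//; rewrite -(opprK M%:R) subr_ge0 ltW.
  have tN : (Num.truncn ((u + M%:R) * 2 ^+ L) < N)%N.
    rewrite truncn_lt_nat// /N !natrM natrX ltr_pM2r// mulr_natl mulr2n.
    by rewrite ltrD2r.
  by exists (Ordinal tN); exact: truncn_itv.
have [c Hc] := fin_all_exists codes.
by exists [ffun p => c p]; split => // p; rewrite ffunE; exact: Hc.
Qed.

Lemma card_path_code : (#|path_code| <= 2 ^ ((b + 2) * (2 * q) * L.+1 * 2 ^ L))%N.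
Proof.
clear rho_gt0 rho_lt1 rho_sq.
rewrite card_ffun card_prod !card_ord.
have NL : (N <= 2 ^ ((b + 2) * L.+1))%N.
  apply: (@leq_trans (2 * (2 * 2 ^ (b * L)) * 2 ^ L)).
    rewrite leq_mul2r leq_mul2l /= /M mul2n -addnn leq_add2l.
    by rewrite leq_exp2l// leq_pmull ?orbT.
  rewrite mulnA -(expnD 2 1 1) -!expnD leq_exp2l//; nia.
have [->|N0] := posnP N.
  case: (posnP ((2 ^ L).+1 * q)%N) => [->|h]; first by rewrite expn0 expn_gt0.
  by rewrite exp0n.
apply: (@leq_trans ((2 ^ ((b + 2) * L.+1)) ^ ((2 ^ L).+1 * q))).
  by case: ((2 ^ L).+1 * q)%N => // e; rewrite leq_exp2r.
rewrite -expnM leq_exp2l//.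
have : (0 < 2 ^ L)%N by rewrite expn_gt0.
move: (2 ^ L)%N => p p0.
rewrite (_ : (b + 2) * (2 * q) * L.+1 * p = (b + 2) * L.+1 * (2 * p * q))%N; last by ring.
by rewrite leq_mul2l leq_mul2r (_ : p.+1 <= 2 * p)%N ?orbT//; lia.
Qed.

End path_cells.

Section wiener_cells.
Context {R : realType} {q : nat}.
Local Notation E := (path_space R q).
Variables (mu0 : probability 'rV[R]_q R) (W : probability E R).
Hypothesis wienerW : is_wiener mu0 W.
Variables (kappa m : R).
Hypotheses (kappa_gt0 : 0 < kappa) (m_gt0 : 0 < m).
Hypothesis mu0_tail : forall rad : R, 0 < rad ->
  (mu0 (~` [set x | (enorm x < rad)%R]) <= (kappa / rad `^ m)%:E)%E.

(** The radius [2 ^ (b * L)] of the initial ball, with [1 <= b * m], makes the mass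
of the initial law outside of it at most [kappa / 2 ^ L]. *)
Lemma wiener_cells (rho : R) : 0 < rho -> rho < 1 -> 1 < 2 * rho ^+ 2 ->
  exists2 C : R, 0 < C & exists c : nat, forall L, exists (I : finType) (S : I -> set E),
  [/\ forall i, measurable (S i),
      forall i j x, S i x -> S j x -> i = j,
      forall i x y, S i x -> S i y -> mdist x y <= C * rho ^+ L,
      fine (W (~` \bigcup_i S i)) <= C * rho ^+ L &
      (#|I| <= 2 ^ (c * L.+1 * 2 ^ L))%N].
Proof.
move=> r0 r1 r2.
have [C0 C00 HC0] := wiener_dyadic_holder r0 wienerW r2.
pose b := (Num.truncn m^-1).+1.
have bm : 1 <= b%:R * m.
  by rewrite -ler_pdivrMr// mul1r ltW// truncnS_gt.
have D0 : 0 <= q%:R * (1 + 2 / (1 - rho)).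
  by rewrite mulr_ge0 ?ler0n// addr_ge0// divr_ge0// subr_ge0 ltW.
have b_pos : (0 < b)%N by [].
exists (q%:R * (1 + 2 / (1 - rho)) + (C0 + kappa)).
  by rewrite ltr_wpDl// addr_gt0.
exists ((b + 2) * (2 * q))%N => L.
exists (path_code (q := q) L b), (@path_cell R q rho L b).
have rL : 0 <= rho ^+ L by rewrite exprn_ge0// ltW.
have mS c : measurable (@path_cell R q rho L b c) by exact: measurable_path_cell.
split.
- exact: mS.
- by move=> c c' x; exact: path_cell_disj.
- move=> c x y h1 h2; apply: le_trans (path_cell_diam r0 r1 r2 h1 h2) _.
  by rewrite ler_wpM2r// lerDl addr_ge0 ?ltW.
- pose far : set E := path_eval unit_itv0 @^-1` (~` [set v | enorm v < 2 ^+ (b * L)]).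
  have mfar0 : measurable (~` [set v : 'rV[R]_q | enorm v < 2 ^+ (b * L)]).
    apply: measurableC; apply: measurable_open_rV.
    rewrite (_ : [set v | _] = enorm @^-1` [set u | u < 2 ^+ (b * L)])//.
    by apply: open_comp => [v _|]; [exact: continuous_enorm|exact: open_lt].
  have mfar : measurable far.
    rewrite -[far]setTI; exact: (measurable_path_eval unit_itv0 measurableT mfar0).
  pose A (h : bool) := if h then far else ~` dyadic_holder rho L.
  apply: (@le_trans _ _ (\sum_(h : bool) fine (W (A h)))).
    apply: (@union_bound _ _ _ W _ A).
    - by apply: measurableC; apply: fin_bigcup_measurable => //; exact: finite_finset.
    - by case => //=; apply: measurableC; exact: measurable_dyadic_holder.
    - move=> x nS; have [G|G] := pselect (dyadic_holder rho L x); last by exists false.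
      exists true => x0; apply: nS; have [c hc] := path_cell_cover (b := b) r0 r1 G x0.
      by exists c.
  rewrite big_bool/=.
  have h1 : fine (W far) <= kappa / 2 ^+ L.
    rewrite -lee_fin fine_prob// (wiener_initial wienerW mfar0).
    apply: le_trans (mu0_tail _) _; first by rewrite exprn_gt0.
    rewrite lee_fin ler_pM2l// lef_pV2 ?posrE ?exprn_gt0 ?powR_gt0 ?exprn_gt0//.
    rewrite -powR_mulrn ?ler0n// -powR_mulrn ?ler0n// -powRrM ler_powR ?ler1n//.
    by rewrite natrM mulrAC -[leLHS]mul1r ler_wpM2r.
  have h2 := HC0 L.
  have h3 := half_pow_le L r0 r1 r2.
  apply: le_trans (lerD h1 h2) _; rewrite -mulrDl.
  apply: (@le_trans _ _ ((kappa + C0) * rho ^+ L)).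
    by rewrite ler_pM2l// addr_gt0.
  by rewrite ler_wpM2r// addrC lerDr.
- by apply: card_path_code.
Qed.

End wiener_cells.

(** * Measurability of the conditioning event *)

Section countable_path_cells.
Context {R : realType} {q : nat}.
Local Notation E := (path_space R q).
Implicit Types (x y : E) (s t : unit_itv R) (j : 'I_q).

(** Uniform continuity, in the form needed for coding: otherwise bad times [f L] at
every level [L] would cluster at some time, where continuity fails. *)
Lemma path_oscillation x (e : R) : 0 < e -> exists L, forall t j,
  `|path_eval t x 0 j - path_eval (dyadic L (dyadic_floor L t)) x 0 j| <= e.
Proof.
move=> e0; apply: contrapT => no.
have bad L : exists t, exists j, e < `|path_eval t x 0 j -
    path_eval (dyadic L (dyadic_floor L t)) x 0 j|.
  apply: contrapT => h; apply: no; exists L => t j; rewrite leNgt; apply/negP => h'.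
  by apply: h; exists t, j.
have [f Hf] := choice bad.
have fT : (f @ \oo) [set: unit_itv R] by exact: filterT.
have [ts [_ cl]] := @compact_unit_itv R (f @ \oo) _ fT.
have e2 : 0 < e / 2 by rewrite divr_gt0.
have Nx : nbhs (x ts : 'rV[R]_q) [set w | enorm (x ts - w) < e / 2].
  exact: (nbhs_enorm e2 (fun w h => h)).
have := @cont_path _ _ x ts _ Nx; move=> [U [[V oV VU] Vt] Ue].
have [dl /= dl0 Vdl] : exists2 dl : R, 0 < dl & forall u, `|val ts - u| < dl -> V u.
  have /nbhs_ballP[dl dl0 Vdl] : nbhs (val ts) V.
    by rewrite nbhsE; exists V => //; split => //; rewrite -VU in Vt.
  by exists dl.
have dl2 : 0 < dl / 2 by rewrite divr_gt0.
have near_ts : nbhs ts (val @^-1` [set u | `|val ts - u| < dl / 2] : set (unit_itv R)).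
  have cv : {for ts, continuous (val : unit_itv R -> R)} by exact: initial_continuous.
  by apply: cv; apply/nbhs_ballP; exists (dl / 2).
have two1 : (1 : R) < 2 by rewrite ltr1n.
have [L0 _ HL0] := expr_unbounded (dl / 2)^-1 two1.
have tail : (f @ \oo) [set f L | L in [set L | (L0 <= L)%N]].
  by exists L0 => // L L0L; exists L.
have [_ [[L /= L0L <-] fLts]] := cl _ _ tail near_ts.
have close u : `|val ts - val u| < dl -> enorm (x ts - x u) < e / 2.
  by move=> h; apply: Ue; rewrite -VU; exact: Vdl.
have c1 : enorm (x ts - x (f L)) < e / 2.
  by apply: close; apply: lt_trans fLts _; rewrite ltr_pdivrMr// ltr_pMr// ltr1n.
pose g : unit_itv R := dyadic L (dyadic_floor L (f L)).
have c2 : enorm (x ts - x g) < e / 2.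
  apply: close; have /andP[h1 h2] := dyadic_floor_itv L (f L).
  have fg : `|val (f L) - val g| <= dl / 2.
    rewrite ger0_norm ?subr_ge0// lerBlDl (le_trans (ltW h2))// lerD2l.
    rewrite -[leRHS]invrK lef_pV2 ?posrE ?invr_gt0 ?exprn_gt0//.
    by rewrite (le_trans HL0)// ler_eXn2l.
  rewrite -(subrKA (val (f L))) (le_lt_trans (ler_normD _ _))//.
  by rewrite (splitr dl) ltr_leD.
have [j] := Hf L; apply/negP; rewrite -leNgt.
have d1 := normr_coord_le_enorm (x ts - x (f L)) j.
have d2 := normr_coord_le_enorm (x ts - x g) j.
move: d1 d2; rewrite !mxE -/g /path_eval => d1 d2.
rewrite -[_ - x g 0 j](_ : (x ts 0 j - x g 0 j) - (x ts 0 j - x (f L) 0 j) = _); last by ring.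
rewrite (le_trans (ler_normB _ _))// (splitr e) lerD// ltW//.
  exact: le_lt_trans d2 c2.
exact: le_lt_trans d1 c1.
Qed.

Variable e : R.
Hypothesis e_gt0 : 0 < e.

(** Codes for a countable cover of the whole space by cells of small diameter: the
level of a grid that resolves the path up to [e], and the rounded values on it. *)
Definition mesh_code := {L : nat & {ffun 'I_(2 ^ L).+1 * 'I_q -> int}}.

Definition mesh_cell (c : mesh_code) : set E :=
  [set x | forall t j, `|path_eval t x 0 j -
      path_eval (dyadic (tag c) (dyadic_floor (tag c) t)) x 0 j| <= e] `&`
  [set x | forall p, (tagged c p)%:~R <= path_eval (dyadic (tag c) p.1) x 0 p.2 / e
                     < (tagged c p + 1)%:~R].

Lemma measurable_mesh_cell c : measurable (mesh_cell c).
Proof.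
apply: measurableI.
  apply: measurable_closed.
  rewrite (_ : [set x | _] = \bigcap_(p in [set: unit_itv R * 'I_q])
    [set x | `|path_eval p.1 x 0 p.2 -
      path_eval (dyadic (tag c) (dyadic_floor (tag c) p.1)) x 0 p.2| <= e]); last first.
    by apply/seteqP; split => [x h p _|x h t j]; [exact: h|exact: (h (t, j) I)].
  apply: closed_bigI => -[t j] _ /=.
  pose f (x : E) : R := `|path_eval t x 0 j -
      path_eval (dyadic (tag c) (dyadic_floor (tag c) t)) x 0 j|.
  have cc s : continuous (fun x : E => path_eval s x 0 j).
    move=> x; exact: (continuous_comp (@continuous_path_eval _ _ s x) (@coord_continuous _ _ _ 0 j _)).
  have cf : continuous f.
    move=> x; apply: (@continuous_comp _ _ _ (fun x : E => path_eval t x 0 j -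
      path_eval (dyadic (tag c) (dyadic_floor (tag c) t)) x 0 j) (fun u : R => `|u|)); last exact: norm_continuous.
    by apply: cvgB; [exact: nbhs_filter|exact: cc|exact: cc].
  by apply: (closed_comp (f := f) (D := [set u | u <= e])) => [x _|]; [exact: cf|exact: closed_le].
case: c => L c /=.
pose f (p : 'I_(2 ^ L).+1 * 'I_q) (x : E) : R := path_eval (dyadic L p.1) x 0 p.2 / e.
rewrite (_ : [set x | _] = \bigcap_(p in [set: 'I_(2 ^ L).+1 * 'I_q])
    (f p @^-1` `[(c p)%:~R, (c p + 1)%:~R[)); last first.
  apply/seteqP; split => [x h p _|x h p]; first by rewrite /= in_itv /=; exact: h.
  by have := h p I; rewrite /= in_itv.
apply: fin_bigcap_measurable => // p _; rewrite -[X in measurable X]setTI.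
have mf : measurable_fun setT (f p).
  by apply: measurable_funM => //; exact: measurable_coord.
by apply: mf.
Qed.

Lemma mesh_cell_diam c x y : mesh_cell c x -> mesh_cell c y ->
  mdist x y <= q%:R * (3 * e).
Proof.
move=> [Gx hx] [Gy hy]; apply: mdist_path_le => t.
apply: le_trans (enorm_le_sum _) _.
have one j : `|(path_eval t x - path_eval t y) 0 j| <= 3 * e.
  have dx := Gx t j; have dy := Gy t j.
  case: c hx hy dx dy {Gx Gy} => L c /= hx hy dx dy.
  have fl : (dyadic_floor L t < (2 ^ L).+1)%N by rewrite ltnS dyadic_floor_le.
  have := hx (Ordinal fl, j); have := hy (Ordinal fl, j) => /=.
  rewrite !mxE -/(path_eval t x 0 j) -/(path_eval t y 0 j).
  move: dx dy; set X := path_eval (dyadic L _) x 0 j; set Y := path_eval (dyadic L _) y 0 j.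
  move=> dx dy; rewrite intrD => /andP[y1 y2] /andP[x1 x2].
  have XY : `|X - Y| <= e.
    have : `|X / e - Y / e| <= 1 by rewrite ler_norml; apply/andP; split; lra.
    by rewrite -mulrBl normrM normfV (gtr0_norm e_gt0) ler_pdivrMr// mul1r.
  have -> : path_eval t x 0 j - path_eval t y 0 j =
      (path_eval t x 0 j - X) + (X - Y) - (path_eval t y 0 j - Y) by ring.
  apply: le_trans (ler_normB _ _) _; apply: le_trans (lerD (ler_normD _ _) (lexx _)) _.
  apply: le_trans (lerD (lerD dx XY) dy) _.
  by rewrite le_eqVlt; apply/orP; left; apply/eqP; ring.
apply: le_trans (ler_sum _ (fun j _ => one j)) _.
by rewrite sumr_const cardT -cardE card_ord -[leLHS]mulr_natl.
Qed.

Lemma mesh_cell_cover x : exists c, mesh_cell c x.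
Proof.
have [L HL] := path_oscillation x e_gt0.
exists (Tagged (fun L => {ffun 'I_(2 ^ L).+1 * 'I_q -> int}) [ffun p : 'I_(2 ^ L).+1 * 'I_q => Num.floor (path_eval (dyadic L p.1) x 0 p.2 / e)]); split => //= p.
by rewrite ffunE floor_itv.
Qed.

End countable_path_cells.

Section measurability_by_perturbation.
Context {R : realType} {q : nat}.
Local Notation E := (path_space R q).

(** A function that varies little between nearby samples has measurable sublevel
sets: up to [u] a sublevel set is a countable union of products of cells, those
that contain one of its points.  This replaces separability of the path space. *)
Lemma measurable_perturbation n (g : n.-tuple E -> \bar R) (a : R) :
  (forall t t' (e : R), (forall j, mdist (tnth t j) (tnth t' j) <= e) ->
     (g t' <= g t + e%:E)%E) ->
  measurable [set t | (g t <= a%:E)%E].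
Proof.
move=> pert.
pose e (m : nat) : R := m.+1%:R^-1 / (q%:R * 3 + 1).
have q3 : 0 < q%:R * 3 + 1 :> R by rewrite ltr_wpDl// mulr_ge0.
have e0 m : 0 < e m by rewrite divr_gt0.
pose rect m (c : n.-tuple (@mesh_code q)) : set (n.-tuple E) :=
  [set t | forall j, mesh_cell (e m) (tnth c j) (tnth t j)].
have mrect m c : measurable (rect m c).
  rewrite (_ : rect m c = \bigcap_(j in [set: 'I_n])
      ((fun t : n.-tuple E => tnth t j) @^-1` mesh_cell (e m) (tnth c j))); last first.
    by apply/seteqP; split => [t h j _|t h j]; [exact: h|exact: (h j I)].
  apply: fin_bigcap_measurable => // j _; rewrite -[X in measurable X]setTI.
  by apply: (@measurable_tnth _ E n j) => //; exact: measurable_mesh_cell.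
(* The part of a product of cells that is kept at precision [m]: all of it if it
   meets the sublevel set, none of it otherwise. *)
pose piece m (c : n.-tuple (@mesh_code q)) : set (n.-tuple E) :=
  [set t | rect m c t /\ exists2 t0, rect m c t0 & (g t0 <= a%:E)%E].
have mpiece m c : measurable (piece m c).
  have [ex|nex] := pselect (exists2 t0, rect m c t0 & (g t0 <= a%:E)%E).
    by rewrite (_ : piece m c = rect m c)//; apply/seteqP; split => t // -[].
  by rewrite (_ : piece m c = set0)//; apply/seteqP; split => t // -[].
rewrite (_ : [set t | _] = \bigcap_m \bigcup_c piece m c).
  apply: bigcap_measurableType => m _; apply: countable_bigcupT_measurable => //.
  exact: countableP.
apply/seteqP; split => [t gt m _|t H /=].
  have [f Hf] := fin_all_exists (fun j => mesh_cell_cover (e0 m) (tnth t j)).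
  have rt : rect m [tuple f j | j < n] t by move=> j; rewrite tnth_mktuple.
  by exists [tuple f j | j < n] => //; split => //; exists t.
apply/lee_addgt0Pr => u u0.
pose m := Num.truncn u^-1.
have mu : m.+1%:R^-1 <= u.
  by rewrite -[u]invrK lef_pV2 ?posrE ?invr_gt0// ltW// truncnS_gt.
have [c _ [rt [t0 rt0 gt0]]] := H m I.
apply: le_trans (pert t0 t u _) _.
  move=> j; apply: le_trans (mesh_cell_diam (e0 m) (rt0 j) (rt j)) _.
  apply: le_trans mu; rewrite /e mulrA mulrCA -[leRHS]mulr1 ler_pM2l//.
  by rewrite ler_pdivrMr// mul1r lerDl.
by rewrite leeD2r.
Qed.

End measurability_by_perturbation.

Section sample_event.
Context {R : realType} {q : nat}.
Local Notation E := (path_space R q).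
Variables (dbar : probability E R -> probability E R -> \bar R)
  (nu : unit_itv R -> probability 'rV[R]_q R).
Hypothesis dbarE : dbar = prohorov \/ dbar = fortet_mourier.

(** The predecessor compensates the convention that [empirical n] averages [n.+1]
terms. *)
Definition sample_event (eps : R) : set (seq E) :=
  [set s | thickened_constraint dbar nu eps
    (empirical (size s).-1 (nth point s))].

Lemma dbar_empirical n (s s' : nat -> E) U (delta : R) :
  (forall j, (j < n.+1)%N -> mdist (s j) (s' j) <= delta) ->
  (dbar (empirical n s') U <= dbar (empirical n s) U + delta%:E)%E.
Proof.
by case: dbarE => ->; [exact: prohorov_empirical|exact: fortet_mourier_empirical].
Qed.

Lemma measurable_sample_event eps : measurable_seq (sample_event eps).
Proof.
case=> [|n].
  have [D0|D0] := pselect (sample_event eps [::]).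
    by rewrite (_ : [set t | _] = setT)//; apply/seteqP; split => // t _; rewrite /= tuple0.
  by rewrite (_ : [set t | _] = set0)//; apply/seteqP; split => // t; rewrite /= tuple0.
rewrite /sample_event /thickened_constraint /=.
apply: measurable_perturbation => t t' e tt'.
have dU U : (dbar (empirical (size t').-1 (nth point t')) U <=
    dbar (empirical (size t).-1 (nth point t)) U + e%:E)%E.
  rewrite !size_tuple; apply: dbar_empirical => j jn.
  by have := tt' (Ordinal jn); rewrite !(tnth_nth point).
rewrite -leeBlDr//; apply: le_ereal_inf_tmp => _ [U CU <-].
rewrite leeBlDr//; apply: le_trans (dU U); apply: ereal_inf_lbound.
by exists U.
Qed.

End sample_event.

(** * Gibbs conditioning *)

Section gibbs_conditioning.
Context d (T : measurableType d) (R : realType).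
Variables (W Wstar : probability T R) (phi : T -> R).
Local Notation bm := (@bounded_measurable d T R).
Hypothesis bphi : bm phi.
Hypothesis WstarE : forall f, bm f ->
  mean Wstar f = mean W (fun x => f x * expR (phi x)).
Local Notation H := (mean Wstar phi).
Variable D : nat -> set (seq T).
Hypothesis mD : forall n, measurable_seq (D n).
Hypothesis Drot : forall n, rot_invariant (D n).
Local Notation p n := (mean_seq W n.+1 \1_(D n)).
Variable K : nat -> set (probability T R).
Hypothesis K_near : forall eta, 0 < eta -> exists m, forall V c h,
  K m V -> dv_entropy_le W V c -> bm h -> (forall x, `|h x| <= 1) ->
  (mean V h - mean Wstar h) ^+ 2 <= 16 * (c - H + eta).
Hypothesis K_mean_empirical : forall m, \forall n \near \oo, forall Pi : probability T R,
  0 < p n ->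
  (forall g, bm g -> mean Pi g =
     mean_seq W n.+1 (fun s => \1_(D n) s * \sum_(x <- s) g x) / (p n * n.+1%:R)) ->
  K m Pi.
Hypothesis p_lower : forall eta, 0 < eta -> \forall n \near \oo,
  expR (- (n.+1%:R * (H + eta))) <= p n.

(** In [conditional_block_bound] divide by the number of blocks, which is at least
[n.+1 / (2 * k)]: the error [- ln p - n.+1 * mean Pi phi] is [o (n.+1)] by
[p_lower] and by [K_near] for the test function [phi / M]. *)
Lemma gibbs_conditioning (k : nat) (eta : R) : (0 < k)%N -> 0 < eta ->
  \forall n \near \oo, 0 < p n /\ forall B, measurable_seq B ->
    `|mean_seq W n.+1 (fun t => \1_(D n) t * \1_B (take k t)) / p n -
      mean_seq Wstar k \1_B| <= eta.
Proof.
move=> k0 eta0.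
have [M M0 phiM] := bm_bound bphi.
pose s0 : R := Num.min 2^-1 (eta / 4).
have s00 : 0 < s0 by rewrite lt_min invr_gt0 ltr0n divr_gt0.
have s0h : s0 <= 2^-1 by rewrite ge_min lexx.
have s0e : 4 * s0 <= eta.
  by rewrite -ler_pdivlMl// mulrC ge_min lexx orbT.
have kR : 0 < k%:R :> R by rewrite ltr0n.
have M1 : 0 < M + 1 by rewrite addr_gt0.
(* [M * u] will bound the distance from [mean Pi phi] to its limit, and [eta1] is
   the corresponding slack on entropies, from [16 * (2 * eta1) = u ^+ 2]. *)
pose u : R := Num.min 1 (s0 ^+ 2 / (k%:R * (M + 1))).
have u0 : 0 < u by rewrite lt_min ltr01 divr_gt0 ?exprn_gt0// mulr_gt0.
have u1 : u <= 1 by rewrite ge_min lexx.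
have ku : k%:R * ((M + 1) * u) <= s0 ^+ 2.
  by rewrite mulrA -ler_pdivlMl ?mulr_gt0// mulrC ge_min lexx orbT.
pose eta1 := u ^+ 2 / 32.
have eta10 : 0 < eta1 by rewrite divr_gt0 ?exprn_gt0.
have [m Hm] := K_near eta10.
near=> n.
have low : expR (- (n.+1%:R * (H + eta1))) <= p n by near: n; exact: p_lower.
have p0 : 0 < p n by apply: lt_le_trans low; exact: expR_gt0.
split => // B mB.
have n0 : (0 < n.+1)%N by [].
have n0R : 0 < n.+1%:R :> R by [].
have [Pi PiE] := mean_empirical_ex n0 (mD n) p0.
have KPi : K m Pi by move: Pi p0 PiE; near: n; exact: K_mean_empirical.
have lnp : - ln (p n) <= n.+1%:R * (H + eta1).
  by rewrite lerNl -[leLHS]expRK ler_ln ?posrE ?expR_gt0.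
have entPi : dv_entropy_le W Pi (H + eta1).
  apply: dv_entropy_leW (dv_entropy_mean_empirical n0 (mD n) p0 PiE).
  by rewrite ler_pdivrMr// mulrC.
have Pi_phi : `|mean Pi phi - H| <= M * u.
  have bh : bm (fun x => M^-1 * phi x) by exact: bmZ.
  have h1 x : `|M^-1 * phi x| <= 1.
    by rewrite normrM gtr0_norm ?invr_gt0// ler_pdivrMl// mulr1.
  have := Hm Pi _ _ KPi entPi bh h1; rewrite !meanZ// -mulrBr exprMn.
  have -> : 16 * (H + eta1 - H + eta1) = u ^+ 2.
    by rewrite /eta1; field.
  rewrite exprVn ler_pdivrMl ?exprn_gt0// -exprMn => h.
  by rewrite -(@ler_pXn2r _ 2)// ?nnegrE// ?mulr_ge0 ?(ltW M0) ?(ltW u0)// real_normK ?num_real.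
pose Kb := (n.+1 %/ k)%N.
have kn : (k <= n.+1)%N by near: n; exists k => // n /= /leqW.
have Kb0 : (0 < Kb)%N by rewrite divn_gt0.
have KbR : 0 < Kb%:R :> R by rewrite ltr0n.
have Kbk : (Kb * k <= n.+1)%N by exact: leq_trunc_div.
have nKb : n.+1%:R <= Kb%:R * (2 * k%:R) :> R.
  rewrite -!natrM ler_nat.
  apply: leq_trans (ltnW (ltn_ceil n.+1 k0)) _.
  by rewrite -/Kb mulnA leq_mul2r muln2 -addnn -addn1 leq_add2l Kb0 orbT.
set Delta := _ / p n - _.
have block s : `|s| <= 2^-1 -> s ^+ 2 = s0 ^+ 2 -> s * Delta <= 4 * s0 ^+ 2.
  move=> s12 ss.
  have := conditional_block_bound n0 (mD n) p0 PiE (@Drot n) bphi WstarE mB Kbk s12.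
  rewrite -/Delta ss => h.
  have h2 : Kb%:R * (s * Delta) <= Kb%:R * (4 * s0 ^+ 2).
    have h3 : n.+1%:R * (H + eta1 - mean Pi phi) <= Kb%:R * (2 * s0 ^+ 2).
      apply: (@le_trans _ _ (n.+1%:R * ((M + 1) * u))).
        rewrite ler_pM2l// mulrDl mul1r.
        have : eta1 <= u.
          rewrite /eta1 expr2 -mulrA ler_piMr ?(ltW u0)// ler_pdivrMr// mul1r.
          by rewrite (le_trans u1)// ler1n.
        by move: Pi_phi; rewrite ler_distl => /andP[+ _]; lra.
      apply: (@le_trans _ _ (Kb%:R * (2 * k%:R) * ((M + 1) * u))).
        by rewrite ler_wpM2r// mulr_ge0// ltW.
      by rewrite -mulrA ler_pM2l// -mulrA ler_pM2l.
    rewrite -[Kb%:R * s * Delta]mulrA -[2 * Kb%:R * _]mulrA in h.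
    rewrite [Kb%:R * (2 * _)]mulrCA mulrBr mulrDr in h3.
    have l := lnp; rewrite mulrDr in l; rewrite [Kb%:R * (4 * _)]mulrCA.
    move: h h3 l.
    move: (Kb%:R * (s * Delta)) (n.+1%:R * mean Pi phi) (n.+1%:R * H) (n.+1%:R * eta1) => a b c e.
    move: (Kb%:R * s0 ^+ 2) (ln (p n)) => f g; lra.
  by move: h2; rewrite ler_pM2l.
have b1 := block s0; have b2 := block (- s0).
rewrite normrN gtr0_norm// sqrrN in b1 b2.
rewrite ler_norml; apply/andP; split.
  have := b2 s0h erefl; rewrite mulNr -mulrN expr2 mulrCA ler_pM2l// => h.
  lra.
have := b1 s0h erefl; rewrite expr2 mulrCA ler_pM2l// => h; lra.
Unshelve. all: by end_near. Qed.

End gibbs_conditioning.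

(** * Asymptotic estimates *)

Section asymptotics.
Context {R : realType}.

(** The sample size from which cells of level [L] can be controlled. *)
Definition level_size (c L : nat) : nat := (2 ^ (c * L.+1 * 2 ^ L))%N.

Lemma level_ex (c L0 N : nat) : (0 < c)%N -> (level_size c L0 <= N)%N ->
  exists2 L, (L0 <= L)%N & (level_size c L <= N < level_size c L.+1)%N.
Proof.
move=> c0 L0N; pose P L := (level_size c L <= N)%N.
have exP : exists L, P L by exists L0.
have ubP L : P L -> (L <= N)%N.
  move=> PL; apply: leq_trans PL; apply: leq_trans (ltnW (ltn_expl L (ltnSn 1))) _.
  rewrite /level_size leq_exp2l// -mulnA mulnC -mulnA -{1}(muln1 L).
  have : (0 < 2 ^ L * c)%N by rewrite muln_gt0 expn_gt0.
  by rewrite mulSn; move: (2 ^ L * c)%N; nia.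
case: (ex_maxnP exP ubP) => L PL Lmax.
exists L; first exact: Lmax.
rewrite -/(P L) PL /= ltnNge; apply/negP => PL1.
by have := Lmax _ PL1; rewrite ltnn.
Qed.

Lemma linear_expR_decay (C u : R) : 0 <= C -> 0 < u -> exists L0, forall L, (L0 <= L)%N ->
  C * L.+1%:R * expR (- u) ^+ L <= 1.
Proof.
move=> C0 u0; exists (Num.truncn (8 * C / u ^+ 2)).+1 => L LL.
have u2 : 0 < u ^+ 2 by rewrite exprn_gt0.
have L0 : (0 < L)%N by exact: leq_trans LL.
have LR : 0 < L%:R :> R by rewrite ltr0n.
have h1 : 8 * C / u ^+ 2 <= L%:R.
  by apply: ltW (lt_le_trans (truncnS_gt _) _); rewrite ler_nat.
have h2 : expR (- u) ^+ L <= (2 / (L%:R * u)) ^+ 2.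
  by rewrite -expRM_natl mulrN; apply: expR_opp_le_expr => //; rewrite mulr_gt0.
have h3 : L.+1%:R <= 2 * L%:R :> R by rewrite -natrM ler_nat; lia.
apply: (@le_trans _ _ (C * (2 * L%:R) * (2 / (L%:R * u)) ^+ 2)).
  by apply: ler_pM; rewrite ?mulr_ge0 ?exprn_ge0 ?expR_ge0// ler_wpM2l.
rewrite (_ : _ * _ = (8 * C / u ^+ 2) / L%:R); last by field; rewrite !gt_eqF.
by rewrite ler_pdivrMr// mul1r.
Qed.

Variable r : R.
Hypotheses (r_gt0 : 0 < r) (r_half : r < 1 / 2).

(** [2 ^ (- alpha)] with [alpha] the middle of [r] and [1 / 2]: the Hoelder exponent
[alpha] is available to Brownian paths and beats the rate [r]. *)
Definition holder_rate : R := expR (- ((r + 1 / 2) / 2 * ln 2)).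

Let ln2 : 0 < ln 2 :> R. Proof. by rewrite ln_gt0// ltr1n. Qed.

Lemma holder_rate_gt0 : 0 < holder_rate. Proof. exact: expR_gt0. Qed.

Lemma holder_rate_lt1 : holder_rate < 1.
Proof.
rewrite -[ltRHS]expR0 ltr_expR oppr_lt0 mulr_gt0//; move: r_gt0; lra.
Qed.

Lemma holder_rate_sqr : 1 < 2 * holder_rate ^+ 2.
Proof.
rewrite -{1}[2](@lnK R) ?posrE// -expRM_natl -expRD -[ltLHS]expR0 ltr_expR.
 rewrite (_ : _ + _ = (1 / 2 - r) * ln 2); last by field.
by rewrite mulr_gt0// subr_gt0.
Qed.

(** At level [L] the logarithm of the sample size is of order [L * 2 ^ L], hence its
power [r] is at most of order [L * 2 ^ (r * L)], which is negligible against
[holder_rate ^- L]. *)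
Lemma log_scale_level (c : nat) (A : R) : (0 < c)%N -> 0 < A ->
  exists L0, forall L N, (L0 <= L)%N -> (1 < N)%N -> (N < level_size c L.+1)%N ->
  A * holder_rate ^+ L <= 1 / (ln N%:R `^ r).
Proof.
move=> c0 A0.
have u0 : 0 < (1 / 2 - r) / 2 * ln 2 by rewrite mulr_gt0// divr_gt0// subr_gt0.
have Ac : 0 <= A * (4 * c%:R) by rewrite !mulr_ge0// ltW.
have [L0 HL0] := linear_expR_decay Ac u0.
exists L0 => L N LL N1 NL.
have N1R : 1 < N%:R :> R by rewrite ltr1n.
have lnN : 0 < ln N%:R :> R by rewrite ln_gt0.
have ln2_le1 : ln 2 <= 1 :> R.
  have := @le_ln1Dx R 1 (lt_trans (ltrN10 R) ltr01).
  by rewrite (_ : 1 + 1 = 2)//.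
pose Y : R := 4 * c%:R * (L.+1%:R * 2 ^+ L).
have lnNY : ln N%:R <= Y.
  apply: (@le_trans _ _ (ln ((2 : R) ^+ (c * L.+2 * 2 ^ L.+1)))).
    have N0 : 0 < N%:R :> R by exact: lt_trans N1R.
    rewrite ler_ln ?posrE ?exprn_gt0//.
    by rewrite -natrX ler_nat ltnW.
  rewrite lnXn// -[leLHS]mulr_natl.
  apply: (@le_trans _ _ ((c * L.+2 * 2 ^ L.+1)%:R * 1)); first by rewrite ler_wpM2l.
  rewrite mulr1 /Y -natrX -!natrM ler_nat expnS.
  have : (L.+2 <= 2 * L.+1)%N by lia.
  move: (2 ^ L)%N => p h; rewrite (_ : 4 * c * (L.+1 * p) = c * (2 * L.+1) * (2 * p))%N; last by ring.
  by rewrite leq_mul2r leq_mul2l h !orbT.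
have r0 : 0 <= r by exact: ltW.
have r1 : r <= 1 by move: r_half; lra.
have Yr : ln N%:R `^ r <= 4 * c%:R * L.+1%:R * (2 `^ r) ^+ L.
  apply: le_trans (ge0_ler_powR r0 (ltW lnN) _ lnNY) _.
    by rewrite nnegrE /Y !mulr_ge0// exprn_ge0.
  rewrite /Y mulrA powRM ?mulr_ge0 ?exprn_ge0//.
  rewrite -[2 ^+ L]powR_mulrn// -powRrM (mulrC L%:R) powRrM powR_mulrn ?powR_ge0//.
  rewrite ler_wpM2r ?exprn_ge0 ?powR_ge0//.
  rewrite -[leRHS]powRr1 ?mulr_ge0// ler_powR//.
  by rewrite -!natrM ler1n !muln_gt0 c0.
have lr0 : 0 < ln N%:R `^ r by exact: powR_gt0.
rewrite ler_pdivlMr//.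
apply: (@le_trans _ _ (A * holder_rate ^+ L * (4 * c%:R * L.+1%:R * (2 `^ r) ^+ L))).
  by rewrite ler_wpM2l// mulr_ge0 ?exprn_ge0 ?expR_ge0// ltW.
apply: le_trans (HL0 L LL).
rewrite [2 `^ r](_ : _ = expR (r * ln 2)); last by rewrite /powR gt_eqF.
rewrite le_eqVlt; apply/orP; left; apply/eqP.
rewrite (_ : expR (- _) = holder_rate * expR (r * ln 2)).
  by rewrite [in RHS]exprMn; ring.
by rewrite -expRD; congr expR; field.
Qed.

Lemma log_scale_cvg0 (e : R) : 0 < e -> \forall n \near \oo, 1 / (ln n%:R `^ r) < e.
Proof.
move=> e0; pose y := (e^-1) `^ (r^-1).
have y0 : 0 <= y by exact: powR_ge0.
exists (Num.truncn (expR y)).+1 => // n /= hn.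
have h1 : expR y < n%:R by apply: lt_le_trans (truncnS_gt _) _; rewrite ler_nat.
have n0 : 0 < n%:R :> R by exact: lt_trans (expR_gt0 _) h1.
have h2 : y < ln n%:R by rewrite -[ltLHS]expRK ltr_ln ?posrE ?expR_gt0.
have h3 : e^-1 < ln n%:R `^ r.
  have -> : e^-1 = y `^ r.
    by rewrite /y -powRrM mulVf ?gt_eqF// powRr1// invr_ge0 ltW.
  by rewrite gt0_ltr_powR// ?nnegrE// ltW// (le_lt_trans y0 h2).
by rewrite mul1r -[ltRHS]invrK ltf_pV2 ?posrE ?invr_gt0//; apply: lt_trans h3; rewrite invr_gt0.
Qed.

Lemma expR_decay_lt (u B : R) : 0 < u -> 0 < B -> \forall n \near \oo,
  expR (- (n%:R * u)) <= B.
Proof.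
move=> u0 B0; exists (Num.truncn (B^-1 / u)).+1 => // n /= hn.
have h1 : B^-1 / u < n%:R by apply: lt_le_trans (truncnS_gt _) _; rewrite ler_nat.
have n0 : 0 < n%:R :> R by apply: lt_trans h1; rewrite divr_gt0// invr_gt0.
have h2 := @expR_opp_le_expr R (n%:R * u) 1 (mulr_gt0 n0 u0) isT.
apply: le_trans h2 _; rewrite expr1 mul1r -[leRHS]invrK lef_pV2 ?posrE ?invr_gt0 ?mulr_gt0//.
by rewrite ltW// -ltr_pdivrMr.
Qed.

End asymptotics.

(** * Lower bound on the probability of the conditioning event *)

Section chernoff_family.
Context d (T : measurableType d) (R : realType).

Lemma measurable_seq_sum_ge (h : T -> R) (c : R) : bounded_measurable h ->
  measurable_seq [set s | c <= \sum_(x <- s) h x].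
Proof.
move=> bh n; have [mf _] := bm_seq_sum bh n.
rewrite -[X in measurable X]setTI (_ : [set t | _] =
  (fun t : n.-tuple T => \sum_(x <- t) h x) @^-1` `[c, +oo[).
  by apply: mf.
by apply/seteqP; split => t /=; rewrite in_itv/= andbT.
Qed.

(** Union bound over finitely many Chernoff bounds, one for each test function. *)
Lemma chernoff_family (mu : probability T R) (n : nat) (J : finType)
    (h : J -> T -> R) (a : J -> R) (D : set (seq T)) :
  (forall j, bounded_measurable (h j)) -> (forall j x, `|h j x| <= 1) ->
  (forall j, 0 <= a j <= 2) -> (forall j, mean mu (h j) <= 0) ->
  measurable_seq D ->
  (forall s, size s = n -> (forall j, \sum_(x <- s) h j x < n%:R * a j) -> D s) ->
  1 - \sum_j expR (- (n%:R * a j ^+ 2 / 8)) <= mean_seq mu n \1_D.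
Proof.
move=> bh h1 a02 mh mD HD.
pose B j := [set s : seq T | n%:R * a j <= \sum_(x <- s) h j x].
have mB j : measurable_seq (B j) by exact: measurable_seq_sum_ge.
rewrite lerBlDr -lerBlDl mean_seq_indic// -fine_probC; last exact: mD.
apply: le_trans (union_bound _ (A := fun j => [set t : n.-tuple T | B j t]) _ _ _) _.
- by apply: measurableC; exact: mD.
- by move=> j; exact: mB.
- move=> t nD; apply: contrapT => no; apply: nD; apply: HD; first by rewrite size_tuple.
  by move=> j; rewrite ltNge; apply/negP => hj; apply: no; exists j.
apply: ler_sum => j _; rewrite -(mean_seq_indic _ _ (mB j)).
by apply: (chernoff_bound (h := h j)).
Qed.

End chernoff_family.

Section numerical_bounds.
Context {R : realType}.

Lemma centered_indicator_le1 (b : bool) (w : R) : 0 <= w <= 1 -> `|b%:R - w| <= 1.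
Proof. by case: b => /andP[w0 w1] /=; rewrite ler_norml; apply/andP; split; lra. Qed.

(** [2 * Q] Chernoff bounds at deviation [delta / Q], where [delta = C * rho ^+ L] and
[Q] bounds the number of cells: with [Q ^ 4] samples the exponent is at least of
order [Q], which absorbs the factor [Q]. *)
Lemma cell_tail_small (C rho : R) (L Q N : nat) : 0 < C -> (2 ^+ L)^-1 <= rho ^+ L ->
  (2 ^+ L) ^+ 2 <= Q%:R :> R -> 2048 / C ^+ 4 <= Q%:R -> Q%:R ^+ 4 <= N%:R :> R ->
  (0 < Q)%N ->
  Q%:R * 2 * expR (- (N%:R * (C * rho ^+ L / Q%:R) ^+ 2 / 8)) <= 1 / 4.
Proof.
move=> C0 hrho hL hQ QN Qpos; have Q0 : 0 < Q%:R :> R by rewrite ltr0n.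
set delta := C * rho ^+ L.
have rhoL : 0 <= rho ^+ L by apply: le_trans hrho; rewrite invr_ge0 exprn_ge0.
have Qd : C ^+ 2 <= Q%:R * delta ^+ 2.
  rewrite /delta exprMn mulrCA ler_peMr ?exprn_ge0 ?(ltW C0)//.
  apply: (@le_trans _ _ ((2 ^+ L) ^+ 2 * ((2 ^+ L)^-1) ^+ 2)).
    by rewrite -exprMn divff ?expf_neq0// expr1n.
  apply: ler_pM => //; rewrite ?exprn_ge0 ?invr_ge0 ?exprn_ge0//.
  by apply: lerXn2r; rewrite ?nnegrE// invr_ge0 exprn_ge0.
have ex : Q%:R * C ^+ 2 / 8 <= N%:R * (delta / Q%:R) ^+ 2 / 8.
  rewrite ler_pM2r ?invr_gt0//.
  apply: (@le_trans _ _ (Q%:R ^+ 4 * (delta / Q%:R) ^+ 2)); last by rewrite ler_wpM2r// sqr_ge0.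
  rewrite (_ : _ * (delta / Q%:R) ^+ 2 = Q%:R * (Q%:R * delta ^+ 2)); last first.
    by field; rewrite gt_eqF.
  by rewrite ler_pM2l.
have QC0 : 0 < Q%:R * C ^+ 2 / 8 by rewrite divr_gt0// mulr_gt0// exprn_gt0.
have e3 := @expR_opp_le_expr R _ 2 QC0 isT.
have e4 : expR (- (N%:R * (delta / Q%:R) ^+ 2 / 8)) <= (2 / (Q%:R * C ^+ 2 / 8)) ^+ 2.
  by apply: le_trans e3; rewrite ler_expR lerN2.
apply: (@le_trans _ _ (Q%:R * 2 * (2 / (Q%:R * C ^+ 2 / 8)) ^+ 2)).
  by rewrite ler_wpM2l.
rewrite (_ : _ * _ = 512 / C ^+ 4 / Q%:R); last by field; rewrite !gt_eqF.
rewrite ler_pdivrMr//.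
by move: hQ; rewrite (_ : 2048 / C ^+ 4 = 4 * (512 / C ^+ 4)); [lra|field; rewrite gt_eqF].
Qed.

Lemma deviation_to_sum (N M H s eta a : R) : 0 < N -> 0 < M -> a <= eta / (4 * M) ->
  (2 * M)^-1 * (s - N * H) < N * a -> s <= N * (H + eta / 2).
Proof.
move=> N0 M0; rewrite ler_pdivlMr ?mulr_gt0// ltr_pdivrMl ?mulr_gt0// => ha hs.
have : N * (a * (4 * M)) <= N * eta by rewrite ler_pM2l.
have e : 2 * M * (N * a) = N * (a * (4 * M)) / 2 by field.
by rewrite e in hs => h; lra.
Qed.

Lemma half_le_of_sum (x y z : R) : x <= 1 / 4 -> y <= 1 / 4 -> 1 - (x + y) <= z ->
  1 / 2 <= z.
Proof. by lra. Qed.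

End numerical_bounds.

Section lower_bound.
Context {R : realType} {q : nat}.
Local Notation E := (path_space R q).
Variables (mu0 : probability 'rV[R]_q R) (W Wstar : probability E R) (phi : E -> R).
Hypothesis wienerW : is_wiener mu0 W.
Variables (kappa m : R).
Hypotheses (kappa_gt0 : 0 < kappa) (m_gt0 : 0 < m).
Hypothesis mu0_tail : forall rad : R, 0 < rad ->
  (mu0 (~` [set x | (enorm x < rad)%R]) <= (kappa / rad `^ m)%:E)%E.
Hypothesis bphi : bounded_measurable phi.
Hypothesis WstarE : forall f, bounded_measurable f ->
  mean Wstar f = mean W (fun x => f x * expR (phi x)).
Variables (dbar : probability E R -> probability E R -> \bar R)
  (nu : unit_itv R -> probability 'rV[R]_q R).
Hypothesis dbarE : dbar = prohorov \/ dbar = fortet_mourier.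
Hypothesis CWstar : marginal_constraint nu Wstar.
Variable r : R.
Hypotheses (r_gt0 : 0 < r) (r_half : r < 1 / 2).

Lemma dbar_cells (I : finType) (S : I -> set E) (V V' : probability E R) (delta a : R) :
  0 < delta -> (forall i, measurable (S i)) ->
  (forall i j x, S i x -> S j x -> i = j) ->
  (forall i x y, S i x -> S i y -> mdist x y <= delta) ->
  1 - delta <= \sum_i fine (V' (S i)) ->
  (forall i, `|fine (V (S i)) - fine (V' (S i))| <= a) ->
  #|I|%:R * a <= delta -> (dbar V V' <= (6 * delta)%:E)%E.
Proof.
by case: dbarE => ->; [exact: prohorov_cells|exact: fortet_mourier_cells].
Qed.

Lemma density_prob_le (M : R) (A : set E) : (forall x, phi x <= M) -> measurable A ->
  fine (Wstar A) <= expR M * fine (W A).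
Proof.
move=> pM mA; have bA := bm_indic R mA.
rewrite -mean_indic// WstarE// -(mean_indic W mA) -meanZ//.
apply: le_mean; [by apply: bmM => //; exact: bm_expR|exact: bmZ|] => x.
by rewrite mulrC ler_wpM2r ?ler_expR// indicE.
Qed.

(** Under [Wstar] a sample is good when each cell has the right frequency up to
[a = delta / Q] and the mean of [phi] is almost [H]; good samples lie in the
conditioning event because their empirical measure is close to [Wstar], and their
probability is at least [1 / 2]. *)
Lemma sample_event_lower (eta : R) : 0 < eta -> \forall n \near \oo,
  expR (- (n.+1%:R * (mean Wstar phi + eta))) <=
  mean_seq W n.+1 \1_(sample_event dbar nu (1 / (ln n.+1%:R `^ r))).
Proof.
move=> eta0; set H := mean Wstar phi.
have [M M0 phiM] := bm_bound bphi.
have rho0 := holder_rate_gt0 r; have rho1 := holder_rate_lt1 r_gt0.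
have rho2 := holder_rate_sqr r_half; set rho := holder_rate r in rho0 rho1 rho2.
have [C C0 [c cells]] := wiener_cells wienerW kappa_gt0 m_gt0 mu0_tail rho0 rho1 rho2.
(* The factor [expR M] transfers the mass estimate from [W] to [Wstar]. *)
pose C' := C * expR M.
have C'0 : 0 < C' by rewrite mulr_gt0 ?expR_gt0.
have CC' : C <= C' by rewrite ler_peMr ?(ltW C0)// -[leLHS]expR0 ler_expR ltW.
have c0 : (0 < 4 * c.+1)%N by [].
have A0 : 0 < 6 * C' by rewrite mulr_gt0.
have [L1 HL1] := log_scale_level r_gt0 r_half c0 A0.
have u0 : 0 < (r + 1 / 2) / 2 * ln 2.
  by rewrite mulr_gt0 ?ln_gt0 ?ltr1n//; move: r_gt0; lra.
have [L2 HL2] := linear_expR_decay (ltW C'0) u0.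
have two1 : (1 : R) < 2 by rewrite ltr1n.
have [L3 _ HL3] := expr_unbounded (2048 / C' ^+ 4) two1.
pose L0 := maxn L1 (maxn L2 L3).
pose a2 : R := Num.min (eta / (4 * M)) 2.
have a20 : 0 < a2 by rewrite lt_min divr_gt0 ?mulr_gt0//=.
have a28 : 0 < a2 ^+ 2 / 8 by rewrite divr_gt0 ?exprn_gt0.
have e2 : 0 < eta / 2 by rewrite divr_gt0.
have q4 : 0 < 1 / 4 :> R by rewrite divr_gt0.
have q2 : 0 < 1 / 2 :> R by rewrite divr_gt0.
near=> n.
have NL0 : (level_size (4 * c.+1) L0 <= n.+1)%N.
  by near: n; exists (level_size (4 * c.+1) L0) => // k /= /leqW.
have N1 : (1 < n.+1)%N by near: n; exists 1%N.
have t1 : expR (- (n.+1%:R * (a2 ^+ 2 / 8))) <= 1 / 4.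
  near: n; have [k _ Hk] := expR_decay_lt a28 q4.
  by exists k => // n' /= kn'; apply: Hk => /=; exact: leqW.
have t3 : expR (- (n.+1%:R * (eta / 2))) <= 1 / 2.
  near: n; have [k _ Hk] := expR_decay_lt e2 q2.
  by exists k => // n' /= kn'; apply: Hk => /=; exact: leqW.
set N := n.+1 in NL0 N1 t1 t3 *; have NR : 0 < N%:R :> R by rewrite ltr0n.
have [L L0L /andP[LN NL]] := level_ex c0 NL0.
have [L1L L2L L3L] : [/\ L1 <= L, L2 <= L & L3 <= L]%N.
  by move: L0L; rewrite /L0 !geq_max => /and3P[].
have [I [S [mS S_disj S_diam S_mass cardI]]] := cells L.
pose Q : nat := (2 ^ (c.+1 * L.+1 * 2 ^ L))%N.
have Q0 : 0 < Q%:R :> R by rewrite ltr0n expn_gt0.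
have IQ : #|I|%:R <= Q%:R :> R.
  rewrite ler_nat (leq_trans cardI)// leq_exp2l// leq_mul2r leq_mul2r leqnSn.
  by rewrite !orbT.
have QN : Q%:R ^+ 4 <= N%:R :> R.
  rewrite -natrX ler_nat; apply: leq_trans LN.
  by rewrite /Q /level_size -expnM [(_ * 4)%N]mulnC !mulnA.
have Qpos : (0 < Q)%N by rewrite expn_gt0.
have hL2 : (2 ^+ L) ^+ 2 <= Q%:R :> R.
  rewrite -exprM -natrX ler_nat /Q leq_exp2l//.
  rewrite -mulnA; apply: (leq_trans _ (leq_pmull _ (ltn0Sn c))).
  by case: (L) => // l; rewrite leq_mul// expnS leq_pmulr// expn_gt0.
have hQ : 2048 / C' ^+ 4 <= Q%:R.
  apply: le_trans HL3 _; rewrite -natrX ler_nat /Q leq_exp2l// (leq_trans L3L)//.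
  rewrite -mulnA mulnC -mulnA (leq_trans (leqnSn L))// leq_pmulr//.
  by rewrite muln_gt0 expn_gt0.
pose delta := C' * rho ^+ L.
have d0 : 0 < delta by rewrite mulr_gt0 ?exprn_gt0.
have rhoL : 0 <= rho ^+ L by rewrite exprn_ge0 ?ltW.
have d1 : delta <= 1.
  apply: le_trans (HL2 L L2L); rewrite -/rho /delta.
  rewrite ler_wpM2r// ler_peMr ?(ltW C'0)// ler1n.
  done.
have deps : 6 * delta <= 1 / (ln N%:R `^ r).
  by rewrite mulrA; exact: HL1.
pose a := delta / Q%:R.
have Q1 : 1 <= Q%:R :> R by rewrite ler1n expn_gt0.
have a0 : 0 < a by rewrite divr_gt0.
have a1 : a <= 2.
  apply: (@le_trans _ _ 1); last by rewrite ler1n.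
  by rewrite ler_pdivrMr// mul1r (le_trans d1).
have Ia : #|I|%:R * a <= delta.
  by rewrite /a mulrA ler_pdivrMr// mulrC ler_pM2l.
pose w i := fine (Wstar (S i)).
have w01 i : 0 <= w i <= 1 by rewrite fine_prob_ge0 fine_prob_le1.
(* [Some (i, b)] tests the frequency of the cell [i] from above or from below, and
   [None] tests the mean of [phi]. *)
pose h (j : option (I * bool)) (x : E) : R :=
  if j is Some (i, b) then (-1) ^+ b * (\1_(S i) x - w i) else (2 * M)^-1 * (phi x - H).
pose b (j : option (I * bool)) : R := if j is Some _ then a else a2.
pose good := [set s : seq E | sample_event dbar nu (1 / (ln N%:R `^ r)) s /\
   \sum_(x <- s) phi x <= N%:R * (H + eta / 2)].
have mev : measurable_seq (sample_event dbar nu (1 / (ln N%:R `^ r))).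
  by move=> k; exact: measurable_sample_event.
have mgood : measurable_seq good.
  have m2 : measurable_seq [set s : seq E | - (N%:R * (H + eta / 2)) <= \sum_(x <- s) - phi x].
    by apply: measurable_seq_sum_ge; exact: bmN.
  move=> k.
  have e : [set t : k.-tuple E | good t] =
      [set t : k.-tuple E | sample_event dbar nu (1 / (ln N%:R `^ r)) t] `&`
      [set t : k.-tuple E | - (N%:R * (H + eta / 2)) <= \sum_(x <- t) - phi x].
    by apply/seteqP; split => t /= [tD]; rewrite sumrN lerN2.
  by rewrite e; exact: (measurableI _ _ (mev k) (m2 k)).
have bh j : bounded_measurable (h j).
  case: j => [[i s]|]; apply: bmZ; apply: bmB => //; try exact: bm_cst.
  exact: bm_indic.
have HM : `|H| <= M by exact: normr_mean.
have h1 j x : `|h j x| <= 1.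
  case: j => [[i s]|] /=.
    rewrite normrM normrX normrN1 expr1n mul1r.
    by rewrite indicE; exact: centered_indicator_le1.
  rewrite normrM gtr0_norm ?invr_gt0 ?mulr_gt0// ler_pdivrMl ?mulr_gt0// mulr1.
  rewrite (le_trans (ler_normB _ _))// mulr_natl mulr2n lerD//.
have mh j : mean Wstar (h j) <= 0.
  case: j => [[i s]|] /=.
    rewrite meanZ ?meanB ?mean_cst ?mean_indic ?subrr ?mulr0//; try exact: bm_cst.
      exact: bm_indic.
    by apply: bmB; [exact: bm_indic|exact: bm_cst].
  rewrite meanZ ?meanB ?mean_cst ?subrr ?mulr0//; first exact: bm_cst.
  by apply: bmB => //; exact: bm_cst.
have b02 j : 0 <= b j <= 2.
  by case: j => [_|] /=; rewrite ltW//= ge_min lexx orbT.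
have covers s : size s = N -> (forall j, \sum_(x <- s) h j x < N%:R * b j) -> good s.
  move=> sN Hs; split; last first.
    have := Hs None; rewrite /= -mulr_sumr sumrB big_const_seq count_predT sN.
    rewrite iter_addr_0 -[H *+ N]mulr_natl; apply: deviation_to_sum => //.
    by rewrite ge_min lexx.
  rewrite /sample_event /thickened_constraint /=.
  apply: ge_ereal_inf.
  exists (dbar (empirical (size s).-1 (nth point s)) Wstar); first by exists Wstar.
  apply: (@le_trans _ _ (6 * delta)%:E); last by rewrite lee_fin.
  apply: (dbar_cells (S := S) (a := a)) => //.
  - by move=> i x y Sx Sy; apply: le_trans (S_diam i x y Sx Sy) _; rewrite ler_wpM2r.
  - apply: (@le_trans _ _ (fine (Wstar (\bigcup_i S i)))); last first.
      apply: union_bound => //; last by move=> x [i _ Six]; exists i.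
      by apply: fin_bigcup_measurable => //; exact: finite_finset.
    have mU : measurable (\bigcup_i S i).
      by apply: fin_bigcup_measurable => //; exact: finite_finset.
    rewrite lerBlDr -lerBlDl -fine_probC//.
    apply: le_trans (density_prob_le (M := M) _ _) _.
    + by move=> x; apply: le_trans (phiM x); exact: ler_norm.
    + exact: measurableC.
    by rewrite /delta /C' mulrAC mulrC ler_pM2r ?expR_gt0.
  - move=> i; rewrite fine_empirical sN -/(w i).
    have e1 : \sum_(j < N.-1.+1) \1_(S i) (nth point s j) = \sum_(x <- s) \1_(S i) x :> R.
      by rewrite (big_nth point) sN big_mkord.
    rewrite e1.
    have dev : \sum_(x <- s) (\1_(S i) x - w i) = \sum_(x <- s) \1_(S i) x - N%:R * w i :> R.
      by rewrite sumrB big_const_seq count_predT sN iter_addr_0 mulr_natl.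
    have := Hs (Some (i, false)); have := Hs (Some (i, true)).
    rewrite /= -!mulr_sumr dev expr0 expr1 mul1r mulN1r => g1 g2.
    rewrite -[w i](mulKf (negbT (gt_eqF NR))) -mulrBr normrM gtr0_norm ?invr_gt0//.
    by rewrite ler_pdivrMl// ler_norml lerNl ltW//= ltW.
have conc := chernoff_family bh h1 b02 mh mgood covers.
have half : 1 / 2 <= mean_seq Wstar N \1_good.
  rewrite mulrA in t1; apply: half_le_of_sum t1 _ _.
    exact: (cell_tail_small C'0 (half_pow_le L rho0 rho1 rho2) hL2 hQ QN Qpos).
  apply: le_trans conc; rewrite lerD2l lerN2 (bigD1 None)//= lerD2l.
  rewrite (reindex_omap Some id) /=; last by case.
  rewrite (eq_bigl xpredT); last by move=> j; rewrite eqxx.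
  rewrite (eq_bigr (fun=> expR (- (N%:R * a ^+ 2 / 8)))); last by [].
  rewrite sumr_const cardT -cardE card_prod card_bool -[leLHS]mulr_natl natrM.
  by rewrite ler_wpM2r ?expR_ge0// ler_wpM2r.
have bgood := bm_seq_indic R mgood.
have cm := @change_of_measure_lower_bound _ _ _ W Wstar phi N good
  (N%:R * (H + eta / 2)) bphi WstarE mgood (fun s gs => gs.2).
apply: (@le_trans _ _ (mean_seq W N \1_good)); last first.
  apply: le_mean_seq => //; first exact: bm_seq_indic mev.
  move=> s _; rewrite !indicE; have [|//] := boolP (s \in good).
  by rewrite inE => -[gs _]; rewrite mem_set.
apply: le_trans cm.
apply: (@le_trans _ _ (expR (- (N%:R * (H + eta / 2))) * (1 / 2))); last first.
  by rewrite ler_pM2l ?expR_gt0.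
rewrite (_ : - (N%:R * (H + eta)) = - (N%:R * (H + eta / 2)) - N%:R * (eta / 2)); last by field.
by rewrite expRD ler_pM2l ?expR_gt0.
Unshelve. all: by end_near. Qed.

End lower_bound.

(** * Conclusion *)

Section constraint_of_samples.
Context {R : realType} {q : nat}.
Local Notation E := (path_space R q).
Variables (dbar : probability E R -> probability E R -> \bar R)
  (nu : unit_itv R -> probability 'rV[R]_q R).
Hypothesis dbarE : dbar = prohorov \/ dbar = fortet_mourier.

(** The distances depend on a probability through its values only. *)
Lemma thickened_constraint_ext (V V' : probability E R) eps :
  (V : set E -> \bar R) = V' ->
  thickened_constraint dbar nu eps V -> thickened_constraint dbar nu eps V'.
Proof.
move=> VV'; have dVV' U : dbar V U = dbar V' U.
  by case: dbarE => ->; rewrite /prohorov /fortet_mourier VV'.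
rewrite /thickened_constraint /= (_ : [set dbar V U | U in _] =
  [set dbar V' U | U in marginal_constraint nu])//.
by apply: eq_imagel => U _; exact: dVV'.
Qed.

Lemma empirical_ext n (x y : nat -> E) :
  (forall A, \sum_(j < n.+1) \1_A (x j) = \sum_(j < n.+1) \1_A (y j) :> R) ->
  (empirical n x : set E -> \bar R) = empirical n y.
Proof.
move=> xy; apply/funext => A.
have e1 := @empiricalE _ E R n x A; have e2 := @empiricalE _ E R n y A.
by rewrite xy -e2 in e1; exact: e1.
Qed.

Lemma sample_event_rot eps : rot_invariant (sample_event dbar nu eps).
Proof.
move=> k [|x s]; first by rewrite /rot/=.
rewrite /sample_event /= size_rot; apply: thickened_constraint_ext.
apply: empirical_ext => A.
have sumE (t : seq E) : size t = (size s).+1 ->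
    \sum_(j < (size s).+1) \1_A (nth point t j) = \sum_(y <- t) \1_A y :> R.
  by move=> <-; rewrite (big_nth point) big_mkord.
rewrite !sumE ?size_rot//.
by apply: perm_big; rewrite perm_sym perm_rot.
Qed.

Lemma sample_eventE n eps (x : nat -> E) :
  thickened_constraint dbar nu eps (empirical n x) <->
  sample_event dbar nu eps [tuple x j | j < n.+1].
Proof.
have xE (j : 'I_n.+1) : nth point [tuple x i | i < n.+1] j = x j.
  by have := tnth_nth point [tuple x i | i < n.+1] j; rewrite tnth_mktuple.
rewrite /sample_event /mkset size_tuple.
split; apply: thickened_constraint_ext; apply: empirical_ext => A;
  by apply: eq_bigr => j _; rewrite xE.
Qed.

Lemma thickened_relaxed (delta : R) : 0 < delta -> exists2 e0 : R, 0 < e0 &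
  forall eps V, eps < e0 -> thickened_constraint dbar nu eps V ->
    relaxed_constraint nu delta V.
Proof.
move=> d0; case: dbarE => ->.
  by exists delta => // eps V; exact: prohorov_thickened_relaxed.
exists (delta ^+ 2 / (1 + delta)).
  by rewrite divr_gt0 ?exprn_gt0// addr_gt0.
by move=> eps V; exact: fortet_mourier_thickened_relaxed.
Qed.

Lemma mean_empirical_relaxed (W : probability E R) (n : nat) (eps e0 delta : R)
    (p := mean_seq W n.+1 \1_(sample_event dbar nu eps)) (Pi : probability E R) :
  (forall eps V, eps < e0 -> thickened_constraint dbar nu eps V ->
    relaxed_constraint nu delta V) ->
  eps < e0 -> 0 < p ->
  (forall g, bounded_measurable g -> mean Pi g = mean_seq W n.+1
     (fun s => \1_(sample_event dbar nu eps) s * \sum_(x <- s) g x) / (p * n.+1%:R)) ->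
  relaxed_constraint nu delta Pi.
Proof.
move=> He0 ee0 p0 PiE t F cF.
have mD : measurable_seq (sample_event dbar nu eps).
  by move=> k; exact: measurable_sample_event.
have mF : measurable (path_eval t @^-1` F : set E).
  rewrite -[X in measurable X]setTI.
  exact: (measurable_path_eval t measurableT (measurable_closed_rV cF)).
apply: (mean_empirical_set (ltn0Sn n) mD p0 PiE mF) => s sn Ds.
have := He0 _ _ ee0 Ds t F cF; rewrite fine_empirical sn /=.
have -> : \sum_(j < n.+1) \1_(path_eval t @^-1` F) (nth point s j) =
    \sum_(x <- s) \1_(path_eval t @^-1` F) x :> R.
  by rewrite (big_nth point) sn big_mkord.
by rewrite ler_pdivrMl.
Qed.

(** The limit of near minimisers satisfies the marginal constraint and its entropy is
compared with that of the projection through [relative_entropy_le_dv]. *)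
Lemma mean_near_I_projection (W Wstar : probability E R) (phi : E -> R) :
  is_I_projection W (marginal_constraint nu) Wstar -> bounded_measurable phi ->
  {ae W, forall x, log_density Wstar W x = (phi x)%:E} ->
  forall eta, 0 < eta -> exists m, forall V c h,
    relaxed_constraint nu m.+1%:R^-1 V -> dv_entropy_le W V c ->
    bounded_measurable h -> (forall x, `|h x| <= 1) ->
    (mean V h - mean Wstar h) ^+ 2 <= 16 * (c - mean Wstar phi + eta).
Proof.
move=> [CWs infE fin _] bphi phiE.
apply: (@mean_near_projection _ _ _ W Wstar (mean Wstar phi)
  (fun n => relaxed_constraint nu n.+1%:R^-1)).
- by move=> n V V' M KV KV' ME; exact: relaxed_constraint_midpoint KV KV' ME.
- move=> n m nm; apply: relaxed_constraint_le.
  by rewrite lef_pV2 ?posrE// ler_nat.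
- by move=> n; apply: marginal_constraint_relaxed.
- exact: dv_entropy_projection.
- move=> V_ V e c KV e0 VV ec.
  have CV := relaxed_constraint_lim KV e0 VV.
  rewrite -lee_fin -(relative_entropy_mean bphi phiE fin) infE.
  apply: le_trans (relative_entropy_le_dv (dv_entropy_dominates ec) ec).
  by apply: ereal_inf_lbound; exists V.
Qed.

End constraint_of_samples.

Section tuple_sets.
Context d (T : measurableType d) (R : realType).

Definition seq_set k (B : set (k.-tuple T)) : set (seq T) :=
  [set s | exists2 t : k.-tuple T, B t & val t = s].

Lemma seq_setE k (B : set (k.-tuple T)) : [set t : k.-tuple T | seq_set B t] = B.
Proof.
apply/seteqP; split => [t [t' Bt' /val_inj <-]//|t Bt]; by exists t.
Qed.

Lemma measurable_seq_set k (B : set (k.-tuple T)) : measurable B ->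
  measurable_seq (seq_set B).
Proof.
move=> mB n; have [nk|nk] := eqVneq n k; first by subst n; rewrite seq_setE.
rewrite (_ : [set t | _] = set0)//; apply/seteqP; split => // t [t' _ tt'].
by move/eqP: nk; apply; rewrite -(size_tuple t) -tt' size_tuple.
Qed.

Lemma measurable_seq_take (D B : set (seq T)) k : measurable_seq D ->
  measurable_seq B -> measurable_seq [set s | D s /\ B (take k s)].
Proof.
move=> mD mB n.
have m2 : measurable [set t : n.-tuple T | B (take k t)].
  rewrite -[X in measurable X]setTI.
  exact: (@measurable_take _ T k n measurableT _ (mB _)).
exact: (measurableI _ _ (mD n) m2).
Qed.

End tuple_sets.

Section conditional_law_of_sample.
Context d d' (Omega : measurableType d) (T : measurableType d') (R : realType).
Variables (P : probability Omega R) (W : probability T R) (X : nat -> {mfun Omega >-> T}).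
Hypothesis X_indep : mutually_independent P (fun j => X j : Omega -> T).
Hypothesis X_law : forall j A, measurable A -> distribution P (X j) A = W A.

Lemma conditional_lawE (k n : nat) (D : set (seq T)) (A : set Omega) (B : set (k.-tuple T)) :
  (k <= n)%N -> measurable_seq D -> measurable B ->
  (forall w, A w <-> D [tuple X j w | j < n]) ->
  conditional_law P (fun w => [tuple X j w | j < k]) A B =
  (mean_seq W n (fun t => \1_D t * \1_(seq_set B) (take k t)) / mean_seq W n \1_D)%:E.
Proof.
move=> kn mD mB AD.
have PA : P A = tuple_power W n [set t : n.-tuple T | D t].
  rewrite -(joint_law X_indep X_law (mD n)); congr (P _).
  by apply/seteqP; split => w; [exact: (AD w).1|exact: (AD w).2].
have mDB := measurable_seq_take k mD (measurable_seq_set mB).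
have PBA : P ((fun w => [tuple X j w | j < k]) @^-1` B `&` A) =
    tuple_power W n [set t : n.-tuple T | D t /\ seq_set B (take k t)].
  rewrite -(joint_law X_indep X_law (mDB n)); congr (P _).
  have takeE w : take k [tuple X j w | j < n] = [tuple X j w | j < k] :> seq T.
    apply: (@eq_from_nth _ point); first by rewrite size_take !size_tuple; case: ltngtP kn.
    move=> i; rewrite size_take size_tuple => ik.
    have {}ik : (i < k)%N by apply: leq_trans ik _; case: ltnP.
    rewrite nth_take// -[LHS](tnth_nth _ _ (Ordinal (leq_trans ik kn))).
    by rewrite -[RHS](tnth_nth _ _ (Ordinal ik)) !tnth_mktuple.
  apply/seteqP; split => w /=.
    move=> [Bw Aw]; split; first exact: (AD w).1.
    by rewrite takeE; exists [tuple X j w | j < k].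
  move=> [Dw]; rewrite takeE => -[t Bt /val_inj tX]; split; last exact: (AD w).2.
  by rewrite -tX.
rewrite /conditional_law PA PBA -(mean_seq_indic W n mD) -(mean_seq_indic W n mDB).
congr (_ / _)%:E; apply: eq_mean_seq => s _; rewrite !indicE -natrM mulnb.
congr (_%:R); congr nat_of_bool; apply/idP/andP; rewrite !inE.
  by move=> [].
by move=> [].
Qed.

End conditional_law_of_sample.

Theorem theorem5p6 (R : realType) (q : nat) (q_gt0 : (0 < q)%N)
  (mu0 : probability 'rV[R]_q R)
  (W : probability (path_space R q) R)
  (wienerW : is_wiener mu0 W)
  (d : measure_display) (Omega : measurableType d) (P : probability Omega R)
  (X : nat -> {mfun Omega >-> path_space R q})
  (X_indep : mutually_independent P (fun j => X j : Omega -> path_space R q))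
  (X_law : forall (j : nat) (A : set (path_space R q)), measurable A ->
     distribution P (X j) A = W A)
  (dbar : probability (path_space R q) R -> probability (path_space R q) R -> \bar R)
  (dbarE : dbar = prohorov \/ dbar = fortet_mourier)
  (nu : unit_itv R -> probability 'rV[R]_q R)
  (C_nonempty : marginal_constraint nu !=set0)
  (Wstar : probability (path_space R q) R)
  (projW : is_I_projection W (marginal_constraint nu) Wstar)
  (phi : path_space R q -> R)
  (phi_continuous : continuous phi)
  (phi_bounded : [bounded phi x | x in [set: path_space R q]])
  (phiE : {ae W, forall x, log_density Wstar W x = (phi x)%:E})
  (kappa m : R) (kappa_gt0 : 0 < kappa) (m_gt0 : 0 < m)
  (mu0_tail : forall rad : R, 0 < rad ->
     (mu0 (~` [set x | (enorm x < rad)%R]) <= (kappa / rad `^ m)%:E)%E)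
  (r : R) (r_gt0 : 0 < r) (r_lt : r < 1 / (2 * q%:R))
  (k : nat) (k_gt0 : (0 < k)%N) :
  let eps (n : nat) : R := 1 / (ln n%:R `^ r) in
  let event (n : nat) : set Omega :=
    [set w | thickened_constraint dbar nu (eps n.+1)
               (empirical n (fun j => X j w))] in
  tv_dist (conditional_law P (fun w => [tuple X j w | j < k]) (event n))
          (tuple_power Wstar k) @[n --> \oo] --> 0%E.
Proof.
move=> eps event; have [CWs _ fin _] := projW.
have bphi : bounded_measurable phi.
  split; first exact: measurable_continuous.
  have [M [_ HM]] := phi_bounded; exists (M + 1) => x; apply: HM => //.
  by rewrite ltrDl.
have WstarE := mean_density bphi phiE fin.
have r_half : r < 1 / 2.
  apply: lt_le_trans r_lt _; rewrite !div1r lef_pV2 ?posrE ?mulr_gt0 ?ltr0n//.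
  by rewrite ler_peMr// ler1n.
pose D n := sample_event dbar nu (eps n.+1).
have mD n : measurable_seq (D n) by move=> l; exact: measurable_sample_event.
have Drot n : rot_invariant (D n) by move=> l s; exact: sample_event_rot.
have K_mean : forall l, \forall n \near \oo, forall Pi : probability (path_space R q) R,
    0 < mean_seq W n.+1 \1_(D n) ->
    (forall g, bounded_measurable g -> mean Pi g =
       mean_seq W n.+1 (fun s => \1_(D n) s * \sum_(x <- s) g x) /
       (mean_seq W n.+1 \1_(D n) * n.+1%:R)) ->
    relaxed_constraint nu l.+1%:R^-1 Pi.
  move=> l; have l0 : 0 < l.+1%:R^-1 :> R by rewrite invr_gt0.
  have [e0 e00 He0] := thickened_relaxed nu dbarE l0.
  have [n0 _ Hn0] := log_scale_cvg0 r_gt0 e00.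
  exists n0 => // n /= n0n Pi; apply: (mean_empirical_relaxed dbarE He0).
  by apply: Hn0 => /=; exact: leqW.
have low eta : 0 < eta -> \forall n \near \oo,
    expR (- (n.+1%:R * (mean Wstar phi + eta))) <= mean_seq W n.+1 \1_(D n).
  exact: (sample_event_lower wienerW kappa_gt0 m_gt0 mu0_tail bphi WstarE dbarE CWs
    r_gt0 r_half).
have tv_le eta : 0 < eta -> \forall n \near \oo,
    (0 <= tv_dist (conditional_law P (fun w => [tuple X j w | j < k]) (event n))
          (tuple_power Wstar k) <= eta%:E)%E.
  move=> eta0.
  have G := gibbs_conditioning bphi WstarE mD Drot
    (K := fun n => relaxed_constraint nu n.+1%:R^-1)
    (mean_near_I_projection projW bphi phiE) K_mean low k_gt0 eta0.
  near=> n.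
  have [p0 Hn] : 0 < mean_seq W n.+1 \1_(D n) /\ forall B, measurable_seq B ->
      `|mean_seq W n.+1 (fun t => \1_(D n) t * \1_B (take k t)) / mean_seq W n.+1 \1_(D n) -
        mean_seq Wstar k \1_B| <= eta by near: n; exact: G.
  have kn : (k <= n.+1)%N by near: n; exists k => // n /= /leqW.
  have lawE B : measurable B ->
      conditional_law P (fun w => [tuple X j w | j < k]) (event n) B =
      (mean_seq W n.+1 (fun t => \1_(D n) t * \1_(seq_set B) (take k t)) /
        mean_seq W n.+1 \1_(D n))%:E.
    move=> mB; apply: (conditional_lawE X_indep X_law kn (mD n) mB) => w.
    exact: sample_eventE.
  apply/andP; split.
    apply: (@le_trans _ _ `|conditional_law P (fun w => [tuple X j w | j < k]) (event n) set0 -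
       tuple_power Wstar k set0|%E); first exact: abse_ge0.
    by apply: ereal_sup_ubound; exists set0.
  apply: ge_ereal_sup => _ [B mB <-]; rewrite lawE//.
  have := Hn _ (measurable_seq_set mB).
  rewrite (mean_seq_indic Wstar k (measurable_seq_set mB)) seq_setE.
  by rewrite -lee_fin; congr (_ <= _)%E; rewrite -(fine_prob (tuple_power Wstar k) mB).
have fin_tv : \forall n \near \oo,
    tv_dist (conditional_law P (fun w => [tuple X j w | j < k]) (event n))
          (tuple_power Wstar k) \is a fin_num.
  have := tv_le 1 ltr01; apply: filterS => n /andP[h1 h2].
  by rewrite ge0_fin_numE// (le_lt_trans h2)// ltry.
apply/fine_cvgP; split; first exact: fin_tv.
apply/cvgrPdist_le => eta eta0.
apply: filterS2 fin_tv (tv_le eta eta0) => n f /andP[h1 h2] /=.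
by rewrite sub0r normrN ger0_norm ?fine_ge0// -lee_fin fineK.
Unshelve. all: by end_near. Qed.
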